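(* There is an algorithm that solves the All-Targets Change-Making problem in $O(t^{4/3}\,\mathrm{polylog}\, t)$ time.
   Context: All-Targets Change-Making: given a set $V=\{v_1,\dots,v_n\}$ of $n$ distinct positive integers (coin values) and a positive integer $t$, output, for every $j=0,1,\dots,t$, the minimum of $\sum_{i=1}^n m_i$ over all $m_1,\dots,m_n\in\mathbb{N}=\{0,1,2,\dots\}$ with $\sum_{i=1}^n m_i v_i=j$ (i.e., the minimum number of coins, each coin value usable arbitrarily many times, summing to exactly $j$), or $\infty$ if no such $m_i$ exist.
   Formalization: The time bound O(t^{4/3} polylog t) is proved when all coin values are at most t; each coin value exceeding t may add a constant number of steps, since with V in arbitrary order an unbounded number of such coins cannot be read in time depending only on t. *)

(* Defs.v *)
From HB Require Import structures.
From mathcomp Require Import all_boot all_order all_algebra.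
From mathcomp Require Import all_classical all_reals all_analysis.

Set Implicit Arguments.
Unset Strict Implicit.
Unset Printing Implicit Defensive.

Local Open Scope nat_scope.

(** * A word RAM with [w]-bit words

    Words are the naturals below [2 ^ w].  A program has finitely many
    registers (the ones occurring in its text) and a memory addressed by words.
    Control flow is structured instead of being given by jumps, which changes
    running times by constant factors only.  A program is a fixed finite object
    that does not depend on [w] or on the input, and it is deterministic. *)

Inductive binop := WAdd | WSub | WMul | WDiv | WMod | WEq | WLt.

Inductive expr :=
  | Const of nat
  | Reg of nat
  | Read of expr
  | Bin of binop & expr & expr.

Inductive prog :=
  | Skip
  | Assign of nat & expr
  | Store of expr & expr
  | Seq of prog & prog
  | If of expr & prog & prog
  | While of expr & prog.

Record state := State { regs : nat -> nat; ram : nat -> nat }.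

Definition upd (f : nat -> nat) (x v : nat) : nat -> nat :=
  fun y => if y == x then v else f y.

(* Addition, subtraction and multiplication wrap around modulo [2 ^ w]; the
   conventions for a zero divisor are those of [%/] and [%%]. *)
Definition eval_binop (w : nat) (o : binop) (a b : nat) : nat :=
  match o with
  | WAdd => (a + b) %% 2 ^ w
  | WSub => (a + (2 ^ w - b)) %% 2 ^ w
  | WMul => (a * b) %% 2 ^ w
  | WDiv => a %/ b
  | WMod => a %% b
  | WEq => nat_of_bool (a == b) %% 2 ^ w
  | WLt => nat_of_bool (a < b) %% 2 ^ w
  end.

Fixpoint eval_expr (w : nat) (s : state) (e : expr) : nat :=
  match e with
  | Const n => n %% 2 ^ w
  | Reg x => regs s x
  | Read e1 => ram s (eval_expr w s e1)
  | Bin o e1 e2 => eval_binop w o (eval_expr w s e1) (eval_expr w s e2)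
  end.

Fixpoint cost (e : expr) : nat :=
  match e with
  | Const _ | Reg _ => 1
  | Read e1 => (cost e1).+1
  | Bin _ e1 e2 => (cost e1 + cost e2).+1
  end.

(* [exec w p s n s']: started in [s], the program [p] halts in [s'] after [n]
   unit-cost steps. *)
Inductive exec (w : nat) : prog -> state -> nat -> state -> Prop :=
  | exec_skip s :
      exec w Skip s 1 s
  | exec_assign x e s :
      exec w (Assign x e) s (cost e).+1
        (State (upd (regs s) x (eval_expr w s e)) (ram s))
  | exec_store e1 e2 s :
      exec w (Store e1 e2) s (cost e1 + cost e2).+1
        (State (regs s) (upd (ram s) (eval_expr w s e1) (eval_expr w s e2)))
  | exec_seq p1 p2 s n1 s1 n2 s2 :
      exec w p1 s n1 s1 -> exec w p2 s1 n2 s2 ->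
      exec w (Seq p1 p2) s (n1 + n2) s2
  | exec_if_true e p1 p2 s n s' :
      eval_expr w s e != 0 -> exec w p1 s n s' ->
      exec w (If e p1 p2) s (cost e + n).+1 s'
  | exec_if_false e p1 p2 s n s' :
      eval_expr w s e = 0 -> exec w p2 s n s' ->
      exec w (If e p1 p2) s (cost e + n).+1 s'
  | exec_while_true e p s n1 s1 n2 s2 :
      eval_expr w s e != 0 -> exec w p s n1 s1 -> exec w (While e p) s1 n2 s2 ->
      exec w (While e p) s (cost e + n1 + n2).+1 s2
  | exec_while_false e p s :
      eval_expr w s e = 0 ->
      exec w (While e p) s (cost e).+1 s.

(** * All-Targets Change-Making *)

Definition pays (V : seq nat) (j : nat) (m : 'I_(size V) -> nat) : Prop :=
  \sum_(i < size V) m i * nth 0 V i = j.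
Arguments pays : clear implicits.

(* [None] stands for infinity. *)
Definition is_min_coins (V : seq nat) (j : nat) (o : option nat) : Prop :=
  match o with
  | Some c =>
      (exists m, pays V j m /\ \sum_(i < size V) m i = c) /\
      (forall m, pays V j m -> c <= \sum_(i < size V) m i)
  | None => forall m, ~ pays V j m
  end.

(* A coin set is given as a duplicate-free array, in arbitrary order. *)
Definition coin_set (V : seq nat) : Prop := uniq V /\ all (fun v => 0 < v) V.

(* Memory initially holds [t], [n], [v_1], ..., [v_n] in cells 0 to [n + 1];
   everything else is zero. *)
Definition input (t : nat) (V : seq nat) : state :=
  State (fun=> 0) (nth 0 [:: t, size V & V]).

(* Cell [j] of the output holds 0 for infinity and [c + 1] for the value [c]. *)
Definition encode (o : option nat) : nat := if o is Some c then c.+1 else 0.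

Definition output (t : nat) (V : seq nat) (s : state) : Prop :=
  forall j, j <= t ->
    exists o, is_min_coins V j o /\ ram s j = encode o.

(* Words have at least [c] times logarithmically many bits in the size of the
   instance, and each coin value fits in a word.  There is no upper bound on
   [w], but as a program has to cope with all admissible word sizes it cannot
   take advantage of long words. *)
Definition word_size (c w t : nat) (V : seq nat) : Prop :=
  c * up_log 2 (t + size V).+1 <= w /\ all (fun v => v < 2 ^ w) V.

(* [T t] bounds the running time for target [t] when no coin exceeds [t].
   Coins exceeding [t] are useless, but may be present in any number, and
   scanning past each of them costs at most [a] extra steps. *)
Definition solves_all_targets (p : prog) (c a : nat) (T : nat -> nat) : Prop :=
  forall (w t : nat) (V : seq nat),
    0 < t -> coin_set V -> word_size c w t V ->
    exists (n : nat) (s : state),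
      [/\ exec w p (input t V) n s,
          n <= T t + a * count (fun v => t < v) V &
          output t V s].

(* Main.v *)
Require Import Defs.
From mathcomp Require Import all_boot all_order all_algebra.
From mathcomp Require Import all_classical all_reals all_analysis.
From mathcomp Require Import algC cyclotomic zify ring lra.
Import numFieldNormedType.Exports.

(** Let L be the least integer with L^3 >= t.  Coins of value at least L^2 occur
    at most L times in a sum up to t.  The smaller coins are cut into L buckets
    of width L, and the extreme coins of each bucket are called special: there
    are at most 2L of them.  Every multiset of coins can be changed, keeping its
    sum and its size, until it has O(L log t) small coins that are not special.
    Indeed, if a < z are the special coins of a bucket, then among L others of
    that bucket some have values x with the sum of the x - a divisible by z - a,
    and these can be replaced by copies of a and z.  So each bucket contributes
    fewer than L, and only O(log t) distinct values occur, since otherwise two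
    sets of values have the same sum and the same size and one can be exchanged
    for the other.

    Hence all sums of k coins for k up to R = O(L log t) are found by R Boolean
    convolutions of length O(t), and afterwards each special coin is added by
    one pass of the textbook recurrence.  A convolution takes time O(t polylog t)
    by Nussbaumer's algorithm: Z[x]/(x^(mr) + 1) is mapped to polynomials in z
    over S = Z[y]/(y^m + 1) by x |-> z, x^r |-> y, and these are multiplied by a
    fast Fourier transform of length 2r that uses a power of y as root of unity;
    the 2r products in S, with m about the square root of the length, are done
    in the same way.  All this is ring arithmetic and works modulo 2^w; a Boolean
    convolution needs no division by the power of two that the inverse transforms
    introduce. *)

Set Implicit Arguments.
Unset Strict Implicit.
Unset Printing Implicit Defensive.
Local Open Scope nat_scope.

(** * Few coins besides the special ones *)

(** The cut-off L balances about L log t convolutions of length O(t) against one O(t) pass for each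
    of the 2L special coins. A round of convolution adds only one coin, so the rounds can afford
    only the few coins left besides the special ones; a pass of the recurrence allows any
    multiplicity of its coin. Exchanges keep sum and size, hence all minima; what needs care is that
    they come to an end, and one potential has to rise under both kinds.

    Quotient rings are never built: an array is judged by its values at an arbitrary x with x^N = -1
    in a commutative ring, where blocks become values at y = x^r. Only at the end do the N complex
    roots give back the coefficients.

    Halving the exponent of the block length gives about log log t levels, so doubling the array at
    each level costs just a logarithmic factor. The inverse transforms leave every coefficient
    multiplied by 2^(e + lev - 1), which could make it vanish modulo 2^w; the logarithmic lower
    bound on w keeps all scaled coefficients below 2^w, so that being positive can still be
    tested. *)

Lemma zero_sum_infix (l : nat) (e : seq nat) : 0 < l -> l <= size e ->
  exists B1 B B2, [/\ e = B1 ++ B ++ B2, 0 < size B & l %| sumn B].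
Proof.
move=> l0 le.
(* Pigeonhole: the l + 1 prefix sums of lengths 0 to l cannot all differ modulo l, and two equal
   ones delimit the infix. *)
pose f i := sumn (take i e) %% l.
have : ~~ uniq (map f (iota 0 l.+1)).
  apply/negP => /uniq_leq_size U.
  have /U : {subset map f (iota 0 l.+1) <= iota 0 l}.
    by move=> y /mapP[i _ ->]; rewrite mem_iota /= add0n ltn_mod.
  by rewrite size_map !size_iota ltnn.
case/(uniqPn 0) => i [k [lik]]; rewrite size_map size_iota => kl.
rewrite !(nth_map 0) ?size_iota ?(ltn_trans lik) // !nth_iota ?(ltn_trans lik) // !add0n => E.
exists (take i e), (drop i (take k e)), (drop k e); split.
- by rewrite catA -{1}(cat_take_drop k e) -{1}(cat_take_drop i (take k e)) take_takel // ltnW.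
- by rewrite size_drop size_take_min; lia.
- have : sumn (take k e) = sumn (take i e) + sumn (drop i (take k e)).
    by rewrite -sumn_cat -{1}(cat_take_drop i (take k e)) take_takel // ltnW.
  move=> E2; move: E; rewrite /f E2 => /eqP.
  rewrite -{1}[sumn (take i e)]addn0 eqn_modDl mod0n eq_sym; by [].
Qed.

Lemma sum_pow2_lt (X : seq nat) (k : nat) :
  sorted gtn X -> all (fun x => x < k) X -> \sum_(x <- X) 2 ^ x < 2 ^ k.
Proof.
elim: X k => [|x X IH] k; first by rewrite big_nil expn_gt0.
rewrite /= => pX /andP[xk _]; rewrite big_cons.
have aX : all (fun y => y < x) X.
  by apply: (order_path_min _ pX) => a b c /= h1 h2; apply: ltn_trans h2 h1.
have := IH x (path_sorted pX) aX => h.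
apply: (@leq_trans (2 ^ x.+1)); last by rewrite leq_exp2l.
by rewrite expnS; lia.
Qed.

(** Uniqueness of binary expansions: the largest exponent outweighs all smaller ones together, so
    the selections agree on it, and so on downwards. *)
Lemma mask_sum_pow2_inj (X : seq nat) (m1 m2 : bitseq) :
  sorted gtn X -> size m1 = size X -> size m2 = size X ->
  \sum_(x <- mask m1 X) 2 ^ x = \sum_(x <- mask m2 X) 2 ^ x -> m1 = m2.
Proof.
elim: X m1 m2 => [|x X IH] [|a m1] [|b m2] //= pX [s1] [s2].
have aX : all (fun y => y < x) X.
  by apply: (order_path_min _ pX) => ? ? ? /= h1 h2; apply: ltn_trans h2 h1.
have tr : transitive gtn by move=> ? ? ? /= h1 h2; apply: ltn_trans h2 h1.
have sX := path_sorted pX.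
have lt m : \sum_(i <- mask m X) 2 ^ i < 2 ^ x.
  by apply: sum_pow2_lt; [exact: (subseq_sorted tr (mask_subseq m X)) | apply: all_mask].
case: a b => [] [] /=; rewrite ?big_cons.
- by move/addnI => /IH -> .
- by have := lt m2; lia.
- by have := lt m1; lia.
- by move=> /IH ->.
Qed.

Lemma sum_lt_size (g : nat -> nat) (M : nat) (s : seq nat) :
  0 < size s -> all (fun x => g x < M) s -> \sum_(x <- s) g x < size s * M.
Proof.
case: s => // x s _ /= /andP[gx gs]; rewrite big_cons mulSn.
rewrite -addSn; apply: leq_add => //.
elim: s gs => [|y s IH]; first by rewrite big_nil.
by move=> /= /andP[/ltnW gy /IH h]; rewrite big_cons mulSn leq_add.
Qed.

Section Exchange.
Variables (C : pred nat) (L Q : nat).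
Hypothesis L0 : 0 < L.

Definition in_bucket b x := C x && (x %/ L == b).

(** [iota 0 (L * L)] contains all members of the buckets concerned, which makes being extreme a
    boolean test. Values from [L * L] on are neither special nor [plain]. *)
Definition special x :=
  [&& C x, x < L * L &
   all (fun y => in_bucket (x %/ L) y ==> (x <= y)) (iota 0 (L * L)) ||
   all (fun y => in_bucket (x %/ L) y ==> (y <= x)) (iota 0 (L * L))].

Definition plain x := (x < L * L) && ~~ special x.

Lemma bucket_lt b x : b < L -> x %/ L = b -> x < L * L.
Proof. by move=> bL E; rewrite -ltn_divLR // E. Qed.

Lemma bucket_extremes b x : b < L -> in_bucket b x ->
  exists a z, [/\ special a, special z, in_bucket b a, in_bucket b z &
    forall y, in_bucket b y -> a <= y <= z].
Proof.
move=> bL xb.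
have ub y : in_bucket b y -> y <= L * L.
  by case/andP=> _ /eqP /(bucket_lt bL) /ltnW.
case: (ex_minnP (ex_intro _ x xb)) => a ab amin.
case: (ex_maxnP (ex_intro _ x xb) ub) => z zb zmax.
case/andP: (ab) => Ca /eqP Ea; case/andP: (zb) => Cz /eqP Ez.
exists a, z; split=> //.
- apply/and3P; split=> //; first exact: bucket_lt bL Ea.
  apply/orP; left; apply/allP => y _; apply/implyP; rewrite Ea; exact: amin.
- apply/and3P; split=> //; first exact: bucket_lt bL Ez.
  apply/orP; right; apply/allP => y _; apply/implyP; rewrite Ez; exact: zmax.
- by move=> y yb; rewrite amin // zmax.
Qed.

(* The potential that increases with each exchange; the powers of two tell sets
   of values apart. *)
Definition weight x := if plain x then 2 ^ x else 2 ^ (L * L).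

Lemma weight_le x : weight x <= 2 ^ (L * L).
Proof. by rewrite /weight; case: ifP => // /andP[/ltnW h _]; rewrite leq_exp2l. Qed.

Lemma weight_lt x : plain x -> weight x < 2 ^ (L * L).
Proof. by rewrite /weight => px; rewrite px; case/andP: px => h _; rewrite ltn_exp2l. Qed.

Definition improves (s s' : seq nat) :=
  [/\ all C s', sumn s' = sumn s, size s' = size s &
      \sum_(x <- s) weight x < \sum_(x <- s') weight x].

Lemma improves_swap (s X Y r : seq nat) : perm_eq s (X ++ r) -> all C s -> all C Y ->
  sumn X = sumn Y -> size X = size Y ->
  \sum_(x <- X) weight x < \sum_(x <- Y) weight x -> exists s', improves s s'.
Proof.
move=> ps Cs CY sXY zXY w; exists (Y ++ r); split.
- by move: Cs; rewrite (perm_all _ ps) !all_cat => /andP[_ ->]; rewrite CY.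
- by rewrite (perm_sumn ps) !sumn_cat sXY.
- by rewrite (perm_size ps) !size_cat zXY.
- by rewrite (perm_big _ ps) /= !big_cat /= ltn_add2r.
Qed.

Lemma sum_sub (B : seq nat) a : all (fun x => a <= x) B ->
  sumn B = size B * a + sumn (map (fun x => x - a) B).
Proof. by elim: B => //= x B IH /andP[h /IH ->]; lia. Qed.

Lemma crowded_bucket (s : seq nat) b : all C s -> b < L ->
  L <= count (fun x => plain x && (x %/ L == b)) s -> exists s', improves s s'.
Proof.
move=> Cs bL.
set f := seq.filter (fun x => plain x && (x %/ L == b)) s.
rewrite -size_filter -/f => szf.
have fC x : x \in f -> [/\ plain x, in_bucket b x & C x].
  rewrite mem_filter => /andP[/andP[px xb] xs].
  by have Cx := allP Cs _ xs; split=> //; rewrite /in_bucket Cx.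
have [x xf] : exists x, x \in f.
  case: (f) szf => [|y f' _]; first by rewrite leqNgt L0.
  by exists y; rewrite mem_head.
have [px xb _] := fC _ xf.
have [a [z [sa sz ab zb lim]]] := bucket_extremes bL xb.
have nsp y : special y -> plain y = false by move=> h; rewrite /plain h andbF.
(* A plain coin is not extreme, so the bucket has two different extremes and the modulus z - a is
   positive. *)
have ltaz : a < z.
  have xa : x != a by apply/eqP => E; move: px; rewrite E nsp.
  have /andP[h1 h2] := lim x xb.
  by rewrite (leq_trans _ h2) // ltn_neqAle eq_sym xa.
(* Values in a bucket of width L are this close, so the L coins at hand suffice for the pigeonhole
   argument modulo z - a. *)
have lL : z - a <= L.
  case/andP: ab => _ /eqP Ea; case/andP: zb => _ /eqP Ez.
  have := divn_eq a L; have := divn_eq z L; rewrite Ea Ez.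
  by have := ltn_pmod z L0; lia.
have za0 : 0 < z - a by rewrite subn_gt0.
have zaf : z - a <= size (map (fun x => x - a) f) by rewrite size_map; apply: leq_trans szf.
have [B1 [B [B2 [E B0 dv]]]] := zero_sum_infix za0 zaf.
have [f1 [f2 [f3 [Ef Eb]]]] : exists f1 f2 f3, f = f1 ++ f2 ++ f3 /\ B = map (fun x => x - a) f2.
  exists (take (size B1) f), (take (size B) (drop (size B1) f)), (drop (size B) (drop (size B1) f)).
  split; first by rewrite !cat_take_drop.
  by rewrite map_take map_drop E drop_size_cat // take_size_cat.
have f2C y : y \in f2 -> y \in f by move=> h; rewrite Ef !mem_cat h orbT.
have a2 : all (fun y => a <= y) f2.
  by apply/allP => y /f2C /fC[_ /lim /andP[]].
have Es := sum_sub a2.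
rewrite -Eb in Es.
case/dvdnP: dv => q Eq.
have szB : size B = size f2 by rewrite Eb size_map.
(* Each offset x - a is at most z - a, so the replacement needs no more copies of z than there are
   coins to replace; copies of a make up the number. *)
have qle : q <= size f2.
  have : sumn B <= size B * (z - a).
    rewrite Eb.
    have : all (fun y => y <= z) f2 by apply/allP => y /f2C /fC[_ /lim /andP[]].
    elim: (f2) => //= y g IH /andP[h /IH]; rewrite mulSn; apply: leq_add.
    exact: leq_sub2r.
  by rewrite Eq szB leq_pmul2r // subn_gt0.
apply: (@improves_swap s f2 (nseq q z ++ nseq (size f2 - q) a)
   (f1 ++ f3 ++ seq.filter (predC (fun x => plain x && (x %/ L == b))) s)) => //.
- have pf : perm_eq (f ++ seq.filter (predC (fun x => plain x && (x %/ L == b))) s) s.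
    by apply/permPl; exact: perm_filterC.
  rewrite perm_sym; apply: perm_trans pf.
  by rewrite Ef -!catA perm_catCA.
- rewrite all_cat !all_nseq.
  by case/andP: ab => -> _; case/andP: zb => -> _; rewrite !orbT.
- rewrite sumn_cat !sumn_nseq Es Eq.
  have -> : z * q = q * (z - a) + a * q.
    by rewrite (mulnC a) -mulnDr subnK ?(ltnW ltaz) // mulnC.
  by rewrite (mulnBr a) -addnA subnKC ?leq_mul2l ?qle ?orbT // addnC (mulnC a).
- by rewrite size_cat !size_nseq subnKC.
(* The potential rises because a and z have the maximal weight and every plain coin has less. *)
- rewrite big_cat /= !big_nseq !iter_addn_0.
  rewrite /weight !nsp // -mulnDr subnKC // mulnC.
  have : all plain f2 by apply/allP => y /f2C /fC[].
  move=> pl; apply: sum_lt_size; first by rewrite -szB.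
  by apply/allP => y /(allP pl) py; have := weight_lt py; rewrite /weight py.
Qed.

Hypothesis Qbig : Q.+1 * (Q * (L * L)).+1 < 2 ^ Q.

(** [Qbig] compares the pairs of a size and a sum open to subsets of Q values with the 2^Q subsets.
    An exchange is possible in either direction; different subsets have different sums of powers of
    two, so one direction raises the potential. The two subsets may overlap, common values being
    replaced by themselves. *)
Lemma many_types (s : seq nat) : all C s ->
  Q <= size (undup (seq.filter plain s)) -> exists s', improves s s'.
Proof.
move=> Cs szU.
pose U := sort geq (undup (seq.filter plain s)).
pose X := take Q U.
have szX : size X = Q by rewrite size_take_min size_sort; apply/minn_idPl.
have uU : uniq U by rewrite sort_uniq undup_uniq.
have sU : sorted gtn U.
  rewrite gtn_sorted_uniq_geq uU; apply: sort_sorted.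
  by move=> a b; rewrite /= leq_total.
have tr : transitive gtn by move=> ? ? ? /= h1 h2; apply: ltn_trans h2 h1.
have sX : sorted gtn X by apply: (subseq_sorted tr (take_subseq U Q)).
have uX : uniq X by apply: take_uniq.
have XU x : x \in X -> (plain x /\ x \in s).
  by move=> /mem_take; rewrite mem_sort mem_undup mem_filter => /andP[].
pose f (m : Q.-tuple bool) : 'I_Q.+1 * 'I_(Q * (L * L)).+1 :=
  (inord (size (mask m X)), inord (sumn (mask m X))).
have : ~~ injectiveb f.
  apply/negP => /injectiveP /leq_card.
  by rewrite card_prod !card_ord card_tuple card_bool leqNgt Qbig.
case/injectivePn => m1 [m2 m12 [/(congr1 val) /= E1 /(congr1 val) /= E2]].
have szm (m : Q.-tuple bool) : size (mask m X) <= Q.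
  by rewrite -[X in _ <= X]szX (size_subseq (mask_subseq m X)).
have smm (m : Q.-tuple bool) : sumn (mask m X) <= Q * (L * L).
  apply: (@leq_trans (size (mask m X) * (L * L))); last by rewrite leq_mul2r szm orbT.
  have : all plain (mask m X) by apply/allP => x /mem_mask /XU[].
  elim: (mask m X) => //= x g IH /andP[/andP[/ltnW h _] /IH]; rewrite mulSn; lia.
rewrite !inordK ?ltnS // in E1 E2.
have Wm (m : Q.-tuple bool) : \sum_(x <- mask m X) weight x = \sum_(x <- mask m X) 2 ^ x.
  apply: eq_big_seq => x /mem_mask /XU[px _]; by rewrite /weight px.
have go (n1 n2 : Q.-tuple bool) : size (mask n1 X) = size (mask n2 X) ->
    sumn (mask n1 X) = sumn (mask n2 X) ->
    \sum_(x <- mask n1 X) 2 ^ x < \sum_(x <- mask n2 X) 2 ^ x -> exists s', improves s s'.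
  move=> e1 e2 lt.
  have [r pr] : exists r, perm_eq s (mask n1 X ++ r).
    (* A subset of X uses each value once, and each value of X occurs in s, so the subset can be
       split off from s. *)
    have /count_subseqP [u us pu] : forall x, count_mem x (mask n1 X) <= count_mem x s.
      move=> x; rewrite count_uniq_mem ?mask_uniq //.
      case: (boolP (x \in mask n1 X)) => // /mem_mask /XU[_].
      by rewrite -has_pred1 has_count.
    have [r pr] := perm_to_subseq us; exists r.
    apply: (perm_trans pr); by rewrite perm_cat2r perm_sym.
  apply: improves_swap pr _ _ e2 e1 _ => //.
  - by apply/allP => x /mem_mask /XU[_ /(allP Cs)].
  - by rewrite !Wm.
case: (ltngtP (\sum_(x <- mask m1 X) 2 ^ x) (\sum_(x <- mask m2 X) 2 ^ x)) => lt.
- exact: (go m1 m2).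
- exact: (go m2 m1).
- have := mask_sum_pow2_inj sX _ _ lt; rewrite !size_tuple szX => /(_ erefl erefl) /val_inj E.
  by rewrite E eqxx in m12.
Qed.

Lemma count_by_class (T : eqType) (K : seq T) (g : nat -> T) (p : pred nat) (M : nat) (s : seq nat) :
  (forall x, x \in s -> p x -> g x \in K) ->
  (forall k, k \in K -> count (fun x => p x && (g x == k)) s <= M) ->
  count p s <= size K * M.
Proof.
elim: K s => [|k K IH] s h1 h2.
  rewrite mul0n leqn0 -leqn0 leqNgt -has_count; apply/hasPn => x xs; apply/negP => /(h1 x xs).
  by rewrite in_nil.
rewrite mulSn.
have -> : count p s = count (fun x => p x && (g x == k)) s +
    count p (seq.filter (fun x => g x != k) s).
  elim: s {h1 h2} => //= x s ->; case: eqP => _ /=; case: (p x) => //=; lia.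
apply: leq_add; first by apply: h2; rewrite mem_head.
apply: IH => [x|k' k'K].
  rewrite mem_filter => /andP[xk xs] px; have := h1 x xs px.
  by rewrite inE (negbTE xk).
apply: leq_trans (h2 k' _); last by rewrite inE k'K orbT.
rewrite count_filter; apply: sub_count => x /=; by case/andP => /andP[-> ->].
Qed.

(** Induction on the distance of the potential from its maximum [size s * 2 ^ (L * L)]. When no
    exchange applies, fewer than Q values occur, hence fewer than Q buckets, each with fewer than L
    plain coins. *)
Lemma few_plain (s : seq nat) : all C s ->
  exists s', [/\ all C s', sumn s' = sumn s, size s' = size s & count plain s' <= Q * L].
Proof.
pose bnd (s : seq nat) := size s * 2 ^ (L * L) - \sum_(x <- s) weight x.
have ub (u : seq nat) : \sum_(x <- u) weight x <= size u * 2 ^ (L * L).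
  elim: u => [|x u IH]; first by rewrite big_nil.
  by rewrite big_cons /= mulSn leq_add // weight_le.
have [n] := ubnP (bnd s); elim: n s => // n IH s; rewrite ltnS => bn Cs.
have again : (exists s', improves s s') ->
  exists s', [/\ all C s', sumn s' = sumn s, size s' = size s & count plain s' <= Q * L].
  case=> s1 [C1 e1 z1 w1].
  have : bnd s1 < n.
    apply: leq_trans bn; rewrite /bnd z1.
    by have := ub s1; have := ub s; rewrite z1; lia.
  by move/IH => /(_ C1) [s2 [? e2 z2 ?]]; exists s2; split=> //; rewrite ?e2 ?z2.
case: (leqP Q (size (undup (seq.filter plain s)))) => [h|lt].
  exact: again (many_types Cs h).
case: (boolP (has (fun b => L <= count (fun x => plain x && (x %/ L == b)) s) (iota 0 L))).
  case/hasP => b; rewrite mem_iota add0n => /andP[_ bL] /(crowded_bucket Cs bL); exact: again.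
move/hasPn => few; exists s; split=> //.
apply: (@leq_trans (size (undup (map (fun x => x %/ L) (undup (seq.filter plain s)))) * L)); last first.
  rewrite leq_mul2r (leq_trans (size_undup _)) ?orbT // size_map; exact: ltnW.
apply: (count_by_class (g := fun x => x %/ L)).
- move=> x xs px; rewrite mem_undup; apply: map_f; by rewrite mem_undup mem_filter px.
- move=> b; rewrite mem_undup => /mapP [x]; rewrite mem_undup mem_filter => /andP[/andP[lx _] _ ->].
  apply: ltnW; rewrite ltnNge; apply: few.
  by rewrite mem_iota add0n /= ltn_divLR.
Qed.

Lemma few_not_special (s : seq nat) t : t <= L * (L * L) -> sumn s <= t -> all C s ->
  exists s1 s2, [/\ all C s1, all special s2, sumn s1 + sumn s2 = sumn s,
    size s1 + size s2 = size s & size s1 <= Q.+1 * L].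
Proof.
move=> tL st Cs.
have [s' [C' e' z' c']] := few_plain Cs.
exists (seq.filter (predC special) s'), (seq.filter special s').
have pp : perm_eq (seq.filter (predC special) s' ++ seq.filter special s') s'.
  rewrite perm_catC; apply/permPl; exact: perm_filterC.
split.
- by apply/allP => x; rewrite mem_filter => /andP[_ /(allP C')].
- by apply: filter_all.
- by rewrite -sumn_cat (perm_sumn pp) e'.
- by rewrite -size_cat (perm_size pp) z'.
- rewrite size_filter.
  (* A coin that is not special is plain or at least [L * L]; the second kind accounts for the
     additional L in [Q.+1 * L]. *)
  have -> : count (predC special) s' = count plain s' + count (fun x => L * L <= x) s'.
    elim: (s') => //= x u ->; rewrite /plain ltnNge.
    case: leqP => /= h; last by rewrite add0n addnA.
    by rewrite /special ltnNge h andbF /=; lia.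
  have big : count (fun x => L * L <= x) s' * (L * L) <= sumn s'.
    by elim: (s') => //= x u; case: leqP => h; lia.
  rewrite mulSn addnC leq_add // -(@leq_pmul2r (L * L)) ?muln_gt0 ?L0 //.
  by rewrite (leq_trans big) // e' (leq_trans st).
Qed.
End Exchange.

Import GRing.Theory.

(** * Fast negacyclic products *)

Section SumReindexing.
Variable K : comPzRingType.
Local Open Scope ring_scope.

Lemma sum_ord_mul (m r : nat) (G : nat -> K) :
  \sum_(q < (m * r)%N) G q = \sum_(j < m) \sum_(i < r) G (j * r + i)%N.
Proof.
rewrite -(big_mkord predT G) big_nat_mul big_mkord; apply: eq_bigr => j _.
rewrite -(big_mkord predT (fun i => G (j * r + i)%N)) -[X in \sum_(X <= _ < _) _]add0n.
rewrite big_addn mulSn addnK; apply: eq_bigr => i _; by rewrite addnC.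
Qed.

Lemma sum_rotate (m c : nat) (G : nat -> K) :
  \sum_(j < m) G ((j + c) %% m)%N = \sum_(j < m) G j.
Proof.
case: m => [|m]; first by rewrite !big_ord0.
pose h (j : 'I_m.+1) : 'I_m.+1 := Ordinal (ltn_pmod (j + c) (ltn0Sn m)).
rewrite [RHS](reindex_inj (h := h)) //.
move=> i j /(congr1 val) /= /eqP; rewrite eqn_modDr !modn_small // => /eqP.
exact: val_inj.
Qed.

Lemma sum_even_odd (h : nat) (G : nat -> K) :
  \sum_(i < (2 * h)%N) G i = \sum_(i < h) G (2 * i)%N + \sum_(i < h) G (2 * i).+1.
Proof.
rewrite [in LHS]mulnC sum_ord_mul -big_split /=; apply: eq_bigr => i _.
by rewrite !big_ord_recl big_ord0 /= addr0 addn0 mulnC addn1.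
Qed.

(** A geometric sum without division, as K may have zero divisors: the sum is the product of the
    factors 1 + z^(2^n) for n < b, and the factor for n = a is zero. *)
Lemma sum_root_powers (z : K) (a b : nat) : (a < b)%N -> z ^+ (2 ^ a) = -1 ->
  \sum_(l < (2 ^ b)%N) z ^+ l = 0.
Proof.
have dbl n : \sum_(l < (2 ^ n.+1)%N) z ^+ l =
    (1 + z ^+ (2 ^ n)) * \sum_(l < (2 ^ n)%N) z ^+ l.
  rewrite expnSr mulnC sum_ord_mul !big_ord_recl big_ord0 addr0 mulrDl mul1r.
  congr (_ + _).
  by rewrite mulr_sumr; apply: eq_bigr => i _; rewrite -exprD mul1n.
move=> ab za; elim: b ab => // b IH; rewrite ltnS leq_eqVlt => /orP[/eqP <-|/IH h].
  by rewrite dbl za subrr mul0r.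
by rewrite dbl h mulr0.
Qed.

(** A root of unity of the right order would not do in a ring with zero divisors; th^(2^d) = -1
    does. If s = k 2^a with k odd, then a <= d and the power 2^(d - a) of th^s is again -1. *)
Lemma sum_root_orthogonal (th : K) (d s : nat) : th ^+ (2 ^ d) = -1 ->
  (0 < s < 2 ^ d.+1)%N -> \sum_(l < (2 ^ d.+1)%N) (th ^+ s) ^+ l = 0.
Proof.
move=> thd /andP[s0 sd].
pose a := logn 2 s.
have ad : (a <= d)%N.
  rewrite -ltnS -(@ltn_exp2l 2) //; apply: leq_ltn_trans sd; apply: dvdn_leq => //.
  by rewrite pfactor_dvdn.
apply: (@sum_root_powers _ (d - a)); first by rewrite ltnS leq_subr.
have [k ks Es] : exists2 k, odd k & s = (k * 2 ^ a)%N.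
  have [k kc E] := pfactor_coprime (isT : prime 2) s0.
  by exists k => //; move: kc; rewrite coprime2n.
rewrite -exprM {1}Es -mulnA -expnD subnKC // mulnC exprM thd -signr_odd ks.
by rewrite expr1.
Qed.
End SumReindexing.

Section Steps.
Implicit Types (f g : nat -> int).
Local Open Scope ring_scope.

(* Blocks of length [m] hold elements of Z[y]/(y^m + 1).  The coefficients of
   block [k] are extended to exponents below [2 * m] by [y^m = -1]. *)
Definition negacyc m f k u : int := (1 - 2 * (u %/ m)%N%:Z) * f (k * m + u %% m)%N.

(* [x^(j r + i)] becomes [z^i y^j]; the upper half of each group of [2 r] blocks is
   zero, so that products do not wrap around in the transform of length [2 r]. *)
Definition lift_step N r m f i : int :=
  let q := (i %/ m)%N in
  if (q %% (2 * r) < r)%N then f (q %/ (2 * r) * N + (i %% m * r + q %% (2 * r)))%N else 0.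

(* Stockham's self-sorting layer from length [h] to length [2 h]; with
   [d = 2 m - 1] the root of unity is a power of [y], with [d = 1] its inverse. *)
Definition fft_layer m r h d f i : int :=
  let q := (i %/ m)%N in
  let l := (q %% (2 * r) %% (2 * h))%N in
  let k := (q %/ (2 * r) * (2 * r) + (q %% (2 * r) %/ (2 * h) * h + l %% h))%N in
  f (k * m + i %% m)%N + negacyc m f (k + r) ((i %% m + m %/ h * l * d) %% (2 * m))%N.

(** Substitutes z = x and y = x^r. Since z^r becomes y, block k + r is added to block k after
    multiplication by y; reading it with the shift 2m - 1, that is -1 modulo 2m, performs this
    multiplication. *)
Definition unlift_step N r m f i : int :=
  let k := (i %/ N * (2 * r) + i %% N %% r)%N in
  let j := (i %% N %/ r)%N in
  f (k * m + j)%N + negacyc m f (k + r) ((j + (2 * m).-1) %% (2 * m))%N.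

(** The product in Z[x]/(x^2 + 1); the factor 2j - 1 is the sign -1 for the constant coefficient and
    +1 for the linear one. *)
Definition base_mul f g i : int :=
  let q := (i %/ 2)%N in let j := (i %% 2)%N in
  f (q * 2)%N * g i + (2 * j%:Z - 1) * (f (q * 2 + 1)%N * g (q * 2 + (1 - j))%N).

Fixpoint fft m r d s f :=
  if s is s'.+1 then fft_layer m r (2 ^ s') d (fft m r d s' f) else f.
End Steps.

(** * Evaluation at elements x with x^N = -1 *)

Section Evaluation.
Variable K : comPzRingType.
Implicit Types (f : nat -> int) (x y : K).
Local Open Scope ring_scope.

(** Stands for the class of block k in Z[x]/(x^N + 1), provided that x^N = -1. *)
Definition ev N f k x : K := \sum_(j < N) (f (k * N + j)%N)%:~R * x ^+ j.

Lemma expr_negacyc m (x : K) u : x ^+ m = -1 -> (u < 2 * m)%N ->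
  x ^+ u = (1 - 2 * (u %/ m)%N%:Z)%:~R * x ^+ (u %% m).
Proof.
move=> xm um.
have m0 : (0 < m)%N by case: m um {xm} => //; rewrite muln0.
rewrite {1}(divn_eq u m) exprD mulnC exprM xm; congr (_ * _).
have : (u %/ m < 2)%N by rewrite ltn_divLR.
by case: (u %/ m)%N => [|[|]] // _; rewrite ?expr0 ?expr1.
Qed.

Lemma expr_2m m (x : K) : x ^+ m = -1 -> x ^+ (2 * m) = 1.
Proof. by move=> xm; rewrite mulnC exprM xm sqrrN expr1n. Qed.

(** Multiplication by a power of x only rotates the 2m signed coefficients. This is why a transform
    whose root of unity is a power of x needs no multiplications in the ring. *)
Lemma ev_negacyc m f k c e x : x ^+ m = -1 -> (e + c = 0 %[mod 2 * m])%N ->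
  \sum_(j < m) (negacyc m f k ((j + c) %% (2 * m))%N)%:~R * x ^+ j = x ^+ e * ev m f k x.
Proof.
move=> xm ec; rewrite /ev mulr_sumr.
rewrite -(sum_rotate m c (fun j => x ^+ e * ((f (k * m + j)%N)%:~R * x ^+ j))).
apply: eq_bigr => j _.
have m0 : (0 < m)%N by apply: leq_ltn_trans (ltn_ord j).
set u := ((j + c) %% (2 * m))%N.
have um : (u < 2 * m)%N by rewrite ltn_mod muln_gt0.
have -> : ((j + c) %% m = u %% m)%N by rewrite /u modn_dvdm // dvdn_mull.
have xj : x ^+ j = x ^+ (e + u).
  have x2 := expr_2m xm.
  rewrite -(expr_mod (e + u) x2) -(expr_mod j x2); congr (_ ^+ _).
  by rewrite /u modnDmr addnCA -modnDmr ec modnDmr addn0.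
have sgn : (1 - 2 * (u %/ m)%N%:Z) * (1 - 2 * (u %/ m)%N%:Z) = 1.
  have : (u %/ m < 2)%N by rewrite ltn_divLR.
  by case: (u %/ m)%N => [|[|]].
rewrite xj exprD (expr_negacyc xm um) /negacyc rmorphM /=.
set s := _%:~R; set F := _%:~R; set X := x ^+ e; set Y := x ^+ _.
have ss : s * s = 1 by rewrite /s -rmorphM /= sgn.
transitivity (s * s * (F * X * Y)); first by ring.
by rewrite ss mul1r; ring.
Qed.

Lemma mod_small_add a b m : (b < m)%N -> ((a * m + b) %% m = b)%N.
Proof. by move=> h; rewrite modnMDl modn_small. Qed.

Lemma div_small_add a b m : (b < m)%N -> ((a * m + b) %/ m = a)%N.
Proof. by move=> h; rewrite divnMDl ?(leq_ltn_trans _ h) // divn_small // addn0. Qed.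

Lemma ev_lift_step N r m f b i y : (i < 2 * r)%N ->
  ev m (lift_step N r m f) (b * (2 * r) + i) y =
  if (i < r)%N then \sum_(j < m) (f (b * N + (j * r + i))%N)%:~R * y ^+ j else 0.
Proof.
move=> ir; rewrite /ev.
have E (j : 'I_m) : lift_step N r m f ((b * (2 * r) + i) * m + j)%N =
    if (i < r)%N then f (b * N + (j * r + i))%N else 0.
  by rewrite /lift_step mod_small_add // div_small_add // mod_small_add // div_small_add.
case: ifP => ir2; last by rewrite big1 // => j _; rewrite E ir2 mul0r.
by apply: eq_bigr => j _; rewrite E ir2.
Qed.

Lemma ev_split N r m f b x : N = (m * r)%N ->
  ev N f b x = \sum_(i < r) x ^+ i * \sum_(j < m) (f (b * N + (j * r + i))%N)%:~R * (x ^+ r) ^+ j.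
Proof.
move=> EN; pose G q := (f (b * N + q)%N)%:~R * x ^+ q.
transitivity (\sum_(q < (m * r)%N) G q); first by rewrite -EN.
rewrite sum_ord_mul exchange_big /=; apply: eq_bigr => i _.
rewrite mulr_sumr; apply: eq_bigr => j _.
by rewrite /G exprD -exprM (mulnC r); ring.
Qed.

Lemma ev_unlift_step N r m f b x : (0 < m)%N -> N = (m * r)%N -> x ^+ N = -1 ->
  ev N (unlift_step N r m f) b x =
  \sum_(i < (2 * r)%N) x ^+ i * ev m f (b * (2 * r) + i) (x ^+ r).
Proof.
move=> m0 EN xN.
have ym : (x ^+ r) ^+ m = -1 by rewrite -exprM mulnC -EN.
rewrite (ev_split _ _ _ EN).
rewrite (sum_ord_mul 2 r (fun i => x ^+ i * ev m f (b * (2 * r) + i) (x ^+ r))) !big_ord_recl big_ord0 addr0 -big_split /=.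
apply: eq_bigr => i _; rewrite mul0n add0n mul1n exprD -mulrA (mulrCA (x ^+ r)) -mulrDr.
congr (_ * _).
rewrite -[X in X * _]expr1 -(@ev_negacyc m f _ (2 * m).-1 1 _ ym); last first.
  by rewrite add1n prednK ?muln_gt0 // modnn mod0n.
rewrite /ev -big_split /=; apply: eq_bigr => j _.
have lt : (j * r + i < N)%N.
  rewrite EN; apply: (@leq_trans (j.+1 * r)); last by rewrite leq_mul2r ltn_ord orbT.
  by rewrite mulSn addnC ltn_add2r.
rewrite -mulrDl -rmorphD /= /unlift_step mod_small_add // div_small_add //.
by rewrite mod_small_add // div_small_add // -(addnA (b * _)%N) (addnC i r).
Qed.

(** The butterfly with both outputs in one formula: l runs up to 2h, and for odd d the power of the
    root contributes the usual minus sign when l reaches h. *)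
Lemma ev_fft_layer m r h d f g p l y : (0 < m)%N -> (h %| m)%N -> (2 * h %| 2 * r)%N ->
  y ^+ m = -1 -> (d <= 2 * m)%N -> (p < 2 * r %/ (2 * h))%N -> (l < 2 * h)%N ->
  ev m (fft_layer m r h d f) (g * (2 * r) + (p * (2 * h) + l)) y =
  ev m f (g * (2 * r) + (p * h + l %% h)) y +
  (y ^+ (2 * m - d)) ^+ (m %/ h * l) *
  ev m f (g * (2 * r) + ((p + 2 * r %/ (2 * h)) * h + l %% h)) y.
Proof.
move=> m0 hm hr ym dm pl lh.
have pos : (p * (2 * h) + l < 2 * r)%N.
  apply: (@leq_trans (p.+1 * (2 * h))); first by rewrite mulSn addnC ltn_add2r.
  by rewrite -leq_divRL // (leq_ltn_trans _ lh).
have h0 : (0 < h)%N by case: h lh {hm hr pl pos} => //; rewrite muln0.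
rewrite -exprM -(@ev_negacyc m f _ (m %/ h * l * d) _ _ ym); last first.
  by rewrite mulnC -mulnDr subnK // modnMl mod0n.
rewrite /ev -big_split /=; apply: eq_bigr => j _.
rewrite -mulrDl -rmorphD; congr (_%:~R * _).
rewrite /fft_layer mod_small_add // div_small_add // mod_small_add // div_small_add //.
rewrite mod_small_add // div_small_add //.
congr (_ + negacyc _ _ _ _).
rewrite -!addnA; congr (_ + _)%N; rewrite mulnDl -!addnA; congr (_ + _)%N.
rewrite addnC; congr (_ + _)%N.
by rewrite divnMl // divnK //; move: hr; rewrite dvdn_pmul2l.
Qed.

(** The index p names the subsequence of stride [2 ^ (D.+1 - s)] starting at p. Its even and odd
    members are two subsequences of twice the stride, transformed by one layer less. At s = D + 1
    only p = 0 is left, and the whole transform appears in natural order. *)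
Lemma ev_fft m D d f g y s : (2 ^ D %| m)%N -> (0 < m)%N -> y ^+ m = -1 -> (d <= 2 * m)%N ->
  odd d -> (s <= D.+1)%N -> forall p l, (p < 2 ^ (D.+1 - s))%N -> (l < 2 ^ s)%N ->
  ev m (fft m (2 ^ D) d s f) (g * (2 * 2 ^ D) + (p * 2 ^ s + l)) y =
  \sum_(i < (2 ^ s)%N) ev m f (g * (2 * 2 ^ D) + (p + i * 2 ^ (D.+1 - s))) y *
    (y ^+ (2 * m - d)) ^+ (2 * m %/ 2 ^ s * l * i).
Proof.
move=> Dm m0 ym dm od; set eta := y ^+ _.
have em : eta ^+ m = -1.
  by rewrite /eta -exprM mulnC exprM ym -signr_odd oddB // oddM /= od expr1.
elim: s => [_ p l _|s IH].
  rewrite expn0 ltnS leqn0 => /eqP ->.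
  by rewrite big_ord_recl big_ord0 /= muln0 !mul0n expr0 mulr1 addr0 muln1.
move=> sD p l pl ls.
have sm : (2 ^ s %| m)%N by apply: dvdn_trans Dm; apply: dvdn_exp2l.
have E2 : (2 * 2 ^ D %/ (2 * 2 ^ s) = 2 ^ (D.+1 - s.+1))%N.
  by rewrite -!expnS -expnB.
have lm : (l %% 2 ^ s < 2 ^ s)%N by rewrite ltn_mod expn_gt0.
have Es : (2 ^ (D.+1 - s) = 2 * 2 ^ (D.+1 - s.+1))%N.
  by rewrite subSS -expnS subSn.
rewrite /= expnS ev_fft_layer // -?expnS //; last 2 first.
- by apply: dvdn_exp2l.
- by rewrite !expnS E2.
rewrite -/eta !expnS E2.
rewrite IH ?(ltnW sD) //; last by rewrite Es mul2n -addnn ltn_addr.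
rewrite IH ?(ltnW sD) //; last by rewrite Es mul2n -addnn ltn_add2r.
(* As eta^(2m) = 1, the transform of length 2^s is periodic in l with period 2^s, so both halves of
   the longer one can use it. *)
have modl i : eta ^+ (2 * m %/ 2 ^ s * (l %% 2 ^ s) * i) =
    eta ^+ (2 * m %/ 2 ^ s * l * i) :> K.
  have e2 := expr_2m em.
  have EW : (2 * m = 2 * m %/ 2 ^ s * 2 ^ s)%N by rewrite divnK // dvdn_mull.
  have -> : (2 * m %/ 2 ^ s * l * i =
      2 * m * (l %/ 2 ^ s * i) + 2 * m %/ 2 ^ s * (l %% 2 ^ s) * i)%N.
    move: EW; set W := (2 * m %/ 2 ^ s)%N => EW; rewrite {1}(divn_eq l (2 ^ s)) EW; ring.
  by rewrite exprD (exprM _ (2 * m)) e2 expr1n mul1r.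
rewrite (sum_even_odd (2 ^ s) (fun i => ev m f (g * (2 * 2 ^ D) + (p + i * 2 ^ (D.+1 - s.+1))) y *
  eta ^+ (2 * m %/ (2 * 2 ^ s) * l * i))).
rewrite divnMl //.
have EW : (2 * m %/ 2 ^ s = 2 * (m %/ 2 ^ s))%N by rewrite muln_divA.
rewrite mulr_sumr; congr (_ + _); apply: eq_bigr => i _.
- rewrite modl Es EW.
  by congr (ev _ _ _ _ * _ ^+ _); ring.
- rewrite modl mulrCA -exprD Es EW.
  by congr (ev _ _ _ _ * _ ^+ _); ring.
Qed.

(** With the upper halves zero, i + j stays below the length of the transform, so the cyclic
    convolution is the ordinary one. The factor on the right is what an inverse transform would
    divide by. *)
Lemma cyclic_convolution (D : nat) (al be : nat -> K) (z z' : K) k :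
  z ^+ (2 ^ D) = -1 -> z * z' = 1 -> (k < 2 ^ D.+1)%N ->
  (forall i, (2 ^ D <= i)%N -> al i = 0) -> (forall i, (2 ^ D <= i)%N -> be i = 0) ->
  \sum_(l < (2 ^ D.+1)%N) (\sum_(i < (2 ^ D.+1)%N) al i * z ^+ (l * i)) *
    (\sum_(i < (2 ^ D.+1)%N) be i * z ^+ (l * i)) * z' ^+ (k * l) =
  (2 ^ D.+1)%:R *
  \sum_(i < (2 ^ D.+1)%N) \sum_(j < (2 ^ D.+1)%N) if (i + j == k)%N then al i * be j else 0.
Proof.
move=> zD zz kD al0 be0.
have z'D : z' ^+ (2 ^ D) = -1.
  have : z ^+ (2 ^ D) * z' ^+ (2 ^ D) = 1 by rewrite -exprMn zz expr1n.
  by rewrite zD mulN1r => /eqP; rewrite eqr_oppLR => /eqP.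
have S i j : (i < 2 ^ D)%N -> (j < 2 ^ D)%N ->
    \sum_(l < (2 ^ D.+1)%N) (z ^+ (i + j) * z' ^+ k) ^+ l =
    if (i + j == k)%N then (2 ^ D.+1)%:R else 0.
  move=> iD jD; have ij : (i + j < 2 ^ D.+1)%N by rewrite expnS mul2n -addnn; lia.
  case: (ltngtP (i + j) k) => h.
  - have -> : z ^+ (i + j) * z' ^+ k = z' ^+ (k - (i + j)).
      by rewrite -{1}(subnKC (ltnW h)) (exprD z') mulrA -exprMn zz expr1n mul1r.
    by apply: sum_root_orthogonal => //; rewrite subn_gt0 h (leq_ltn_trans (leq_subr _ _)).
  - have -> : z ^+ (i + j) * z' ^+ k = z ^+ (i + j - k).
      by rewrite -{1}(subnK (ltnW h)) (exprD _ (i + j - k)) -mulrA -exprMn zz expr1n mulr1.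
    by apply: sum_root_orthogonal => //; rewrite subn_gt0 h (leq_ltn_trans (leq_subr _ _)).
  - rewrite h -exprMn zz expr1n (eq_bigr (fun=> 1)) => [|l _]; last by rewrite expr1n.
    by rewrite sumr_const card_ord.
transitivity (\sum_(l < (2 ^ D.+1)%N) \sum_(i < (2 ^ D.+1)%N) \sum_(j < (2 ^ D.+1)%N)
    al i * be j * (z ^+ (i + j) * z' ^+ k) ^+ l).
  apply: eq_bigr => l _; rewrite -mulrA mulr_suml; apply: eq_bigr => i _.
  rewrite mulrA mulr_sumr mulr_suml; apply: eq_bigr => j _.
  rewrite exprMn -!exprM mulnDl exprD !(mulnC l); ring.
rewrite exchange_big /= mulr_sumr; apply: eq_bigr => i _.
rewrite exchange_big /= mulr_sumr; apply: eq_bigr => j _.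
rewrite -mulr_sumr.
case: (leqP (2 ^ D) i) => iD; first by rewrite al0 // !mul0r if_same mulr0.
case: (leqP (2 ^ D) j) => jD; first by rewrite be0 // mulr0 !mul0r if_same mulr0.
by rewrite S //; case: ifP => _; rewrite ?mulr0 // mulrC.
Qed.

End Evaluation.

(** * The levels of Nussbaumer's algorithm *)

Section Levels.
Variable K : comPzRingType.
Implicit Types (f a b c : nat -> int) (x y : K).
Local Open Scope ring_scope.

Definition level_down D m f := fft m (2 ^ D) (2 * m - 1) D.+1 (lift_step (m * 2 ^ D) (2 ^ D) m f).
Definition level_up D m c := unlift_step (m * 2 ^ D) (2 ^ D) m (fft m (2 ^ D) 1 D.+1 c).

(** It does not matter how the blockwise products in [c] came about, and [kap] collects the powers
    of two of the inner levels; thus the levels can be stacked. *)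
Lemma ev_level_up D m a b c kap g x : (0 < m)%N -> (2 ^ D %| m)%N ->
  x ^+ (m * 2 ^ D) = -1 ->
  (forall k, ev m c k (x ^+ (2 ^ D)) =
     kap * ev m (level_down D m a) k (x ^+ (2 ^ D)) * ev m (level_down D m b) k (x ^+ (2 ^ D))) ->
  ev (m * 2 ^ D) (level_up D m c) g x =
  kap * (2 ^ D.+1)%:R * ev (m * 2 ^ D) a g x * ev (m * 2 ^ D) b g x.
Proof.
move=> m0 Dm xN hc; set y := x ^+ _ in hc.
have ym : y ^+ m = -1 by rewrite /y -exprM mulnC.
have y2 := expr_2m ym.
pose F := (2 ^ D.+1)%N.
have EF : (2 * 2 ^ D = F)%N by rewrite /F expnS.
(* F is the length 2r of the transform. z^r = y^m = -1, and z' is the inverse of z because y^(2m) =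
   1. *)
pose z := y ^+ (2 * m %/ F); pose z' := (y ^+ (2 * m - 1)) ^+ (2 * m %/ F).
have Fm : (2 * m %/ F * 2 ^ D = m)%N.
  by rewrite -EF divnMl // divnK.
have zD : z ^+ (2 ^ D) = -1 by rewrite /z -exprM Fm.
have zz : z * z' = 1.
  rewrite /z /z' -exprMn -exprS -addn1 subnK ?y2 ?expr1n //.
  by rewrite muln_gt0.
have DFT d f l : odd d -> (d <= 2 * m)%N -> (l < F)%N ->
    ev m (fft m (2 ^ D) d D.+1 f) (g * F + l) y =
    \sum_(i < F) ev m f (g * F + i) y * ((y ^+ (2 * m - d)) ^+ (2 * m %/ F)) ^+ (l * i).
  move=> od dm lF; have := @ev_fft K m D d f g y D.+1 Dm m0 ym dm od (leqnn _) 0 l.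
  rewrite subnn expn0 mul0n add0n EF -/F => -> //.
  by apply: eq_bigr => i _; rewrite add0n muln1 -mulnA -!exprM mulnA.
(* The factor changes nothing for i < F, where lifted arrays already vanish in the upper half; it
   makes the sequence vanish for all larger i as well. *)
pose al i := ev m (lift_step (m * 2 ^ D) (2 ^ D) m a) (g * F + i) y * (i < 2 ^ D)%:R.
pose be i := ev m (lift_step (m * 2 ^ D) (2 ^ D) m b) (g * F + i) y * (i < 2 ^ D)%:R.
have liftE f i : (i < F)%N ->
    ev m (lift_step (m * 2 ^ D) (2 ^ D) m f) (g * F + i) y =
    ev m (lift_step (m * 2 ^ D) (2 ^ D) m f) (g * F + i) y * (i < 2 ^ D)%:R.
  move=> iF; rewrite -EF ev_lift_step ?EF //.
  by case: ifP => _; rewrite ?mulr1 ?mul0r.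
have down f l : (l < F)%N -> ev m (level_down D m f) (g * F + l) y =
    \sum_(i < F) (ev m (lift_step (m * 2 ^ D) (2 ^ D) m f) (g * F + i) y * (i < 2 ^ D)%:R) *
      z ^+ (l * i).
  move=> lF; rewrite /level_down DFT //; last 2 first.
  - by rewrite oddB ?muln_gt0 // oddM.
  - by rewrite leq_subr.
  rewrite subKn ?muln_gt0 // expr1 -/z.
  by apply: eq_bigr => i _; rewrite [in LHS]liftE.
have split f : ev (m * 2 ^ D) f g x =
    \sum_(i < F) ev m (lift_step (m * 2 ^ D) (2 ^ D) m f) (g * F + i) y * (i < 2 ^ D)%:R * x ^+ i.
  rewrite (@ev_split _ _ (2 ^ D) m) // -EF.
  rewrite (sum_ord_mul 2 (2 ^ D) (fun i => ev m (lift_step (m * 2 ^ D) (2 ^ D) m f)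
     (g * (2 * 2 ^ D) + i) y * (i < 2 ^ D)%:R * x ^+ i)).
  rewrite !big_ord_recl big_ord0 addr0 /= [X in _ + X]big1 ?addr0 => [|i _]; last first.
    by rewrite mul1n ltnNge leq_addr /= mulr0 mul0r.
  apply: eq_bigr => i _; rewrite mul0n add0n ltn_ord mulr1 ev_lift_step.
    by rewrite ltn_ord mulrC.
  by apply: leq_trans (ltn_ord i) _; rewrite leq_pmull.
rewrite /level_up (@ev_unlift_step _ _ (2 ^ D) m) // EF -/y.
have al0 i : (2 ^ D <= i)%N -> al i = 0 by rewrite /al ltnNge => ->; rewrite mulr0.
have be0 i : (2 ^ D <= i)%N -> be i = 0 by rewrite /be ltnNge => ->; rewrite mulr0.
transitivity (\sum_(k < F) x ^+ k * (kap * (F%:R *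
   \sum_(i < F) \sum_(j < F) if (i + j == k)%N then al i * be j else 0))).
  apply: eq_bigr => k _; rewrite DFT ?muln_gt0 // -/z'.
  rewrite -(@cyclic_convolution K D al be z z' k) //.
  congr (_ * _); rewrite mulr_sumr; apply: eq_bigr => l _.
  by rewrite hc !down // !mulrA.
rewrite !split -/F.
rewrite -(mulrA (kap * _)) mulr_suml.
rewrite (eq_bigr (fun k : 'I_F => (kap * F%:R) *
   \sum_(i < F) \sum_(j < F) if (i + j == k)%N then al i * be j * x ^+ (i + j) else 0)); last first.
  move=> k _; rewrite mulrCA; rewrite -!mulrA; congr (_ * _); rewrite mulrCA; congr (_ * _).
  rewrite mulr_sumr; apply: eq_bigr => i _; rewrite mulr_sumr; apply: eq_bigr => j _.
  by case: eqP => [->|_]; rewrite ?mulr0 // mulrC.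
rewrite -mulr_sumr; congr (_ * _).
rewrite exchange_big /=; apply: eq_bigr => i _.
rewrite exchange_big /= mulr_sumr; apply: eq_bigr => j _.
rewrite -big_mkcond /=.
transitivity (al i * be j * x ^+ (i + j)); last first.
  by rewrite /al /be exprD; ring.
case: (leqP (2 ^ D) i) => iD; first by rewrite al0 // !mul0r big1.
case: (leqP (2 ^ D) j) => jD; first by rewrite be0 // mulr0 mul0r big1.
have ij : (i + j < F)%N by apply: (leq_trans (_ : _ < 2 ^ D + 2 ^ D)%N); [lia | rewrite -EF mul2n addnn].
by rewrite (big_pred1 (Ordinal ij)) // => k; rewrite eq_sym.
Qed.

Lemma ev_base_mul a b k x : x ^+ 2 = -1 ->
  ev 2 (base_mul a b) k x = ev 2 a k x * ev 2 b k x.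
Proof.
move=> x2; rewrite /ev !big_ord_recl !big_ord0 !addr0 /= expr0 expr1 /base_mul.
rewrite addn0 modnMl mulnK // /bump /= modnMDl divnMDl // divn_small // modn_small // !addn0.
rewrite subn0 (_ : 2 * 0%:Z - 1 = -1) // (_ : 2 * 1%:Z - 1 = 1) // mulN1r mul1r.
rewrite !(rmorphD, rmorphM, rmorphN) /=.
set a0 := (a _)%:~R; set a1 := (a _)%:~R; set b0 := (b _)%:~R; set b1 := (b _)%:~R.
have E : (a0 * 1 + a1 * x) * (b0 * 1 + b1 * x) = a0 * b0 + a1 * b1 * x ^+ 2 + (a0 * b1 + a1 * b0) * x.
  by ring.
by rewrite E x2; ring.
Qed.

Variable e : nat.
(** The exponent of the block length at level q. Rounding up makes the new block length m at least
    r, so r divides m and some power of y is a 2r-th root of unity. *)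
Definition width q := iter q uphalf e.

Lemma width_half q : width q = (width q.+1 + (width q)./2)%N.
Proof. by rewrite /width /= -[in LHS](odd_double_half (iter q uphalf e)) uphalf_half -addnn addnA. Qed.

Lemma pow_width q : (2 ^ width q = 2 ^ width q.+1 * 2 ^ (width q)./2)%N.
Proof. by rewrite -expnD -width_half. Qed.

Lemma half_width_le q : ((width q)./2 <= width q.+1)%N.
Proof. by rewrite /width /= uphalf_half leq_addl. Qed.

Fixpoint down q f :=
  if q is q'.+1 then level_down (width q')./2 (2 ^ width q) (down q' f) else f.

Fixpoint up q c :=
  if q is q'.+1 then up q' (level_up (width q')./2 (2 ^ width q) c) else c.

(** The exponent of the power of two left behind: each level contributes the length
    [2 ^ (width q')./2.+1] of its transform. *)
Fixpoint gain q := if q is q'.+1 then ((width q')./2.+1 + gain q')%N else 0%N.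

Lemma ev_up q a b c kap :
  (forall k x, x ^+ (2 ^ width q) = -1 -> ev (2 ^ width q) c k x =
     kap * ev (2 ^ width q) (down q a) k x * ev (2 ^ width q) (down q b) k x) ->
  forall k x, x ^+ (2 ^ e) = -1 ->
  ev (2 ^ e) (up q c) k x = kap * (2 ^ gain q)%:R * ev (2 ^ e) a k x * ev (2 ^ e) b k x.
Proof.
elim: q c kap => [|q IH] c kap hc k x xe; first by rewrite /= hc // expn0 mulr1.
rewrite /= (IH _ (kap * (2 ^ (width q)./2.+1)%:R)) // => [|{}k {xe}x xe].
  by rewrite expnD natrM !mulrA.
rewrite (pow_width q) (@ev_level_up _ _ (down q a) (down q b) _ kap) ?expn_gt0 //.
- by apply: dvdn_exp2l; apply: half_width_le.
- by rewrite -pow_width.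
- move=> k'; apply: hc; by rewrite -exprM mulnC -pow_width.
Qed.
End Levels.

(** * From values back to coefficients *)

Section Product.
Local Open Scope ring_scope.

(** The odd powers of a primitive 2N-th root of unity are N distinct zeros of the difference, a
    polynomial of degree below N. *)
Lemma ev_coef_inj N (f g : nat -> int) : (0 < N)%N ->
  (forall x : algC, x ^+ N = -1 -> ev N f 0 x = \sum_(i < N) (g i)%:~R * x ^+ i) ->
  forall i, (i < N)%N -> f i = g i.
Proof.
move=> N0 h i iN.
have [z pz] := C_prim_root_exists (isT : (0 < (2 * N.-1.+1))%N).
rewrite prednK // in pz.
have zN : z ^+ N = -1.
  have := prim_expr_order pz; rewrite mulnC exprM => /eqP; rewrite -subr_eq0 subr_sqr_1.
  rewrite mulf_eq0 subr_eq0 -(prim_order_dvd pz) addr_eq0 => /orP[/dvdn_leq|/eqP //].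
  by move=> /(_ N0); lia.
pose p : {poly algC} := \poly_(j < N) ((f j)%:~R - (g j)%:~R).
have p0 : p = 0.
  apply/eqP/negPn/negP => pn0.
  have := max_poly_roots pn0 (rs := [seq z ^+ (2 * j).+1 | j <- iota 0 N]).
  rewrite size_map size_iota => H.
  have := leq_ltn_trans (size_poly N (fun j => (f j)%:~R - (g j)%:~R : algC)) (H _ _).
  rewrite ltnn => H'; apply: notF; apply: H'.
    apply/allP => _ /mapP[j _ ->]; rewrite /root horner_poly.
    under eq_bigr do rewrite mulrBl.
    rewrite sumrB subr_eq0; apply/eqP; rewrite -h; first by apply: eq_bigr.
    by rewrite -exprM mulnC exprM zN -signr_odd /= oddM.
  rewrite map_inj_in_uniq ?iota_uniq // => j k; rewrite !mem_iota !add0n => jN kN /eqP.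
  rewrite (eq_prim_root_expr pz) !modn_small; lia.
have := congr1 (fun q : {poly algC} => q`_i) p0.
rewrite coef_poly iN coef0 => /eqP; rewrite subr_eq0 eqr_int => /eqP //.
Qed.

(** Both factors have degree at most t, and 2t < 2^e, so reduction modulo x^(2^e) + 1 does not
    affect the product. Width 1 means blocks of length 2, where [base_mul] takes over. *)
Lemma product_coef e lev (a b : nat -> int) t : (2 * t < 2 ^ e)%N -> width e lev = 1%N ->
  (forall i, (t < i < 2 ^ e)%N -> a i = 0) -> (forall i, (t < i < 2 ^ e)%N -> b i = 0) ->
  forall i, (i < 2 ^ e)%N ->
  up e lev (base_mul (down e lev a) (down e lev b)) i =
  (2 ^ gain e lev)%:R * \sum_(p < t.+1) \sum_(q < t.+1) if (p + q == i)%N then a p * b q else 0.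
Proof.
move=> te wl a0 b0; apply: ev_coef_inj; first by rewrite expn_gt0.
move=> x xe.
have trunc (f : nat -> int) : (forall i, (t < i < 2 ^ e)%N -> f i = 0) ->
    ev (2 ^ e) f 0 x = \sum_(i < t.+1) (f i)%:~R * x ^+ i.
  move=> f0; rewrite /ev -(big_mkord predT (fun i => (f (0 * 2 ^ e + i)%N)%:~R * x ^+ i)).
  rewrite (@big_cat_nat _ _ _ t.+1) //=; last by lia.
  rewrite big_mkord [X in _ + X](_ : _ = 0) ?addr0 //.
  rewrite big_nat_cond big1 // => i /andP[/andP[h1 h2] _].
  by rewrite mul0n add0n f0 ?mul0r // h1.
rewrite (@ev_up _ e lev a b _ 1) //; last first.
  by move=> k y; rewrite wl => y2; rewrite mul1r ev_base_mul.
rewrite mul1r !trunc //.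
rewrite -mulrA mulr_suml.
transitivity (\sum_(i < (2 ^ e)%N) \sum_(p < t.+1) \sum_(q < t.+1)
    if (p + q == i)%N then (2 ^ gain e lev)%:R * ((a p)%:~R * (b q)%:~R * x ^+ (p + q)) else 0).
  rewrite exchange_big /= mulr_sumr; apply: eq_bigr => p _.
  rewrite exchange_big /= mulr_sumr mulr_sumr; apply: eq_bigr => q _.
  rewrite -big_mkcond /=.
  have pq : (p + q < 2 ^ e)%N by have := ltn_ord p; have := ltn_ord q; lia.
  rewrite (big_pred1 (Ordinal pq)) ?exprD; first by ring.
  by move=> k; rewrite eq_sym.
apply: eq_bigr => i _; rewrite rmorphM /= rmorph_sum /= mulr_sumr mulr_suml.
apply: eq_bigr => p _; rewrite rmorph_sum mulr_sumr mulr_suml; apply: eq_bigr => q _.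
case: eqP => [->|_]; last by rewrite rmorph0 mulr0 mul0r.
by rewrite rmorphM /= mulrz_nat !mulrA.
Qed.
End Product.

(** * Weakest preconditions with costs *)

Notation "a [+] b" := (Bin WAdd a b) (at level 50, left associativity).
Notation "a [-] b" := (Bin WSub a b) (at level 50, left associativity).
Notation "a [*] b" := (Bin WMul a b) (at level 40, left associativity).
Notation "a [/] b" := (Bin WDiv a b) (at level 40, left associativity).
Notation "a [%] b" := (Bin WMod a b) (at level 40, left associativity).
Notation "a [<] b" := (Bin WLt a b) (at level 70, no associativity).
Notation "p ;; q" := (Seq p q) (at level 95, right associativity).
Notation "x ::= e" := (Assign x e) (at level 90, no associativity).

Section Wp.
Variable w : nat.

(** Total correctness with a time budget instead of an exact time, so that branches of different
    cost share one bound. *)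
Definition wp (p : prog) (c : nat) (Q : state -> Prop) (s : state) : Prop :=
  exists n s', [/\ exec w p s n s', n <= c & Q s'].

Lemma wp_weaken p c c' (Q Q' : state -> Prop) s :
  c <= c' -> (forall s', Q s' -> Q' s') -> wp p c Q s -> wp p c' Q' s.
Proof.
move=> cc QQ [n [s' [ex nc qs]]]; exists n, s'; split=> //; first exact: leq_trans cc.
exact: QQ.
Qed.

Lemma wp_le p c c' (Q : state -> Prop) s : wp p c Q s -> c <= c' -> wp p c' Q s.
Proof. by move=> h cc; apply: wp_weaken cc _ h. Qed.

Lemma wp_skip (Q : state -> Prop) s : Q s -> wp Skip 1 Q s.
Proof. by move=> q; exists 1, s; split=> //; constructor. Qed.

Lemma wp_assign x e (Q : state -> Prop) s :
  Q (State (upd (regs s) x (eval_expr w s e)) (ram s)) -> wp (x ::= e) (cost e).+1 Q s.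
Proof. by move=> q; eexists _, _; split; [constructor| |exact: q]. Qed.

Lemma wp_store e1 e2 (Q : state -> Prop) s :
  Q (State (regs s) (upd (ram s) (eval_expr w s e1) (eval_expr w s e2))) ->
  wp (Store e1 e2) (cost e1 + cost e2).+1 Q s.
Proof. by move=> q; eexists _, _; split; [constructor| |exact: q]. Qed.

Lemma wp_seq p1 p2 c1 c2 (Q : state -> Prop) s :
  wp p1 c1 (wp p2 c2 Q) s -> wp (p1 ;; p2) (c1 + c2) Q s.
Proof.
move=> [n1 [s1 [ex1 le1 [n2 [s2 [ex2 le2 q]]]]]]; exists (n1 + n2), s2; split=> //.
  exact: exec_seq ex1 ex2.
exact: leq_add.
Qed.

Lemma wp_if e p1 p2 c (Q : state -> Prop) s :
  (eval_expr w s e != 0 -> wp p1 c Q s) -> (eval_expr w s e = 0 -> wp p2 c Q s) ->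
  wp (If e p1 p2) (cost e + c).+1 Q s.
Proof.
move=> h1 h2; case: (eqVneq (eval_expr w s e) 0) => E.
  have [n [s' [ex le q]]] := h2 E; exists (cost e + n).+1, s'; split=> //.
    exact: exec_if_false.
  by rewrite ltnS leq_add2l.
have [n [s' [ex le q]]] := h1 E; exists (cost e + n).+1, s'; split=> //.
  exact: exec_if_true.
by rewrite ltnS leq_add2l.
Qed.

(** All loops of the program run a number of times that is known beforehand, so an invariant indexed
    by the iteration also settles termination. *)
Lemma wp_while (e : expr) (p : prog) (c k : nat) (I : nat -> state -> Prop) s :
  (forall i s, i < k -> I i s -> eval_expr w s e != 0 /\ wp p c (I i.+1) s) ->
  (forall s, I k s -> eval_expr w s e = 0) ->
  I 0 s -> wp (While e p) (k * (cost e + c).+1 + (cost e).+1) (I k) s.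
Proof.
move=> hI hk; suff H j : forall i s, i + j = k -> I i s ->
    wp (While e p) (j * (cost e + c).+1 + (cost e).+1) (I k) s by move=> h0; apply: (H k 0).
elim: j => [|j IH] i {}s.
  rewrite addn0 => -> Is; exists (cost e).+1, s; split=> //.
  by apply: exec_while_false; apply: hk.
rewrite addnS => ij Is.
have ik : i < k by rewrite -ij ltnS leq_addr.
have [e0 [n1 [s1 [ex1 le1 I1]]]] := hI i s ik Is.
have [n2 [s2 [ex2 le2 I2]]] := IH i.+1 s1 ij I1.
exists (cost e + n1 + n2).+1, s2; split=> //; first exact: exec_while_true ex1 ex2.
by rewrite mulSn; lia.
Qed.

Lemma eval_const s n : n < 2 ^ w -> eval_expr w s (Const n) = n.
Proof. exact: modn_small. Qed.

Lemma eval_reg s x v : regs s x = v -> eval_expr w s (Reg x) = v.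
Proof. by []. Qed.

Lemma eval_read s e a v : eval_expr w s e = a -> ram s a = v -> eval_expr w s (Read e) = v.
Proof. by move=> /= ->. Qed.

Lemma eval_add s a b x y : eval_expr w s a = x -> eval_expr w s b = y -> x + y < 2 ^ w ->
  eval_expr w s (a [+] b) = x + y.
Proof. by move=> /= -> ->; exact: modn_small. Qed.

Lemma eval_sub s a b x y : eval_expr w s a = x -> eval_expr w s b = y -> y <= x -> x < 2 ^ w ->
  eval_expr w s (a [-] b) = x - y.
Proof.
move=> /= -> -> yx xw; rewrite addnBA; last exact: leq_trans yx (ltnW xw).
by rewrite addnC -addnBA // modnDl modn_small // (leq_ltn_trans (leq_subr _ _)).
Qed.

Lemma eval_mul s a b x y : eval_expr w s a = x -> eval_expr w s b = y -> x * y < 2 ^ w ->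
  eval_expr w s (a [*] b) = x * y.
Proof. by move=> /= -> ->; exact: modn_small. Qed.

Lemma eval_mul0 s a b : eval_expr w s b = 0 -> eval_expr w s (a [*] b) = 0.
Proof. by move=> /= ->; rewrite muln0 mod0n. Qed.

Lemma eval_div s a b x y : eval_expr w s a = x -> eval_expr w s b = y ->
  eval_expr w s (a [/] b) = x %/ y.
Proof. by move=> /= -> ->. Qed.

Lemma eval_mod s a b x y : eval_expr w s a = x -> eval_expr w s b = y ->
  eval_expr w s (a [%] b) = x %% y.
Proof. by move=> /= -> ->. Qed.

Lemma eval_lt s a b x y : 0 < w -> eval_expr w s a = x -> eval_expr w s b = y ->
  eval_expr w s (a [<] b) = (x < y).
Proof.
move=> w0 /= -> ->; apply: modn_small; apply: (leq_ltn_trans (leq_b1 _)).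
by rewrite -[X in X < _](expn0 2) ltn_exp2l.
Qed.

(* Words stand for integers modulo [2 ^ w]. *)
Definition word (z : int) : nat := `|(z %% Posz (2 ^ w))%Z|%N.

Lemma wordE z : Posz (word z) = (z %% Posz (2 ^ w))%Z.
Proof. by rewrite /word gez0_abs // modz_ge0 // -lt0n expn_gt0. Qed.

Lemma word_lt z : word z < 2 ^ w.
Proof. by rewrite -ltz_nat wordE ltz_pmod // ltz_nat expn_gt0. Qed.

Lemma word_nat n : n < 2 ^ w -> word (Posz n) = n.
Proof. by move=> h; rewrite /word modz_nat modn_small. Qed.

Lemma eval_addw s a b x y : eval_expr w s a = word x -> eval_expr w s b = word y ->
  eval_expr w s (a [+] b) = word (x + y)%R.
Proof.
move=> /= -> ->; apply/eqP; rewrite -eqz_nat -modz_nat PoszD !wordE; apply/eqP.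
by rewrite modzDml modzDmr.
Qed.

Lemma eval_mulw s a b x y : eval_expr w s a = word x -> eval_expr w s b = word y ->
  eval_expr w s (a [*] b) = word (x * y)%R.
Proof.
move=> /= -> ->; apply/eqP; rewrite -eqz_nat -modz_nat PoszM !wordE; apply/eqP.
by rewrite modzMml modzMmr.
Qed.

Lemma eval_subw s a b x y : eval_expr w s a = word x -> eval_expr w s b = word y ->
  eval_expr w s (a [-] b) = word (x - y)%R.
Proof.
move=> /= -> ->; apply/eqP; rewrite -eqz_nat -modz_nat PoszD -subzn ?(ltnW (word_lt _)) // !wordE.
apply/eqP.
rewrite addrCA modzDl -[in LHS]modzDmr modzNm modzDmr modzDml //.
Qed.

Lemma eval_word s e n : eval_expr w s e = n -> n < 2 ^ w -> eval_expr w s e = word (Posz n).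
Proof. by move=> -> h; rewrite word_nat. Qed.

Definition except x b len (s s' : state) :=
  (forall y, y <> x -> regs s' y = regs s y) /\
  (forall a, ~~ (b <= a < b + len) -> ram s' a = ram s a).

Definition tabulate (x : nat) (len base e : expr) : prog :=
  x ::= Const 0 ;;
  While (Reg x [<] len) (Store (base [+] Reg x) e ;; x ::= Reg x [+] Const 1).

(** The expressions must keep their values whatever the target range contains, since it is being
    overwritten; so [e] may not depend on that range. *)
Lemma wp_tabulate x (elen ebase e : expr) len base (f : nat -> nat) s :
  0 < w -> base + len < 2 ^ w ->
  (forall s', except x base len s s' -> eval_expr w s' elen = len) ->
  (forall s', except x base len s s' -> eval_expr w s' ebase = base) ->
  (forall s' i, i < len -> except x base len s s' -> regs s' x = i -> eval_expr w s' e = f i) ->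
  wp (tabulate x elen ebase e) (len * (cost elen + cost ebase + cost e + 11) + (cost elen + 5))
    (fun s' => except x base len s s' /\ forall i, i < len -> ram s' (base + i) = f i) s.
Proof.
move=> w0 lw hl hb he.
have w1 : 1 < 2 ^ w by rewrite -[X in X < _](expn0 2) ltn_exp2l.
pose I i s' := [/\ except x base len s s', regs s' x = i &
  forall j, j < i -> ram s' (base + j) = f j].
apply: (@wp_weaken _ (2 + (len * (cost (Reg x [<] elen) +
    ((cost (ebase [+] Reg x) + cost e).+1 + 4)).+1 + (cost (Reg x [<] elen)).+1)) _ (I len)).
- by rewrite /=; lia.
- by move=> s' [h1 _ h2].
apply: wp_seq; apply: wp_assign; apply: wp_while.
- move=> i s' il [ex xi fi]; split.
    by rewrite (eval_lt w0 (eval_reg xi) (hl _ ex)) il.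
  have Ee := he _ _ il ex xi.
  have Eb : eval_expr w s' (ebase [+] Reg x) = base + i.
    by apply: (eval_add (hb _ ex) (eval_reg xi)); lia.
  apply: wp_seq; apply: wp_store; rewrite Ee Eb; apply: wp_assign.
  have Ei : eval_expr w (State (regs s') (upd (ram s') (base + i) (f i))) (Reg x [+] Const 1) = i + 1.
    by apply: eval_add; [exact: xi | apply: eval_const |]; lia.
  rewrite Ei /=; split=> [| |j].
  + case: ex => ex1 ex2; split=> [y yx|a ha] /=.
      by rewrite /upd; case: eqP => // _; apply: ex1.
    rewrite /upd; case: eqP => [E|_]; last exact: ex2.
    by move: ha; rewrite E; lia.
  + by rewrite /= /upd eqxx addn1.
  + rewrite ltnS leq_eqVlt /= /upd eqn_add2l => /orP[/eqP ->|ji]; first by rewrite eqxx.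
    by rewrite ltn_eqF // fi.
- by move=> s' [ex xi _]; rewrite (eval_lt w0 (eval_reg xi) (hl _ ex)) ltnn.
- split=> //=; last by rewrite /upd eqxx mod0n.
  by split=> // y yx; rewrite /= /upd; case: eqP.
Qed.
End Wp.

(** * The transform as a program *)

Notation rT := 0.
Notation rCount := 1.
Notation rN := 2.
Notation rExp := 3.
Notation rS := 4.
Notation rL := 5.
Notation rRounds := 6.
Notation rInf := 7.
Notation rLev := 8.
Notation rQ := 9.
Notation rNcur := 10.
Notation rM := 11.
Notation rR := 12.
Notation rTot := 13.
Notation rH := 14.
Notation rI := 15.
Notation rD := 16.
Notation rK := 17.
Notation rJ := 18.
Notation rV := 19.
Notation rLo := 20.
Notation rHi := 21.
Notation rB := 22.

Arguments eval_expr : simpl never.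

(* Memory consists of regions of [S] cells: input and output (0), marks of the
   usable coins (1), table of numbers of coins (2), block lengths of the levels of
   the transform (3), array being transformed (4), scratch (5), transform of the
   marks (6). *)
Definition cell (k : nat) (e : expr) : expr := Const k [*] Reg rS [+] e.

Ltac ev := first [eassumption | lazymatch goal with
  | |- eval_expr _ _ (Reg _) = _ => apply: eval_reg; eassumption
  | |- eval_expr _ _ (Const _) = _ => apply: eval_const
  | |- eval_expr _ _ (_ [+] _) = _ => apply: eval_add; [ev|ev|]
  | |- eval_expr _ _ (_ [-] _) = _ => apply: eval_sub; [ev|ev| |]
  | |- eval_expr _ _ (_ [*] _) = _ => apply: eval_mul; [ev|ev|]
  | |- eval_expr _ _ (_ [/] _) = _ => apply: eval_div; [ev|ev]
  | |- eval_expr _ _ (_ [%] _) = _ => apply: eval_mod; [ev|ev]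
  | |- _ => idtac
  end].

(* Linear arithmetic over the implications of the goal, with quotients,
   remainders, powers and nonlinear products as atoms. *)
Ltac alia := repeat match goal with
  | |- context [?a %/ ?b] => move: (a %/ b) => ?
  | |- context [?a %% ?b] => move: (a %% b) => ?
  | |- context [?a ^ ?b] => move: (a ^ b) => ?
  | |- context [?a * ?b] => lazymatch a with O => fail | S _ => fail | _ => move: (a * b) => ? end
  end; repeat match goal with x := _ |- _ => clearbody x end; clear; lia.

(* Region 5 is a scratch area, so [e] may read the region being overwritten. *)
Definition overwrite_at (k : nat) (len e : expr) : prog :=
  tabulate rI len (Const 5 [*] Reg rS) e ;;
  tabulate rI len (Const k [*] Reg rS) (Read (cell 5 (Reg rI))).

Definition overwrite (e : expr) : prog := overwrite_at 4 (Reg rTot) e.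

(** * Expressions for the entries of a transform *)

Section Buffer.
Variables (w S : nat).
Hypothesis w0 : 0 < w.
Hypothesis Sw : 8 * S <= 2 ^ w.
Hypothesis w3 : 8 < 2 ^ w.

Definition changes (rs : seq nat) (s s' : state) :=
  (forall y, y \notin rs -> regs s' y = regs s y) /\
  (forall a, ~~ (4 * S <= a < 6 * S) -> ram s' a = ram s a).

Definition holds (s : state) (f : nat -> int) tot :=
  forall i, i < tot -> ram s (4 * S + i) = word w (f i).

Lemma changes_trans rs s1 s2 s3 : changes rs s1 s2 -> changes rs s2 s3 -> changes rs s1 s3.
Proof.
move=> [h1 h2] [h3 h4]; split=> [y yr|a ha]; first by rewrite h3 // h1.
by rewrite h4 // h2.
Qed.

Lemma changes_sub rs rs' s s' : {subset rs <= rs'} -> changes rs s s' -> changes rs' s s'.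
Proof. by move=> sub [h1 h2]; split=> // y yr; apply: h1; apply: contra yr; exact: sub. Qed.

Lemma eval_cell s k e x : regs s rS = S -> k < 8 -> eval_expr w s e = x -> k * S + x < 2 ^ w ->
  eval_expr w s (cell k e) = k * S + x.
Proof. by move=> hS k8 he lt; rewrite /cell; ev => //; lia. Qed.

Lemma wp_overwrite_at k elen e len (f : nat -> nat) s :
  k < 5 -> len < S -> regs s rS = S ->
  (forall s', (forall y, y <> rI -> regs s' y = regs s y) -> eval_expr w s' elen = len) ->
  (forall s' i, i < len -> except rI (5 * S) len s s' -> regs s' rI = i ->
     eval_expr w s' e = f i) ->
  wp w (overwrite_at k elen e) (len * (cost e + 2 * cost elen + 38) + (2 * cost elen + 10))
    (fun s' => [/\ forall y, y <> rI -> regs s' y = regs s y,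
       forall a, ~~ (k * S <= a < k.+1 * S) -> ~~ (5 * S <= a < 6 * S) -> ram s' a = ram s a &
       forall i, i < len -> ram s' (k * S + i) = f i]) s.
Proof.
move=> k5 lS hS hl he.
have kS : k * S <= 4 * S by rewrite leq_mul2r -ltnS k5 orbT.
have kSS : k.+1 * S = k * S + S by rewrite mulSnr.
have [S5 Sk] : 5 * S + len < 2 ^ w /\ k * S + len < 2 ^ w.
  by move: kS lS Sw w3; alia.
have kw : k < 2 ^ w by move: k5 w3; alia.
have regS b s' : except rI b len s s' -> regs s' rS = S by move=> [h _]; rewrite h.
apply: (@wp_weaken _ _ ((len * (cost elen + 3 + cost e + 11) + (cost elen + 5)) +
                        (len * (cost elen + 3 + 6 + 11) + (cost elen + 5)))).
- have -> : len * (cost e + 2 * cost elen + 38) + (2 * cost elen + 10) =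
     (len * (cost elen + 3 + cost e + 11) + (cost elen + 5)) +
     (len * (cost elen + 3 + 6 + 11) + (cost elen + 5)) + len * 4 by ring.
  exact: leq_addr.
- by move=> s'; exact.
apply: wp_seq; apply: wp_weaken (leqnn _) _ (wp_tabulate (len := len) (base := 5 * S)
  (f := f) w0 S5 _ _ _) => //.
- move=> s1 [ex1 t1].
  have hS1 := regS _ _ ex1.
  apply: wp_weaken (leqnn _) _ (wp_tabulate (len := len) (base := k * S)
    (f := f) w0 _ _ _ _) => //.
  + move=> s2 [[r2 m2] t2]; case: ex1 => r1 m1; split=> //.
      by move=> y yI; rewrite r2 // r1.
    move=> a h1 h2; rewrite m2 ?m1 //.
      by move: h2 lS; rewrite (_ : 6 * S = 5 * S + S); [alia | rewrite -mulSnr].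
    by move: h1 lS; rewrite kSS; alia.
  + by move=> s' [h _]; apply: hl => y yI; rewrite h //; case: ex1 => ->.
  + move=> s' [h _]; have hS' : regs s' rS = S by rewrite h.
    by ev; move: w3 kw lS Sk; alia.
  + move=> s' i it ex' iI; have hS' : regs s' rS = S by rewrite (proj1 ex').
    apply: (@eval_read _ _ _ (5 * S + i)).
      by apply: eval_cell => //; move: it S5; alia.
    case: ex' => _ m'; rewrite m'; first by rewrite t1.
    by move: kS lS; alia.
- by move=> s' [h _]; exact: hl.
- by move=> s' /regS h; ev; move: w3 S5; alia.
Qed.

Lemma wp_overwrite e tot (f : nat -> int) s :
  tot < S -> regs s rS = S -> regs s rTot = tot ->
  (forall s' i, i < tot -> except rI (5 * S) tot s s' -> regs s' rI = i ->
     eval_expr w s' e = word w (f i)) ->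
  wp w (overwrite e) (tot * (cost e + 40) + 20)
    (fun s' => changes [:: rI] s s' /\ holds s' f tot) s.
Proof.
move=> totS hS ht he.
have h := @wp_overwrite_at 4 (Reg rTot) e tot (fun i => word w (f i)) s isT totS hS.
apply: wp_weaken (h _ he) => [|s' [h1 h2 h3]|s' h1].
- by rewrite -(addnA (cost e)) leq_add.
- split=> //; split=> [y|a ha]; first by rewrite inE => /eqP /h1.
  by apply: h2; move: ha; lia.
- by apply: eval_reg; rewrite h1.
Qed.

Definition xcell (e : expr) : expr := Read (cell 4 e).

Lemma eval_xcell s f tot e x : regs s rS = S -> holds s f tot -> tot < S ->
  eval_expr w s e = x -> x < tot -> eval_expr w s (xcell e) = word w (f x).
Proof.
move=> hS hf tS he xt; apply: (@eval_read _ _ _ (4 * S + x)); last exact: hf.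
by apply: eval_cell => //; lia.
Qed.

Lemma holds_except s s' f tot tot' : tot <= S -> tot' <= S -> holds s f tot ->
  except rI (5 * S) tot' s s' -> holds s' f tot.
Proof. by move=> h h' hf [_ m] i it; rewrite m ?hf //; lia. Qed.

Definition negacyc_expr (k u : expr) : expr :=
  (Const 1 [-] Const 2 [*] (u [/] Reg rM)) [*] xcell (k [*] Reg rM [+] u [%] Reg rM).

Lemma eval_negacyc s f tot m k u kv uv : regs s rS = S -> regs s rM = m -> holds s f tot ->
  tot < S -> 0 < m -> eval_expr w s k = kv -> eval_expr w s u = uv -> uv < 2 * m ->
  kv * m + m <= tot -> eval_expr w s (negacyc_expr k u) = word w (negacyc m f kv uv).
Proof.
move=> hS hm hf tS m0 hk hu um km.
have lu := ltn_pmod uv m0.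
apply: eval_mulw.
  apply: eval_subw; first by apply: eval_word; [ev|]; lia.
  have u2 : uv %/ m < 2 by rewrite ltn_divLR.
  rewrite -PoszM; apply: eval_word; last by lia.
  by ev; lia.
apply: (@eval_xcell s f tot) => //; last by lia.
by ev; lia.
Qed.

Definition layer_expr : expr :=
  let q := Reg rI [/] Reg rM in
  let l := q [%] (Const 2 [*] Reg rR) [%] (Const 2 [*] Reg rH) in
  let k := q [/] (Const 2 [*] Reg rR) [*] (Const 2 [*] Reg rR) [+]
    (q [%] (Const 2 [*] Reg rR) [/] (Const 2 [*] Reg rH) [*] Reg rH [+] l [%] Reg rH) in
  xcell (k [*] Reg rM [+] Reg rI [%] Reg rM) [+]
  negacyc_expr (k [+] Reg rR)
    ((Reg rI [%] Reg rM [+] Reg rM [/] Reg rH [*] l [*] Reg rD) [%] (Const 2 [*] Reg rM)).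

(** The second operand of a butterfly stays inside its group of 2r blocks: with r = c h the position
    of the first operand in the group is below r. *)
Lemma layer_index (G r h q : nat) : 0 < h -> 2 * h %| 2 * r -> q < G * (2 * r) ->
  (q %/ (2 * r) * (2 * r) + (q %% (2 * r) %/ (2 * h) * h + q %% (2 * r) %% (2 * h) %% h) + r)
   < G * (2 * r).
Proof.
move=> h0 hr qG.
have r0 : 0 < 2 * r by case: (2 * r) qG => //; rewrite muln0.
have gG : q %/ (2 * r) < G by rewrite ltn_divLR.
have pr := ltn_pmod q r0.
move: pr gG; set pos := q %% (2 * r); set g := q %/ (2 * r) => pr gG.
have {hr} /dvdnP[c Ec] := hr.
have Er : r = c * h by nia.
have pc : pos %/ (2 * h) < c by rewrite ltn_divLR ?muln_gt0 // -Ec.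
have lh := ltn_pmod (pos %% (2 * h)) h0.
have : pos %/ (2 * h) * h + pos %% (2 * h) %% h < r by rewrite Er; nia.
have : g.+1 * (2 * r) <= G * (2 * r) by rewrite leq_mul2r gG orbT.
by rewrite mulSn; lia.
Qed.

Lemma eval_layer s f G m r h d i : regs s rS = S -> regs s rM = m -> regs s rR = r ->
  regs s rH = h -> regs s rD = d -> regs s rI = i ->
  holds s f (G * (2 * r) * m) -> G * (2 * r) * m < S -> 8 * (m * m) <= 2 ^ w ->
  0 < m -> 0 < h -> 2 * h %| 2 * r -> r <= m -> d < 2 * m -> i < G * (2 * r) * m ->
  eval_expr w s layer_expr = word w (fft_layer m r h d f i).
Proof.
move=> hS hm hr hh hd hi hf tS mm m0 h0 dv rm dm it.
have qG : i %/ m < G * (2 * r) by rewrite ltn_divLR.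
have lk := layer_index h0 dv qG.
rewrite /fft_layer /layer_expr; cbv zeta.
have qm : i %/ m <= i by apply: leq_div.
have hr2 : h <= r.
  have r0 : 0 < 2 * r by case: (2 * r) it => //; rewrite muln0 mul0n.
  by have := dvdn_leq r0 dv; lia.
have h2 : 0 < 2 * h by rewrite muln_gt0.
move: lk; set q := i %/ m; set l := q %% (2 * r) %% (2 * h).
set p := q %% (2 * r) %/ (2 * h).
set g := q %/ (2 * r) => lk.
have q0 : g * (2 * r) <= q by apply: leq_trunc_div.
have p0 : p * h <= q.
  have : p * (2 * h) <= q %% (2 * r) by apply: leq_trunc_div.
  have : q %% (2 * r) <= q by apply: leq_mod.
  rewrite mulnCA; alia.
have l0 : l < 2 * h by apply: ltn_pmod.
have im := ltn_pmod i m0.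
have lhh : l %% h <= l by apply: leq_mod.
have mS : m <= G * (2 * r) * m.
  by rewrite leq_pmull //; apply: leq_ltn_trans lk.
have rS' : 2 * r <= G * (2 * r) * m.
  apply: leq_trans (leq_pmulr _ m0); rewrite leq_pmull //.
  by have := leq_ltn_trans (leq0n _) lk; rewrite muln_gt0 => /andP[].
set k := g * (2 * r) + _ in lk *.
have kt : k * m + i %% m < G * (2 * r) * m.
  have : k.+1 * m <= G * (2 * r) * m by rewrite leq_mul2r; move: lk; alia.
  by rewrite mulSn; move: im; alia.
have kt2 : (k + r) * m + m <= G * (2 * r) * m.
  by rewrite -mulSnr leq_mul2r lk orbT.
have Hl : eval_expr w s (Reg rI [/] Reg rM [%] (Const 2 [*] Reg rR) [%] (Const 2 [*] Reg rH)) = l.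
  by ev; move: w3 rS' tS Sw hr2; alia.
have Hk : eval_expr w s (Reg rI [/] Reg rM [/] (Const 2 [*] Reg rR) [*] (Const 2 [*] Reg rR) [+]
    (Reg rI [/] Reg rM [%] (Const 2 [*] Reg rR) [/] (Const 2 [*] Reg rH) [*] Reg rH [+]
     Reg rI [/] Reg rM [%] (Const 2 [*] Reg rR) [%] (Const 2 [*] Reg rH) [%] Reg rH)) = k.
  have lk' : k < G * (2 * r) * m by apply: leq_trans (leq_pmulr _ m0); move: lk; alia.
  move: lk'; rewrite /k => lk'.
  by ev; move: w3 rS' tS Sw hr2 q0 p0 lk'; alia.
have mh : m %/ h * l <= 2 * m.
  have := leq_trunc_div m h; have : m %/ h * l <= m %/ h * (2 * h) by rewrite leq_mul2l ltnW ?orbT.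
  by rewrite mulnCA; alia.
(* The amount of rotation is computed in full before it is reduced modulo 2m, so it has to fit into
   a word. *)
have mhd : m %/ h * l * d <= 4 * (m * m).
  have : m %/ h * l * d <= (2 * m) * (2 * m) by apply: leq_mul => //; exact: ltnW.
  by rewrite mulnACA.
have mmm : m <= m * m by rewrite leq_pmulr.
have mh0 : m %/ h <= m by apply: leq_div.
apply: eval_addw.
  apply: (@eval_xcell s f (G * (2 * r) * m)) => //.
  by ev; move: tS Sw kt im; alia.
apply: (@eval_negacyc s f (G * (2 * r) * m) m) => //.
- by ev; move: tS Sw lk (leq_pmulr (G * (2 * r)) m0); alia.
- by ev; move: tS Sw w3 mh mhd mmm mh0 im mS mm; alia.
- by rewrite ltn_mod muln_gt0.
Qed.

Definition lift_expr : expr :=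
  let q := Reg rI [/] Reg rM in
  xcell (q [/] (Const 2 [*] Reg rR) [*] Reg rNcur [+] (Reg rI [%] Reg rM [*] Reg rR [+] q [%] (Const 2 [*] Reg rR)))
  [*] (q [%] (Const 2 [*] Reg rR) [<] Reg rR).

Lemma eval_lift s f G m r i : regs s rS = S -> regs s rM = m -> regs s rR = r ->
  regs s rNcur = m * r -> regs s rI = i -> holds s f (G * (m * r)) ->
  G * (2 * r) * m < S -> 0 < m -> 0 < r -> i < G * (2 * r) * m ->
  eval_expr w s lift_expr = word w (lift_step (m * r) r m f i).
Proof.
move=> hS hm hr hN hi hf tS m0 r0 it.
have E2 : G * (2 * r) * m = 2 * (G * (m * r)) by ring.
rewrite /lift_step /lift_expr; cbv zeta.
have qm : i %/ m <= i by apply: leq_div.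
have im := ltn_pmod i m0.
have qG : i %/ m < G * (2 * r) by rewrite ltn_divLR.
have r2 : 0 < 2 * r by rewrite muln_gt0.
have gG : i %/ m %/ (2 * r) < G by rewrite ltn_divLR.
have rS' : 2 * r <= G * (2 * r) * m.
  apply: leq_trans (leq_pmulr _ m0); rewrite leq_pmull //; exact: leq_ltn_trans gG.
move: qm qG gG; set q := i %/ m => qm qG gG.
have Eb : eval_expr w s (Reg rI [/] Reg rM [%] (Const 2 [*] Reg rR) [<] Reg rR) = (q %% (2 * r) < r).
  by apply: eval_lt => //; ev; move: w3 rS' tS Sw; alia.
(* In the upper half the cell that is read may contain anything; the factor 0 discards it. *)
case: ifP Eb => [lt|_] Eb; last first.
  by rewrite eval_mul0 // (word_nat (n := 0)) // expn_gt0.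
rewrite -[f _]mulr1; apply: eval_mulw; last first.
  by rewrite Eb (word_nat (n := 1)) //; move: w3; alia.
have jr : i %% m * r + q %% (2 * r) < m * r.
  have : (i %% m).+1 * r <= m * r by rewrite leq_mul2r im orbT.
  by rewrite mulSn; move: lt; alia.
have lt2 : q %/ (2 * r) * (m * r) + (i %% m * r + q %% (2 * r)) < G * (m * r).
  have : (q %/ (2 * r)).+1 * (m * r) <= G * (m * r) by rewrite leq_mul2r gG orbT.
  by rewrite mulSn; move: jr; alia.
apply: (@eval_xcell s f (G * (m * r))) => //; first by move: tS; rewrite E2; alia.
by ev; move: lt2 tS Sw w3 rS'; rewrite E2; alia.
Qed.

Definition unlift_expr : expr :=
  let k := Reg rI [/] Reg rNcur [*] (Const 2 [*] Reg rR) [+] Reg rI [%] Reg rNcur [%] Reg rR in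
  let j := Reg rI [%] Reg rNcur [/] Reg rR in
  xcell (k [*] Reg rM [+] j) [+]
  negacyc_expr (k [+] Reg rR) ((j [+] (Const 2 [*] Reg rM [-] Const 1)) [%] (Const 2 [*] Reg rM)).

Lemma eval_unlift s f G m r i : regs s rS = S -> regs s rM = m -> regs s rR = r ->
  regs s rNcur = m * r -> regs s rI = i -> holds s f (G * (2 * r) * m) ->
  G * (2 * r) * m < S -> 0 < m -> 0 < r -> i < G * (m * r) ->
  eval_expr w s unlift_expr = word w (unlift_step (m * r) r m f i).
Proof.
move=> hS hm hr hN hi hf tS m0 r0 it.
have N0 : 0 < m * r by rewrite muln_gt0 m0.
rewrite /unlift_step /unlift_expr; cbv zeta.
have gG : i %/ (m * r) < G by rewrite ltn_divLR.
have iN := ltn_pmod i N0.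
have jm : i %% (m * r) %/ r < m by rewrite ltn_divLR.
have ir := ltn_pmod (i %% (m * r)) r0.
move: gG jm ir; set g := i %/ _; set j := _ %/ r; set u := _ %% r => gG jm ir.
have lk : g * (2 * r) + u + r < G * (2 * r).
  have : g.+1 * (2 * r) <= G * (2 * r) by rewrite leq_mul2r gG orbT.
  by rewrite mulSn; move: ir; alia.
have kt2 : (g * (2 * r) + u + r) * m + m <= G * (2 * r) * m.
  by rewrite -mulSnr leq_mul2r lk orbT.
have kt : (g * (2 * r) + u) * m + m <= G * (2 * r) * m.
  by move: kt2; rewrite [(_ + r) * m]mulnDl; alia.
have lt1 : G * (2 * r) <= G * (2 * r) * m by rewrite leq_pmulr.
have r2 : 2 * r <= G * (2 * r).
  by rewrite leq_pmull //; exact: leq_ltn_trans gG.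
apply: eval_addw.
  apply: (@eval_xcell s f (G * (2 * r) * m)) => //; last by move: kt jm; alia.
  by ev; move: kt jm lk lt1 tS Sw w3 r2; alia.
apply: (@eval_negacyc s f (G * (2 * r) * m) m) => //.
- by ev; move: lk lt1 tS Sw w3 r2; alia.
- rewrite -subn1; ev; move: m0 kt jm lk lt1 tS Sw w3 r2; alia.
- by rewrite ltn_mod muln_gt0.
Qed.

Definition vcell (e : expr) : expr := Read (cell 6 e).

Definition base_expr : expr :=
  let q := Reg rI [/] Const 2 [*] Const 2 in
  let j := Reg rI [%] Const 2 in
  xcell q [*] vcell (Reg rI) [+]
  (Const 2 [*] j [-] Const 1) [*] (xcell (q [+] Const 1) [*] vcell (q [+] (Const 1 [-] j))).

Lemma eval_base s f g T i : regs s rS = S -> regs s rI = i -> holds s f (2 * T) ->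
  (forall j, j < 2 * T -> ram s (6 * S + j) = word w (g j)) -> 2 * T < S -> i < 2 * T ->
  eval_expr w s base_expr = word w (base_mul f g i).
Proof.
move=> hS hi hf hg tS it.
have vE e x : eval_expr w s e = x -> x < 2 * T -> eval_expr w s (vcell e) = word w (g x).
  move=> he xT; apply: (@eval_read _ _ _ (6 * S + x)); last exact: hg.
  by apply: eval_cell => //; move: xT tS Sw; alia.
rewrite /base_mul /base_expr; cbv zeta.
have qT : i %/ 2 * 2 + 1 < 2 * T.
  have : i %/ 2 < T by rewrite ltn_divLR // mulnC.
  by lia.
have Eq : eval_expr w s (Reg rI [/] Const 2 [*] Const 2) = i %/ 2 * 2.
  by ev; move: qT tS Sw w3; lia.
have j2 : i %% 2 < 2 by apply: ltn_pmod.
have Ej : eval_expr w s (Reg rI [%] Const 2) = i %% 2.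
  by ev; move: w3; lia.
apply: eval_addw; apply: eval_mulw.
- by apply: (@eval_xcell s f (2 * T)) => //; lia.
- by apply: vE => //; ev.
- apply: eval_subw; last by apply: eval_word; [ev|]; lia.
  rewrite -PoszM; apply: eval_word; last by lia.
  by ev; lia.
- apply: eval_mulw.
    apply: (@eval_xcell s f (2 * T)) => //; ev; lia.
  apply: vE; last by lia.
  by ev; lia.
Qed.

End Buffer.

Definition fft_prog : prog :=
  rH ::= Const 1 ;;
  While (Reg rH [<] Const 2 [*] Reg rR) (overwrite layer_expr ;; rH ::= Const 2 [*] Reg rH).

Definition load_level : prog :=
  rNcur ::= Read (cell 3 (Reg rQ)) ;; rM ::= Read (cell 3 (Reg rQ [+] Const 1)) ;;
  rR ::= Reg rNcur [/] Reg rM.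

Definition down_level : prog :=
  load_level ;; rTot ::= Const 2 [*] Reg rTot ;; overwrite lift_expr ;;
  rD ::= Const 2 [*] Reg rM [-] Const 1 ;; fft_prog ;; rQ ::= Reg rQ [+] Const 1.

Definition up_level : prog :=
  rQ ::= Reg rQ [-] Const 1 ;; load_level ;; rD ::= Const 1 ;; fft_prog ;;
  rTot ::= Reg rTot [/] Const 2 ;; overwrite unlift_expr.

Definition down_prog : prog :=
  rQ ::= Const 0 ;; rTot ::= Reg rN ;; While (Reg rQ [<] Reg rLev) down_level.

Definition up_prog : prog := While (Const 0 [<] Reg rQ) up_level.

Definition conv_regs : seq nat := [:: rI; rH; rQ; rNcur; rM; rR; rTot; rD].

(** * Effect and running time of the transforms *)

Section Transform.
Variables (w S e lev : nat).
Hypothesis w0 : 0 < w.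
Hypothesis Sw : 8 * S <= 2 ^ w.
Hypothesis w3 : 8 < 2 ^ w.
Hypothesis Nw : 8 * (2 ^ e * 2 ^ e) <= 2 ^ w.
Hypothesis levS : 2 ^ e * 2 ^ lev < S.

Lemma regs_upd f x v y : upd f x v y = if y == x then v else f y.
Proof. by []. Qed.

Lemma changes_assign rs s0 s x v : x \in rs -> changes S rs s0 s ->
  changes S rs s0 (State (upd (regs s) x v) (ram s)).
Proof.
move=> xr [h1 h2]; split=> // y yr; rewrite /= regs_upd; case: eqP => [E|_]; last exact: h1.
by move: yr; rewrite E xr.
Qed.

Lemma wp_fft s f G m D d : regs s rS = S -> regs s rM = m -> regs s rR = 2 ^ D ->
  regs s rTot = G * (2 * 2 ^ D) * m -> regs s rD = d -> holds w S s f (G * (2 * 2 ^ D) * m) ->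
  G * (2 * 2 ^ D) * m < S -> 8 * (m * m) <= 2 ^ w -> 0 < m -> 2 ^ D %| m -> d < 2 * m -> 0 < G ->
  wp w fft_prog (D.+1 * (G * (2 * 2 ^ D) * m * 200 + 50) + 20)
    (fun s' => changes S [:: rI; rH] s s' /\
       holds w S s' (fft m (2 ^ D) d D.+1 f) (G * (2 * 2 ^ D) * m)) s.
Proof.
set tot := G * _ * m.
move=> hS hm hr ht hd hf tS mm m0 Dm dm G0.
have Dlem : 2 ^ D <= m by apply: dvdn_leq.
have r2 : 2 * 2 ^ D <= tot by apply: leq_trans (leq_pmulr _ m0); rewrite leq_pmull.
pose I j s' := [/\ changes S [:: rI; rH] s s', regs s' rH = 2 ^ j &
  holds w S s' (fft m (2 ^ D) d j f) tot].
have cl : cost layer_expr <= 159 by [].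
apply: (@wp_weaken _ _ (2 + (D.+1 * (5 + (tot * (cost layer_expr + 40) + 20 + 4)).+1 + 6)) _
  (I D.+1)).
- rewrite addnCA; apply: leq_add; last by [].
  rewrite leq_mul2l; apply/orP; right.
  have := leq_mul (leqnn tot) cl; rewrite mulnDr; lia.
- by move=> s' [].
apply: wp_seq; apply: wp_assign; apply: wp_while.
- move=> j s1 jD [ch hh hf1]; have [c1 _] := ch.
  have [hS1 hm1 hr1] : [/\ regs s1 rS = S, regs s1 rM = m & regs s1 rR = 2 ^ D].
    by rewrite !c1.
  have [ht1 hd1] : regs s1 rTot = tot /\ regs s1 rD = d by rewrite !c1.
  have jD2 : 2 ^ j.+1 <= 2 * 2 ^ D by rewrite -expnS leq_exp2l.
  have Ec : eval_expr w s1 (Reg rH [<] Const 2 [*] Reg rR) = (2 ^ j < 2 * 2 ^ D).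
    by apply: eval_lt => //; ev; move: w3 r2 tS Sw; alia.
  split.
    by rewrite Ec -expnS ltn_exp2l // jD.
  apply: wp_seq; apply: wp_weaken (leqnn _) _ (wp_overwrite (tot := tot)
      (f := fft_layer m (2 ^ D) (2 ^ j) d (fft m (2 ^ D) d j f)) w0 Sw w3 _ _ _ _) => //.
    move=> s2 [ch2 hf2]; apply: wp_assign.
    have ch3 := changes_trans ch (changes_sub (_ : {subset [:: rI] <= [:: rI; rH]}) ch2).
    split.
    + by apply: changes_assign => //; apply: ch3 => y; rewrite !inE => /eqP ->.
    + have hh2 : regs s2 rH = 2 ^ j by case: ch2 => -> //.
      rewrite /= regs_upd eqxx expnS; ev; first by move: w3; alia.
      by move: jD2; rewrite expnS; move: r2 tS Sw; alia.
    + exact: hf2.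
  move=> s2 i it ex iI; case: (ex) => r2' _.
  apply: (@eval_layer w S w0 Sw w3 s2 _ G) => //; rewrite ?r2' //.
  + by apply: (holds_except w0 Sw w3 _ _ hf1 ex); exact: ltnW.
  + by rewrite expn_gt0.
  + by rewrite -!(expnS 2); apply: dvdn_exp2l.
- move=> s1 [ch hh hf1]; have [c1 _] := ch.
  have hr1 : regs s1 rR = 2 ^ D by rewrite !c1.
  have -> : eval_expr w s1 (Reg rH [<] Const 2 [*] Reg rR) = (2 ^ D.+1 < 2 * 2 ^ D).
    by apply: eval_lt => //; ev; move: w3 r2 tS Sw; alia.
  by rewrite expnS ltnn.
- split=> //.
  + exact: changes_assign.
  + by rewrite /= regs_upd eqxx /eval_expr modn_small // (leq_trans _ w3).
Qed.

Definition level_env (s : state) :=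
  [/\ regs s rS = S, regs s rLev = lev, regs s rN = 2 ^ e &
     forall q, q <= lev -> ram s (3 * S + q) = 2 ^ width e q].

Lemma lev_lt_S : lev < S.
Proof.
apply: leq_ltn_trans levS; apply: (@leq_trans (2 ^ lev)); first exact: ltnW (ltn_expl _ _).
by rewrite leq_pmull // expn_gt0.
Qed.

Lemma level_env_changes s s' : level_env s -> changes S conv_regs s s' -> level_env s'.
Proof.
move=> [h1 h2 h3 h4] [c1 c2]; split; rewrite ?c1 // => q ql; rewrite c2 ?h4 //.
by have := lev_lt_S; lia.
Qed.

Lemma width_le q : width e q <= e.
Proof.
elim: q => // q IH; apply: leq_trans IH; rewrite /width /= leq_uphalf_double -addnn.
by rewrite leq_addl.
Qed.

Lemma wp_load q s : q < lev -> level_env s -> regs s rQ = q ->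
  wp w load_level 22 (fun s' => ram s' = ram s /\ [/\ changes S [:: rNcur; rM; rR] s s',
     regs s' rNcur = 2 ^ width e q.+1 * 2 ^ (width e q)./2, regs s' rM = 2 ^ width e q.+1 &
     regs s' rR = 2 ^ (width e q)./2]) s.
Proof.
move=> ql [hS hl hN hst] hq; have lS := lev_lt_S.
apply: (@wp_weaken _ _ (7 + (9 + 4))) => //; first by move=> s'; exact.
apply: wp_seq; apply: wp_assign.
have -> : eval_expr w s (Read (cell 3 (Reg rQ))) = 2 ^ width e q.
  apply: (@eval_read _ _ _ (3 * S + q)); last by apply: hst; exact: ltnW.
  by apply: (eval_cell w0 Sw w3) => //; lia.
set s1 := State _ _; apply: wp_seq; apply: wp_assign.
have -> : eval_expr w s1 (Read (cell 3 (Reg rQ [+] Const 1))) = 2 ^ width e q.+1.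
  apply: (@eval_read _ _ _ (3 * S + (q + 1))); last by rewrite addn1; apply: hst.
  apply: (eval_cell w0 Sw w3) => //; last by lia.
  by apply: eval_add; [exact: hq | apply: eval_const |]; lia.
set s2 := State _ _; apply: wp_assign.
have -> : eval_expr w s2 (Reg rNcur [/] Reg rM) = 2 ^ (width e q)./2.
  rewrite (@eval_div _ _ _ _ (2 ^ width e q) (2 ^ width e q.+1)) //.
  by rewrite pow_width mulKn // expn_gt0.
split=> //; split=> //=; last by rewrite -pow_width.
do 3 (apply: (@changes_assign _ _ (State _ _)) => //).
Qed.

(** Zero padding doubles the array at each level, and this is its length at the innermost one. *)
Definition total : nat := 2 ^ e * 2 ^ lev.

Lemma total_gt0 : 0 < total.
Proof. by rewrite muln_gt0 !expn_gt0. Qed.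

Lemma pow_lev_le q : q <= lev -> 2 ^ e * 2 ^ q <= total.
Proof. by move=> ql; rewrite leq_mul2l leq_exp2l // ql orbT. Qed.

(** G is the number of blocks of level q. The array is read as G blocks of length m r before the
    level and as G groups of 2r blocks of length m after it. *)
Lemma level_shape q (G := 2 ^ (e + q - width e q)) :
  2 ^ e * 2 ^ q = G * (2 ^ width e q.+1 * 2 ^ (width e q)./2) /\
  2 ^ e * 2 ^ q.+1 = G * (2 * 2 ^ (width e q)./2) * 2 ^ width e q.+1.
Proof.
have E : 2 ^ e * 2 ^ q = G * (2 ^ width e q.+1 * 2 ^ (width e q)./2).
  rewrite -pow_width /G -!expnD subnK //.
  by apply: leq_trans (width_le q) (leq_addr _ _).
by split=> //; rewrite expnS mulnCA E; ring.
Qed.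

Lemma level_bounds q : q < lev -> [/\ 0 < 2 ^ width e q.+1,
  8 * (2 ^ width e q.+1 * 2 ^ width e q.+1) <= 2 ^ w & (width e q)./2.+1 <= e.+1].
Proof.
move=> ql; split; first by rewrite expn_gt0.
  apply: leq_trans Nw; apply: leq_mul => //.
  by apply: leq_mul; rewrite leq_exp2l // width_le.
by rewrite ltnS; apply: leq_trans (half_width_le e q) (width_le _).
Qed.

Lemma level_cost (D c : nat) : D <= e.+1 -> c <= 300 ->
  D * (total * 200 + 50) + (total * c + 200) <= e.+1 * (total * 800).
Proof.
move=> De cc; have T0 := total_gt0.
have h1 : D * (total * 200 + 50) <= e.+1 * (total * 200 + 50) by rewrite leq_mul2r De orbT.
have h2 : total * c <= total * 300 by rewrite leq_mul2l cc orbT.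
have h3 : total * 300 + 200 <= e.+1 * (total * 300 + 200) by rewrite leq_pmull.
have h4 : e.+1 * (total * 200 + 50) + e.+1 * (total * 300 + 200) <= e.+1 * (total * 800).
  by rewrite -mulnDr leq_mul2l; move: T0; lia.
by move: h1 h2 h3 h4; alia.
Qed.

Lemma wp_down_level q s a : q < lev -> level_env s -> regs s rQ = q ->
  regs s rTot = 2 ^ e * 2 ^ q -> holds w S s (down e q a) (2 ^ e * 2 ^ q) ->
  wp w down_level (e.+1 * (total * 800)) (fun s' => [/\ changes S conv_regs s s',
    regs s' rQ = q.+1, regs s' rTot = 2 ^ e * 2 ^ q.+1 &
    holds w S s' (down e q.+1 a) (2 ^ e * 2 ^ q.+1)]) s.
Proof.
move=> ql env hq ht hf.
have [m0 mm De] := level_bounds ql.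
have [Et Et1] := level_shape q.
have tl := pow_lev_le ql.
have TS : 2 ^ e * 2 ^ q.+1 < S by exact: leq_ltn_trans levS.
have G0 : 0 < 2 ^ (e + q - width e q) by rewrite expn_gt0.
have [hS _ _ _] := env.
have Dm : 2 ^ (width e q)./2 %| 2 ^ width e q.+1 by apply: dvdn_exp2l; apply: half_width_le.
have r0 : 0 < 2 ^ (width e q)./2 by rewrite expn_gt0.
have mS : 2 ^ width e q.+1 <= 2 ^ e * 2 ^ q.+1 by rewrite Et1 leq_pmull // muln_gt0 G0 muln_gt0.
have cl : cost lift_expr <= 38 by [].
apply: (@wp_weaken _ _ (22 + (4 + ((2 ^ e * 2 ^ q.+1 * (cost lift_expr + 40) + 20) +
   (6 + (((width e q)./2.+1 * (2 ^ e * 2 ^ q.+1 * 200 + 50) + 20) + 4)))))).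
  apply: leq_trans (level_cost De (isT : 78 <= 300)).
  have h1 : (width e q)./2.+1 * (2 ^ e * 2 ^ q.+1 * 200 + 50) <=
            (width e q)./2.+1 * (total * 200 + 50) by rewrite leq_mul2l leq_add2r leq_mul2r tl !orbT.
  have h2 : 2 ^ e * 2 ^ q.+1 * (cost lift_expr + 40) <= total * 78.
    by apply: leq_mul => //; rewrite (leq_add2r 40 _ 38).
  by move: h1 h2; alia.
  by move=> s'; exact.
move: Et1 hf ht TS mS mm m0 Dm r0; rewrite [down e q.+1 a]/=.
rewrite Et; set m := 2 ^ width e q.+1; set D := (width e q)./2; set G := 2 ^ (e + q - _).
move=> -> hf ht TS mS mm m0 Dm r0.
have E2 : G * (2 * 2 ^ D) * m = 2 * (G * (m * 2 ^ D)) by ring.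
apply: wp_seq; apply: wp_weaken (leqnn _) _ (wp_load ql env hq) => // s1 [e1 [ch1 hN1 hm1 hr1]].
have [c1 k1] := ch1.
apply: wp_seq; apply: wp_assign.
have ht1 : eval_expr w s1 (Const 2 [*] Reg rTot) = G * (2 * 2 ^ D) * m.
  have h : regs s1 rTot = G * (m * 2 ^ D) by rewrite c1.
  by rewrite E2; ev; move: w3 TS Sw; rewrite ?E2; alia.
rewrite ht1; set s2 := State _ _.
have ch2 : changes S conv_regs s s2.
  by apply: changes_assign => //; apply: changes_sub ch1 => y; rewrite !inE => /or3P[] ->; rewrite ?orbT.
have hS2 : regs s2 rS = S by rewrite (proj1 ch2).
have hf2 : holds w S s2 (down e q a) (G * (m * 2 ^ D)).
  by move=> i it; rewrite -hf // /s2 /= e1.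
apply: wp_seq; apply: wp_weaken (leqnn _) _ (wp_overwrite (tot := G * (2 * 2 ^ D) * m)
  (f := lift_step (m * 2 ^ D) (2 ^ D) m (down e q a)) w0 Sw w3 _ _ _ _) => //; last first.
  move=> s' i it ex iI; have [r' _] := ex.
  apply: (eval_lift w0 Sw w3 (G := G)) => //; rewrite ?r' //.
  apply: holds_except ex => //; last exact: ltnW.
  by apply: leq_trans (ltnW TS); rewrite E2 leq_pmull.
move=> s3 [ch3 hf3].
have ch3' : changes S conv_regs s s3.
  by apply: changes_trans ch2 (changes_sub _ ch3) => y; rewrite !inE => /eqP ->.
have hm3 : regs s3 rM = m by rewrite (proj1 ch3).
apply: wp_seq; apply: wp_assign.
have -> : eval_expr w s3 (Const 2 [*] Reg rM [-] Const 1) = 2 * m - 1.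
  by ev; move: w3 mS TS Sw m0; alia.
set s4 := State _ _.
have ch4 : changes S conv_regs s s4 by apply: changes_assign.
apply: wp_seq; apply: wp_weaken (leqnn _) _ (wp_fft (s := s4) (m := m) (D := D) (d := 2 * m - 1)
  (f := lift_step (m * 2 ^ D) (2 ^ D) m (down e q a)) (G := G) _ _ _ _ _ _ _ _ _ _ _ _) => //.
- move=> s5 [ch5 hf5].
  have ch5' : changes S conv_regs s s5.
    by apply: changes_trans ch4 (changes_sub _ ch5) => y; rewrite !inE => /orP[] /eqP ->.
  apply: wp_assign; split.
  + exact: changes_assign.
  + rewrite /= regs_upd eqxx -[RHS]addn1.
    have hq5 : regs s5 rQ = q by rewrite (proj1 ch5) // /s4 /upd /= (proj1 ch3) // /s2 /upd /= c1.
    by ev; move: w3 (lev_lt_S) ql Sw; alia.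
  + by rewrite /upd /= (proj1 ch5) // /s4 /upd /= (proj1 ch3).
  + exact: hf5.
- by rewrite (proj1 ch4).
- by rewrite /s4 /upd /= (proj1 ch3).
- by rewrite /s4 /upd /= (proj1 ch3).
- by move: m0; alia.
Qed.

Lemma wp_up_level q s c : q < lev -> level_env s -> regs s rQ = q.+1 ->
  regs s rTot = 2 ^ e * 2 ^ q.+1 -> holds w S s c (2 ^ e * 2 ^ q.+1) ->
  wp w up_level (e.+1 * (total * 800)) (fun s' => [/\ changes S conv_regs s s',
    regs s' rQ = q, regs s' rTot = 2 ^ e * 2 ^ q &
    holds w S s' (level_up (width e q)./2 (2 ^ width e q.+1) c) (2 ^ e * 2 ^ q)]) s.
Proof.
move=> ql env hq ht hf.
have [m0 mm De] := level_bounds ql.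
have [Et Et1] := level_shape q.
have tl := pow_lev_le ql.
have TS : 2 ^ e * 2 ^ q.+1 < S by exact: leq_ltn_trans levS.
have G0 : 0 < 2 ^ (e + q - width e q) by rewrite expn_gt0.
have Dm : 2 ^ (width e q)./2 %| 2 ^ width e q.+1 by apply: dvdn_exp2l; apply: half_width_le.
have r0 : 0 < 2 ^ (width e q)./2 by rewrite expn_gt0.
have mS : 2 ^ width e q.+1 <= 2 ^ e * 2 ^ q.+1 by rewrite Et1 leq_pmull // muln_gt0 G0 muln_gt0.
have cl : cost unlift_expr <= 89 by [].
apply: (@wp_weaken _ _ (4 + (22 + (2 + (((width e q)./2.+1 * (2 ^ e * 2 ^ q.+1 * 200 + 50) + 20) +
   (4 + (2 ^ e * 2 ^ q * (cost unlift_expr + 40) + 20))))))).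
  apply: leq_trans (level_cost De (isT : 129 <= 300)).
  have h1 : (width e q)./2.+1 * (2 ^ e * 2 ^ q.+1 * 200 + 50) <=
            (width e q)./2.+1 * (total * 200 + 50) by rewrite leq_mul2l leq_add2r leq_mul2r tl !orbT.
  have h2 : 2 ^ e * 2 ^ q * (cost unlift_expr + 40) <= total * 129.
    by apply: leq_mul; [apply: pow_lev_le; exact: ltnW | rewrite (leq_add2r 40 _ 89)].
  by move: h1 h2; alia.
  by move=> s'; exact.
move: Et1 hf ht TS mS mm m0 Dm r0.
rewrite Et; set m := 2 ^ width e q.+1; set D := (width e q)./2; set G := 2 ^ (e + q - _).
move=> -> hf ht TS mS mm m0 Dm r0.
have E2 : G * (2 * 2 ^ D) * m = 2 * (G * (m * 2 ^ D)) by ring.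
apply: wp_seq; apply: wp_assign.
have -> : eval_expr w s (Reg rQ [-] Const 1) = q.
  by rewrite -[RHS](subn1 q.+1); ev; move: w3 (lev_lt_S) ql Sw; alia.
set s0 := State _ _.
have ch0 : changes S conv_regs s s0 by apply: changes_assign.
have env0 := level_env_changes env ch0.
have [hS0 _ _ _] := env0.
apply: wp_seq; apply: wp_weaken (leqnn _) _ (wp_load (s := s0) ql env0 _) => // s1 [e1 [ch1 hN1 hm1 hr1]].
have [c1 k1] := ch1.
have ch1' : changes S conv_regs s s1.
  by apply: changes_trans ch0 (changes_sub _ ch1) => y; rewrite !inE => /or3P[] ->; rewrite ?orbT.
apply: wp_seq; apply: wp_assign.
have -> : eval_expr w s1 (Const 1) = 1 by apply: eval_const; move: w3; alia.
set s2 := State _ _.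
have ch2 : changes S conv_regs s s2 by apply: changes_assign.
apply: wp_seq; apply: wp_weaken (leqnn _) _ (wp_fft (s := s2) (m := m) (D := D) (d := 1)
  (f := c) (G := G) _ _ _ _ _ _ _ _ _ _ _ _) => //.
- move=> s3 [ch3 hf3].
  have ch3' : changes S conv_regs s s3.
    by apply: changes_trans ch2 (changes_sub _ ch3) => y; rewrite !inE => /orP[] /eqP ->.
  have ht3 : regs s3 rTot = G * (2 * 2 ^ D) * m by rewrite (proj1 ch3) // /s2 /upd /= c1.
  apply: wp_seq; apply: wp_assign.
  have -> : eval_expr w s3 (Reg rTot [/] Const 2) = G * (m * 2 ^ D).
    rewrite (eval_div (x := G * (2 * 2 ^ D) * m) (y := 2)) //; last first.
      by apply: eval_const; move: w3; alia.
    by rewrite E2 mulKn.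
  set s4 := State _ _.
  have ch4 : changes S conv_regs s s4 by apply: changes_assign.
  have tS : G * (m * 2 ^ D) < S.
    by apply: leq_ltn_trans TS; rewrite E2 leq_pmull.
  apply: wp_weaken (leqnn _) _ (wp_overwrite (s := s4) (tot := G * (m * 2 ^ D))
    (f := unlift_step (m * 2 ^ D) (2 ^ D) m (fft m (2 ^ D) 1 D.+1 c)) w0 Sw w3 _ _ _ _) => //.
  + move=> s5 [ch5 hf5]; split=> //.
    * by apply: changes_trans ch4 (changes_sub _ ch5) => y; rewrite !inE => /eqP ->.
    * by rewrite (proj1 ch5) // /s4 /upd /= (proj1 ch3) // /s2 /upd /= c1.
    * by rewrite (proj1 ch5).
  + by rewrite (proj1 ch4) //; case: env.
  + move=> s' i it ex iI; have [r' _] := ex.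
    apply: (eval_unlift w0 Sw w3 (G := G)) => //; rewrite ?r' //.
    * by rewrite (proj1 ch4) //; case: env.
    * by rewrite /s4 /upd /= (proj1 ch3).
    * by rewrite /s4 /upd /= (proj1 ch3).
    * by rewrite /s4 /upd /= (proj1 ch3).
    * by apply: (holds_except w0 Sw w3 _ _ _ ex) => //; exact: ltnW.
- by rewrite (proj1 ch2) //; case: env.
- by rewrite /s2 /upd /= c1.
- by move=> i it; rewrite -hf // /s2 /= e1.
- by move: m0; alia.
Qed.

Lemma wp_down_prog s a : level_env s -> holds w S s a (2 ^ e) ->
  wp w down_prog (lev * (e.+1 * (total * 900)) + 10) (fun s' => [/\ changes S conv_regs s s',
    regs s' rQ = lev, regs s' rTot = total & holds w S s' (down e lev a) total]) s.
Proof.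
move=> env hf; have [hS hl hN _] := env.
pose I q s' := [/\ changes S conv_regs s s', regs s' rQ = q, regs s' rTot = 2 ^ e * 2 ^ q &
    holds w S s' (down e q a) (2 ^ e * 2 ^ q)].
apply: (@wp_weaken _ _ (2 + (2 + (lev * (3 + e.+1 * (total * 800)).+1 + 4))) _ (I lev)).
- have h : (3 + e.+1 * (total * 800)).+1 <= e.+1 * (total * 900).
    have h1 : e.+1 * (total * 900) = e.+1 * (total * 800) + e.+1 * (total * 100) by rewrite -!mulnDr.
    have h2 : 4 <= e.+1 * (total * 100).
      by apply: leq_trans (leq_pmull _ (ltn0Sn e)); move: total_gt0; lia.
    by rewrite h1; move: h2; alia.
  have : lev * (3 + e.+1 * (total * 800)).+1 <= lev * (e.+1 * (total * 900)).
    by rewrite leq_mul2l h orbT.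
  by alia.
- by move=> s' [].
apply: wp_seq; apply: wp_assign; apply: wp_seq; apply: wp_assign; apply: wp_while.
- move=> q s1 ql [ch1 hq1 ht1 hf1].
  have env1 := level_env_changes env ch1; have [_ hl1 _ _] := env1.
  split.
    by rewrite (eval_lt (x := q) (y := lev)) // ql.
  apply: wp_weaken (leqnn _) _ (wp_down_level ql env1 hq1 ht1 hf1) => s2 [ch2 *]; split=> //.
  exact: changes_trans ch2.
- move=> s1 [ch1 hq1 _ _]; have [_ hl1 _ _] := level_env_changes env ch1.
  by rewrite (eval_lt (x := lev) (y := lev)) // ltnn.
- split=> //=.
  + by apply: (@changes_assign _ _ (State _ _)) => //; apply: changes_assign.
  + by rewrite /upd /= /eval_expr mod0n.
  + by rewrite /upd /= muln1; exact: hN.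
  + by rewrite muln1.
Qed.

Lemma wp_up_prog s c : level_env s -> regs s rQ = lev -> regs s rTot = total ->
  holds w S s c total ->
  wp w up_prog (lev * (e.+1 * (total * 900)) + 10) (fun s' => changes S conv_regs s s' /\
    holds w S s' (up e lev c) (2 ^ e)) s.
Proof.
move=> env hq ht hf; have [hS hl hN _] := env.
(* The invariant describes what remains to be done: applying the levels still open to the present
   contents [c'] yields the final array. *)
pose I j s' := exists c', [/\ changes S conv_regs s s', regs s' rQ = lev - j,
    regs s' rTot = 2 ^ e * 2 ^ (lev - j), up e (lev - j) c' = up e lev c &
    holds w S s' c' (2 ^ e * 2 ^ (lev - j))].
apply: (@wp_weaken _ _ (lev * (3 + e.+1 * (total * 800)).+1 + 4) _ (I lev)).
- have h : (3 + e.+1 * (total * 800)).+1 <= e.+1 * (total * 900).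
    have h1 : e.+1 * (total * 900) = e.+1 * (total * 800) + e.+1 * (total * 100) by rewrite -!mulnDr.
    have h2 : 4 <= e.+1 * (total * 100).
      by apply: leq_trans (leq_pmull _ (ltn0Sn e)); move: total_gt0; lia.
    by rewrite h1; move: h2; alia.
  have : lev * (3 + e.+1 * (total * 800)).+1 <= lev * (e.+1 * (total * 900)).
    by rewrite leq_mul2l h orbT.
  by alia.
- by move=> s' [c' [h1 h2 h3]]; rewrite subnn /= muln1 => -> h5.
apply: wp_while.
- move=> j s1 jl [c' [ch1 hq1 ht1 hc hf1]].
  have env1 := level_env_changes env ch1.
  have Ej : lev - j = (lev - j.+1).+1 by rewrite subnSK.
  split.
    rewrite (eval_lt (x := 0) (y := lev - j)) ?subn_gt0 ?jl //.
    by apply: eval_const; move: w3; alia.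
  rewrite Ej in hq1 ht1 hc hf1.
  have ql : lev - j.+1 < lev by rewrite -Ej leq_subr.
  apply: wp_weaken (leqnn _) _ (wp_up_level ql env1 hq1 ht1 hf1) => s2 [ch2 h2 h3 h4].
  by eexists; split; [exact: changes_trans ch2 | exact: h2 | exact: h3 | exact: hc | exact: h4].
- move=> s1 [c' [ch1 hq1 _ _ _]].
  have h0 : regs s1 rQ = 0 by rewrite hq1 subnn.
  rewrite (eval_lt (x := 0) (y := 0)) //.
  by apply: eval_const; move: w3; alia.
- by exists c; rewrite subn0.
Qed.
End Transform.

(** * Tables of minimum numbers of coins *)

Section Tables.
Variables (C : pred nat) (t inf : nat).
Hypothesis C0 : forall v, C v -> 0 < v.
Implicit Types (F G : nat -> nat) (s : seq nat).

Definition attained F := forall j, j <= t -> F j < inf ->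
  exists s, [/\ all C s, sumn s = j & size s = F j].

(** Breadth-first search by number of coins. [attained] makes finite entries genuine and the last
    clause makes them minimal; for k < inf an entry is exact if k coins suffice and [inf]
    otherwise. *)
Definition bfs_table k F := [/\ forall j, j <= t -> F j <= k \/ F j = inf, attained F &
  forall s, all C s -> sumn s <= t -> size s <= k -> F (sumn s) <= size s].

Lemma bfs_table0 F : 0 < inf -> F 0 = 0 -> (forall j, 0 < j <= t -> F j = inf) -> bfs_table 0 F.
Proof.
move=> i0 F0 Fj; split=> [j jt|j jt|s _ _].
- by case: j jt => [|j] jt; [left; rewrite F0 | right; rewrite Fj].
- case: j jt => [|j] jt; last by rewrite Fj ?ltnn.
  by exists [::]; rewrite F0.
- by rewrite leqn0 size_eq0 => /eqP ->; rewrite F0.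
Qed.

Lemma bfs_tableS k F F' (X : nat -> bool) : k.+1 < inf -> bfs_table k F ->
  (forall j, j <= t -> reflect (exists v, [/\ C v, v <= j & F (j - v) < inf]) (X j)) ->
  (forall j, j <= t -> F' j = if F j < inf then F j else if X j then k.+1 else inf) ->
  bfs_table k.+1 F'.
Proof.
move=> ki [h1 h2 h3] hX hF; split=> [j jt|j jt|s].
- rewrite hF //; case: ifP => Fi.
    by left; case: (h1 j jt) => [/leqW //|E]; move: Fi; rewrite E ltnn.
  by case: (X j); [left | right].
- rewrite hF //; case: ifP => Fi; first exact: h2.
  case: (hX j jt) => [[v [Cv vj Fv]] _|_]; last by rewrite ltnn.
  have jv : j - v <= t by apply: leq_trans jt; apply: leq_subr.
  have [s [Cs es zs]] := h2 _ jv Fv.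
  exists (v :: s); split=> /=; first by rewrite Cv.
    by rewrite es subnKC.
  congr _.+1; rewrite zs; apply/eqP; rewrite eqn_leq; apply/andP; split.
    by case: (h1 _ jv) Fv => // ->; rewrite ltnn.
  (* If fewer than k coins made up j - v, then v and these would reach j with at most k coins, and
     the old entry at j would be finite. *)
  rewrite leqNgt; apply/negP => lt.
  have := h3 (v :: s); rewrite /= Cv Cs es subnKC // zs => /(_ isT jt lt).
  by move: Fi ki; lia.
- move=> Cs st; rewrite leq_eqVlt => /orP[/eqP zs|zs]; last first.
    rewrite hF //; have h := h3 s Cs st zs.
    by rewrite ifT // (leq_ltn_trans h) // (ltn_trans zs).
  rewrite hF //; case: ifP => Fi.
    rewrite zs; case: (h1 _ st) => [/leqW //|E]; by move: Fi; rewrite E ltnn.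
  case: (hX _ st) => [_|[]]; first by rewrite zs.
  case: s Cs st zs Fi => //= v s /andP[Cv Cs] st [zs] Fi.
  exists v; split=> //; first exact: leq_addr.
  rewrite addKn; apply: (@leq_ltn_trans k); last exact: ltnW.
  rewrite -zs; apply: h3 => //; last by rewrite zs.
  by apply: leq_trans st; apply: leq_addl.
Qed.

(** The k coins in [s1] may be arbitrary, special or not, and [s2] is unlimited. Such an upper bound
    becomes exact once every multiset of coins can be traded for one that splits in this way. *)
Definition dp_table (P : pred nat) k F := [/\ forall j, j <= t -> F j <= inf, attained F &
  forall s1 s2, all C s1 -> all P s2 -> size s1 <= k -> sumn s1 + sumn s2 <= t ->
    F (sumn s1 + sumn s2) <= size s1 + size s2].

Lemma dp_table0 k F : k < inf -> bfs_table k F -> dp_table pred0 k F.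
Proof.
move=> ki [h1 h2 h3]; split=> // [j jt|s1 s2 C1 C2 z1 st].
  by case: (h1 j jt) => [h|-> //]; apply: leq_trans h (ltnW ki).
by case: s2 C2 st => //= _; rewrite !addn0 => st; exact: h3.
Qed.

Lemma dp_table_sub (P P' : pred nat) k F : subpred P' P -> dp_table P k F -> dp_table P' k F.
Proof.
by move=> sub [h1 h2 h3]; split=> // s1 s2 C1 C2; apply: h3 => //; apply: sub_all C2.
Qed.

(** The recurrence refers to F' itself at j - x, so a single pass admits any number of copies of x.
    Nothing prevents x from satisfying P already. *)
Lemma dp_tableU (P : pred nat) k F F' x : C x -> dp_table P k F ->
  (forall j, j <= t -> F' j = if x <= j then minn (F j) (F' (j - x)).+1 else F j) ->
  dp_table (predU P (pred1 x)) k F'.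
Proof.
move=> Cx [h1 h2 h3] hF.
have x0 := C0 Cx.
have le j : j <= t -> F' j <= F j by move=> jt; rewrite hF //; case: ifP => // _; exact: geq_minl.
split=> [j jt|j|s1 s2 C1].
- exact: leq_trans (le j jt) (h1 j jt).
- have [n] := ubnP j; elim: n j => // n IH j jn jt; rewrite hF //; case: ifP => xj; last exact: h2.
  rewrite /minn; case: ifP => [_|_]; first exact: h2.
  move=> lt.
  have j1 : j - x < n by move: x0 xj jn; lia.
  have j2 : j - x <= t by apply: leq_trans jt; apply: leq_subr.
  have [s [Cs es zs]] := IH (j - x) j1 j2 (ltnW lt).
  exists (x :: s); split=> /=; first by rewrite Cx.
    by rewrite es subnKC.
  by rewrite zs.
- elim: (size s2) {-2}s2 (leqnn (size s2)) => [|n IH] {}s2.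
    rewrite leqn0 size_eq0 => /eqP -> _ z1 st; apply: leq_trans (le _ st) _.
    exact: (h3 s1 [::]).
  move=> z2 P2 z1 st.
  case: (boolP (x \in s2)) => xs; last first.
    apply: leq_trans (le _ st) _; apply: h3 => //; apply/allP => y ys.
    have := allP P2 _ ys; rewrite /= => /orP[//|/eqP E].
    by rewrite -E ys in xs.
  have p := perm_to_rem xs.
  have Es := perm_sumn p; have Ez := perm_size p; rewrite /= in Es Ez.
  rewrite Es Ez in st z2 *.
  rewrite hF // ifT; last by rewrite addnCA leq_addr.
  rewrite (_ : sumn s1 + (x + _) - x = sumn s1 + sumn (rem x s2)); last by lia.
  apply: leq_trans (geq_minr _ _) _; rewrite addnS ltnS; apply: IH => //.
  + by move: P2; rewrite (perm_all _ p) => /andP[].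
  + by apply: leq_trans st; rewrite leq_add2l leq_addl.
Qed.

Lemma dp_table_final L Q F : 0 < L -> Q.+1 * (Q * (L * L)).+1 < 2 ^ Q -> t <= L * (L * L) ->
  dp_table (special C L) (Q.+1 * L) F ->
  forall s, all C s -> sumn s <= t -> F (sumn s) <= size s.
Proof.
move=> L0 QL tL [h1 h2 h3] s Cs st.
have [s1 [s2 [C1 S2 es zs z1]]] := few_not_special L0 QL tL st Cs.
by rewrite -es -zs; apply: h3 => //; rewrite es.
Qed.
End Tables.

(** * Multisets as lists and as multiplicities *)

Section Coins.
Variables (V : seq nat) (t : nat).
Hypothesis uV : uniq V.
Hypothesis V0 : all (fun v => 0 < v) V.
Definition usable v := (v \in V) && (v <= t).

Lemma usable_gt0 v : usable v -> 0 < v.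
Proof. by case/andP => /(allP V0). Qed.

Lemma sum_count_mem (s : seq nat) (g : nat -> nat) : all usable s ->
  \sum_(i < size V) count_mem (nth 0 V i) s * g (nth 0 V i) = \sum_(x <- s) g x.
Proof.
move=> Us; rewrite -(big_mkord predT (fun i => count_mem (nth 0 V i) s * g (nth 0 V i))).
rewrite -(big_nth 0 predT (fun v => count_mem v s * g v)).
elim: s Us => [|x s IH] /=; first by rewrite big_nil big1.
case/andP => /andP[xV _] /IH {}IH; rewrite big_cons -IH.
rewrite (eq_bigr (fun v => (x == v) * g v + count_mem v s * g v)) => [|v _]; last by rewrite mulnDl.
rewrite big_split /=; congr (_ + _).
rewrite (bigD1_seq x) //= eqxx mul1n big1 ?addn0 // => v.
by rewrite eq_sym => /negbTE ->.
Qed.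

Lemma pays_of_seq s : all usable s -> exists m, pays V (sumn s) m /\ \sum_(i < size V) m i = size s.
Proof.
move=> Us; exists (fun i => count_mem (nth 0 V i) s); split.
  rewrite /pays (sum_count_mem (fun x => x)) //.
  by rewrite sumnE.
rewrite -(sum1_size s) -[RHS](sum_count_mem (fun=> 1) Us).
by apply: eq_bigr => i _; rewrite muln1.
Qed.

Lemma seq_of_pays j m : j <= t -> pays V j m ->
  exists s, [/\ all usable s, sumn s = j & size s = \sum_(i < size V) m i].
Proof.
move=> jt; rewrite /pays => E.
exists (flatten [seq nseq (m i) (nth 0 V i) | i <- enum 'I_(size V)]); split.
- apply/allP => x /flattenP[_ /mapP[i _ ->]]; rewrite mem_nseq => /andP[m0 /eqP ->].
  rewrite /usable mem_nth //=; apply: leq_trans jt; rewrite -E (bigD1 i) //=.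
  by apply: leq_trans (leq_addr _ _); rewrite leq_pmull.
- rewrite -E sumn_flatten -map_comp sumnE big_map big_enum /=.
  by apply: eq_bigr => i _; rewrite /= sumn_nseq mulnC.
- rewrite size_flatten /shape -map_comp sumnE big_map big_enum /=.
  by apply: eq_bigr => i _; rewrite /= size_nseq.
Qed.

(** Coins are positive, so a sum j takes at most j <= t coins; since t < inf, the entry [inf] can
    only mean that there is no way to pay j. *)
Lemma min_coins_of_table inf F : t < inf -> (forall j, j <= t -> F j <= inf) ->
  attained usable t inf F ->
  (forall s, all usable s -> sumn s <= t -> F (sumn s) <= size s) ->
  forall j, j <= t ->
  exists o, is_min_coins V j o /\ (F j < inf) * (F j + 1) = encode o.
Proof.
move=> ti Finf at_ min j jt; case: (ltnP (F j) inf) => Fi.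
- exists (Some (F j)); split; last by rewrite mul1n addn1.
  have [s [Us es zs]] := at_ j jt Fi; split.
    by rewrite -zs -es; apply: pays_of_seq.
  by move=> m /(seq_of_pays jt) [s' [U' e' <-]]; rewrite -e'; apply: min; rewrite ?e'.
- exists None; split=> // m /(seq_of_pays jt) [s [Us es _]].
  have zs : size s <= sumn s.
    elim: (s) Us => //= x u IH /andP[/usable_gt0 x0 /IH]; by move: x0; lia.
  have := min s Us; rewrite es => /(_ jt).
  by move: Fi zs ti jt; rewrite es; lia.
Qed.
End Coins.

(** * The main program *)

(** The number of rounds is [Q.+1 * L] with Q = 6 e. In the region size S, the square of N has room
    for the padded transform and for all values below [L * L], and n + 2 for the input. *)
Definition size_prog : prog :=
  rT ::= Read (Const 0) ;; rCount ::= Read (Const 1) ;;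
  rExp ::= Const 0 ;; rN ::= Const 1 ;;
  While (Reg rN [<] Const 2 [*] Reg rT [+] Const 2)
    (rN ::= Const 2 [*] Reg rN ;; rExp ::= Reg rExp [+] Const 1) ;;
  rL ::= Const 0 ;;
  While (Reg rL [*] Reg rL [*] Reg rL [<] Reg rT) (rL ::= Reg rL [+] Const 1) ;;
  rRounds ::= (Const 6 [*] Reg rExp [+] Const 1) [*] Reg rL ;;
  rInf ::= Reg rT [+] Reg rRounds [+] Const 1 ;;
  rS ::= Reg rN [*] Reg rN [+] Reg rCount [+] Const 2.

(** No logarithms are computed: the least power of two whose square reaches the present length has
    half its exponent, rounded up. The levels end at length 2. *)
Definition level_prog : prog :=
  rQ ::= Const 0 ;; rNcur ::= Reg rN ;; Store (cell 3 (Reg rQ)) (Reg rNcur) ;;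
  While (Const 2 [<] Reg rNcur)
    (rM ::= Const 1 ;;
     While (Reg rM [*] Reg rM [<] Reg rNcur) (rM ::= Const 2 [*] Reg rM) ;;
     rNcur ::= Reg rM ;; rQ ::= Reg rQ [+] Const 1 ;;
     Store (cell 3 (Reg rQ)) (Reg rNcur)) ;;
  rLev ::= Reg rQ.

Definition mark_prog : prog :=
  rI ::= Const 0 ;;
  While (Reg rI [<] Reg rCount)
    (rV ::= Read (Const 2 [+] Reg rI) ;;
     If (Reg rV [<] Reg rT [+] Const 1) (Store (cell 1 (Reg rV)) (Const 1)) Skip ;;
     rI ::= Reg rI [+] Const 1).

Definition cube_root t : nat := find (fun l => t <= l * l * l) (iota 0 t.+1).

Lemma cube_root_spec t : t <= cube_root t * cube_root t * cube_root t /\ cube_root t <= t.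
Proof.
have h : has (fun l => t <= l * l * l) (iota 0 t.+1).
  apply/hasP; exists t; first by rewrite mem_iota add0n leq0n ltnSn.
  by case: (t) => // u; rewrite -mulnA leq_pmulr.
move: (h) (nth_find 0 h); rewrite has_find size_iota -/(cube_root t) => lt.
by rewrite nth_iota // add0n => h1; rewrite -ltnS.
Qed.

Lemma cube_root_min t l : l < cube_root t -> l * l * l < t.
Proof.
move=> lt; have := before_find 0 lt; rewrite nth_iota; first by rewrite add0n ltnNge => ->.
by apply: leq_trans lt _; rewrite (leq_trans (find_size _ _)) // size_iota.
Qed.

Definition depth e : nat := find (fun q => width e q <= 1) (iota 0 e.+1).

Lemma width_le1 e q : e <= 2 ^ q -> width e q <= 1.
Proof.
elim: q e => [|q IH] e //; rewrite expnS => h.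
by rewrite /width iterSr; apply: IH; rewrite leq_uphalf_double -mul2n.
Qed.

Lemma width_gt0 e q : 0 < e -> 0 < width e q.
Proof. by move=> e0; elim: q => //= q; rewrite /width /= uphalf_gt0. Qed.

(** The second part bounds the padding factor: about log e halvings reach width 1, so doubling at
    each level costs a factor O(e). *)
Lemma depth_spec e : 0 < e -> width e (depth e) = 1 /\ 2 ^ depth e <= 2 * e.
Proof.
move=> e0.
have h : has (fun q => width e q <= 1) (iota 0 e.+1).
  apply/hasP; exists e; first by rewrite mem_iota add0n leq0n ltnSn.
  by apply: width_le1; apply: ltnW; apply: ltn_expl.
move: (h) (nth_find 0 h); rewrite has_find size_iota -/(depth e) => lt.
rewrite nth_iota // add0n => h1; split.
  by apply/eqP; rewrite eqn_leq h1 width_gt0.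
case E: (depth e) lt => [|d] lt; first by rewrite muln_gt0.
rewrite expnS leq_mul2l /= leqNgt; apply/negP => /ltnW /width_le1 h2.
have := @before_find _ 0 (fun q => width e q <= 1) (iota 0 e.+1) d.
rewrite -/(depth e) E ltnSn nth_iota ?(ltnW lt) // add0n => /(_ isT).
by rewrite h2.
Qed.

Lemma depth_min e q : q < depth e -> 1 < width e q.
Proof.
move=> lt; have := before_find 0 lt; rewrite nth_iota; first by rewrite add0n ltnNge => ->.
by apply: leq_trans lt _; rewrite (leq_trans (find_size _ _)) // size_iota.
Qed.

Definition exponent t := up_log 2 (2 * t + 2).

Lemma exponent_spec t : 0 < t -> [/\ 2 * t + 2 <= 2 ^ exponent t,
  2 ^ exponent t < 4 * t + 4, 1 < exponent t & forall j, j < exponent t -> 2 ^ j < 2 * t + 2].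
Proof.
move=> t0; rewrite /exponent; set x := 2 * t + 2.
have x4 : 4 <= x by rewrite /x; move: t0; lia.
have x1 : 1 < x by apply: leq_trans x4.
have h1 : x <= 2 ^ up_log 2 x by apply: up_logP.
have h2 := @up_log_gtn 2 x isT x1.
have e1 : 1 < up_log 2 x.
  rewrite ltnNge; apply/negP => e1.
  have : 2 ^ up_log 2 x <= 2 by rewrite -[X in _ <= X](expn1 2) leq_exp2l.
  by move=> /(leq_trans h1) /(leq_trans x4).
split=> //.
  have -> : 2 ^ up_log 2 x = 2 * 2 ^ (up_log 2 x).-1 by rewrite -expnS prednK // ltnW.
  by rewrite (_ : 4 * t + 4 = 2 * x) ?ltn_pmul2l // /x; lia.
move=> j je; apply: leq_ltn_trans h2; rewrite leq_exp2l //.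
by rewrite -ltnS prednK // ltnW.
Qed.

(** Magnitudes are compared with powers of B = t + n + 1, which is at least 2, so that constants and
    sums are absorbed into the exponent. *)
Lemma coarse_mul B c k x a : 1 < B -> c <= 2 ^ k -> x <= B ^ a -> c * x <= B ^ (k + a).
Proof.
move=> B1 ck xa; rewrite expnD; apply: leq_mul => //.
by apply: leq_trans ck _; case: k => // k; rewrite leq_exp2r.
Qed.

Lemma coarse_add B x y a : 1 < B -> x <= B ^ a -> y <= B ^ a -> x + y <= B ^ a.+1.
Proof.
move=> B1 xa ya; apply: leq_trans (leq_add xa ya) _.
by rewrite addnn -mul2n expnS leq_mul2r B1 orbT.
Qed.

(** * Magnitudes that fit into a word *)

Section Setup.
Variables (w t n e L R S lev : nat).
Hypothesis t0 : 0 < t.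
Hypothesis w0 : 0 < w.
Hypothesis Nlo : 2 * t + 2 <= 2 ^ e.
Hypothesis Nhi : 2 ^ e < 4 * t + 4.
Hypothesis e1 : 1 < e.
Hypothesis Nmin : forall j, j < e -> 2 ^ j < 2 * t + 2.
Hypothesis EL : L = cube_root t.
Hypothesis ER : R = (6 * e + 1) * L.
Hypothesis ES : S = 2 ^ e * 2 ^ e + n + 2.
Hypothesis Elev : lev = depth e.
Hypothesis big : (t + n + 1) ^ 16 <= 2 ^ w.

Lemma lev_bound : 2 ^ lev <= 2 * e /\ 2 ^ lev <= 2 ^ e.
Proof.
have [_] := depth_spec (ltnW e1); rewrite -Elev => h; split=> //; apply: leq_trans h _.
have -> : 2 ^ e = 2 * 2 ^ e.-1 by rewrite -expnS prednK // ltnW.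
rewrite leq_mul2l /=; apply: leq_trans (ltn_expl e.-1 (isT : 1 < 2)).
by rewrite prednK // ltnW.
Qed.

(** The exponent 16 is generous, no estimate here going beyond B^13. The last bound is for the
    scaled convolution: 2^gain is at most the padded length, and a coefficient counts at most (t +
    1)^2 pairs. *)
Lemma word_bounds : [/\ 8 * S <= 2 ^ w, 8 < 2 ^ w, 8 * (2 ^ e * 2 ^ e) <= 2 ^ w,
  2 ^ e * 2 ^ lev < S & 8 * (t * t * t + R + t) < 2 ^ w /\
  2 ^ e * 2 ^ lev * (t.+1 * t.+1) < 2 ^ w].
Proof.
move: big; set B := t + n + 1 => bigB.
have B1 : 1 < B by rewrite /B addn1 ltnS addn_gt0 t0.
have [l1 l2] := lev_bound.
have [_] := cube_root_spec t; rewrite -EL => Lt.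
have up a x : a <= 16 -> x <= B ^ a -> x <= 2 ^ w.
  by move=> a16 xa; apply: leq_trans bigB; apply: leq_trans xa _; rewrite leq_exp2l.
have tB : t <= B ^ 1 by rewrite expn1 /B -addnA leq_addr.
have NB : 2 ^ e <= B ^ 3.
  apply: (@leq_trans (4 * B)); last by apply: (@coarse_mul _ 4 2 B 1) => //; rewrite expn1.
  by move: Nhi; rewrite /B; alia.
have NNB : 2 ^ e * 2 ^ e <= B ^ 6 by rewrite (expnD B 3 3) leq_mul.
have SB : S <= B ^ 7.
  rewrite ES -addnA; apply: coarse_add => //.
  have : B ^ 1 <= B ^ 6 by rewrite leq_exp2l.
  by apply: leq_trans; rewrite expn1 /B; move: t0; alia.
have eB : e <= B ^ 3 by apply: leq_trans NB; apply: ltnW; apply: ltn_expl.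
have RB : R <= B ^ 8.
  rewrite ER (expnD B 7 1); apply: leq_mul; last exact: leq_trans tB.
  apply: coarse_add => //; first exact: (@coarse_mul _ 6 3).
  by rewrite expn_gt0 ltnW.
split.
- by apply: (up 10) => //; apply: (@coarse_mul _ 8 3).
- apply: (@leq_trans (B ^ 4)); last exact: up (leqnn _).
  by apply: (@leq_trans (2 ^ 4)) => //; rewrite leq_exp2r.
- by apply: (up 9) => //; apply: (@coarse_mul _ 8 3).
- apply: leq_ltn_trans (leq_mul (leqnn _) l2) _.
  by rewrite ES -addnA addn2 addnS ltnS leq_addr.
split.
  apply: (@leq_ltn_trans (B ^ 13)); last first.
    by apply: leq_trans bigB; rewrite ltn_exp2l.
  apply: (@coarse_mul _ 8 3 _ 10) => //; apply: coarse_add => //; last first.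
    by apply: leq_trans tB _; rewrite leq_exp2l.
  apply: coarse_add => //; rewrite (expnD B 5 3).
  apply: (@leq_trans (B ^ 3)); last by rewrite leq_pmull // expn_gt0 ltnW.
  by rewrite !expnS expn0 muln1 mulnA; rewrite expn1 in tB; rewrite !leq_mul.
apply: (@leq_ltn_trans (B ^ 8)); last by apply: leq_trans bigB; rewrite ltn_exp2l.
rewrite (expnD B 6 2); apply: leq_mul.
  by apply: leq_trans NNB; rewrite leq_mul2l l2 orbT.
rewrite (expnD B 1 1) expn1; have tB1 : t.+1 <= B by rewrite /B -addn1 leq_add2r leq_addr.
exact: leq_mul.
Qed.
End Setup.

(** * Parameters, block lengths and marks *)

Section Phases.
Variables (w t : nat) (V : seq nat) (e L R S lev : nat).
Notation n := (size V).
Notation inf := (t + R + 1).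
Hypothesis t0 : 0 < t.
Hypothesis w0 : 0 < w.
Hypothesis Sw : 8 * S <= 2 ^ w.
Hypothesis w3 : 8 < 2 ^ w.
Hypothesis Nw : 8 * (2 ^ e * 2 ^ e) <= 2 ^ w.
Hypothesis levS : 2 ^ e * 2 ^ lev < S.
Hypothesis tRw : 8 * (t * t * t + R + t) < 2 ^ w.
Hypothesis Nlo : 2 * t + 2 <= 2 ^ e.
Hypothesis Nmin : forall j, j < e -> 2 ^ j < 2 * t + 2.
Hypothesis e1 : 1 < e.
Hypothesis EL : L = cube_root t.
Hypothesis ER : R = (6 * e + 1) * L.
Hypothesis ES : S = 2 ^ e * 2 ^ e + n + 2.
Hypothesis Elev : lev = depth e.

Lemma NS : 2 ^ e < S.
Proof. by apply: leq_ltn_trans levS; rewrite leq_pmulr // expn_gt0. Qed.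

Lemma Lt : L <= t.
Proof. by rewrite EL; case: (cube_root_spec t). Qed.

Lemma L_gt0 : 0 < L.
Proof.
rewrite lt0n; apply/eqP => L0; case: (cube_root_spec t) => + _; rewrite -EL L0 !muln0.
by rewrite leqNgt t0.
Qed.

Lemma wp_size_prog : wp w size_prog (e * 20 + L * 20 + 100)
  (fun s => [/\ regs s rT = t, regs s rCount = n, regs s rN = 2 ^ e, regs s rL = L &
     [/\ regs s rRounds = R, regs s rInf = inf, regs s rS = S & ram s = ram (input t V)]])
  (input t V).
Proof.
have NS := NS.
have LR : L <= R by rewrite ER leq_pmull // addn1.
have eR : 6 * e + 1 <= R by rewrite ER leq_pmulr // L_gt0.
pose I1 j s := [/\ regs s rT = t, regs s rCount = n, regs s rN = 2 ^ j, regs s rExp = j &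
  ram s = ram (input t V)].
pose I2 j s := [/\ regs s rT = t, regs s rCount = n, regs s rN = 2 ^ e, regs s rExp = e &
  regs s rL = j /\ ram s = ram (input t V)].
apply: wp_le.
  apply: wp_seq; apply: wp_assign.
  apply: wp_seq; apply: wp_assign.
  apply: wp_seq; apply: wp_assign.
  apply: wp_seq; apply: wp_assign.
  apply: wp_seq; apply: (wp_weaken (leqnn _) _ (wp_while (c := 10) (k := e) (I := I1) _ _ _)).
  - move=> s [h1 h2 h3 h4 h5].
    apply: wp_seq; apply: wp_assign.
    apply: wp_seq; apply: (wp_weaken (leqnn _) _ (wp_while (c := 4) (k := L) (I := I2) _ _ _)).
    + move=> {h1 h2 h3 h4 h5}s1 [h1 h2 h3 h4 [h5 h6]].
      apply: wp_seq; apply: wp_assign.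
      have -> : eval_expr w s1 ((Const 6 [*] Reg rExp [+] Const 1) [*] Reg rL) = R.
        by rewrite ER; ev; rewrite -?ER; move: w3 tRw eR; alia.
      set s2 := State _ _; apply: wp_seq; apply: wp_assign.
      have -> : eval_expr w s2 (Reg rT [+] Reg rRounds [+] Const 1) = inf.
        have [r1 r2] : regs s2 rT = t /\ regs s2 rRounds = R by [].
        by ev; move: w3 tRw; alia.
      set s3 := State _ _; apply: wp_assign.
      have -> : eval_expr w s3 (Reg rN [*] Reg rN [+] Reg rCount [+] Const 2) = S.
        have [r1 r2] : regs s3 rN = 2 ^ e /\ regs s3 rCount = n by [].
        by rewrite ES; ev; move: w3 Nw Sw; rewrite ES; alia.
      by split=> //; split.
    + move=> j s1 jL [r1 r2 r3 r4 [r5 r6]].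
      have jt : j * j * j < t by apply: cube_root_min; rewrite -EL.
      have jj : j * j <= t * t by apply: leq_mul; apply: leq_trans Lt; exact: ltnW.
      have tt : t * t <= t * t * t by rewrite leq_pmulr.
      split.
        rewrite (eval_lt (x := j * j * j) (y := t)) //; first by rewrite jt.
        by ev; move: jt jj tt tRw; alia.
      apply: wp_le; first apply: wp_assign; last by [].
      have Ej : eval_expr w s1 (Reg rL [+] Const 1) = j.+1.
        by rewrite -[RHS]addn1; ev; move: jL LR tRw w3; alia.
      by rewrite Ej; split.
    + move=> s1 [r1 r2 r3 r4 [r5 r6]].
      rewrite (eval_lt (x := L * L * L) (y := t)) //.
        by have [+ _] := cube_root_spec t; rewrite -EL ltnNge => ->.
      have h : L * L * L <= t * t * t by rewrite !leq_mul ?Lt.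
      have h' : L * L <= t * t by rewrite leq_mul ?Lt.
      have tt : t * t <= t * t * t by rewrite leq_pmulr.
      by ev; move: h h' tt tRw; alia.
    + by split=> //; split=> //=; rewrite /upd /= /eval_expr mod0n.
  - move=> j s je [h1 h2 h3 h4 h5].
    have jN : 2 * 2 ^ j <= 2 ^ e by rewrite -expnS leq_exp2l.
    split.
      rewrite (eval_lt (x := 2 ^ j) (y := 2 * t + 2)) //; first by rewrite Nmin.
      by ev; move: w3 tRw; alia.
    apply: wp_le.
      apply: wp_seq; apply: wp_assign.
      have -> : eval_expr w s (Const 2 [*] Reg rN) = 2 ^ j.+1.
        by rewrite expnS; ev; move: jN NS Sw w3; alia.
      set s1 := State _ _; apply: wp_assign.
      have r1 : regs s1 rExp = j by [].
      have -> : eval_expr w s1 (Reg rExp [+] Const 1) = j.+1.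
        by rewrite -[RHS]addn1; ev; move: je eR tRw w3; alia.
      by split.
    by [].
  - move=> s [h1 h2 h3 h4 h5].
    rewrite (eval_lt (x := 2 ^ e) (y := 2 * t + 2)) //; first by rewrite ltnNge Nlo.
    by ev; move: w3 tRw; alia.
  - split=> //=; rewrite /upd /= /eval_expr /=.
    + by rewrite mod0n.
    + by rewrite modn_small //; move: w3; alia.
    + by rewrite modn_small //; move: w3; alia.
    + by rewrite mod0n.
by rewrite /=; lia.
Qed.

Lemma levltS : lev < S.
Proof. exact: lev_lt_S levS. Qed.

Lemma wp_level_prog s : regs s rN = 2 ^ e -> regs s rS = S ->
  wp w level_prog (lev * (e * 20 + 50) + 30)
  (fun s' => [/\ regs s' rLev = lev, forall y, y \notin [:: rQ; rNcur; rM; rLev] -> regs s' y = regs s y,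
     forall a, ~~ (3 * S <= a < 4 * S) -> ram s' a = ram s a &
     forall q, q <= lev -> ram s' (3 * S + q) = 2 ^ width e q]) s.
Proof.
move=> hN hS; have NS := NS; have lS := levltS.
pose I q s' := [/\ regs s' rQ = q, regs s' rNcur = 2 ^ width e q,
  forall y, y \notin [:: rQ; rNcur; rM; rLev] -> regs s' y = regs s y,
  forall a, ~~ (3 * S <= a < 4 * S) -> ram s' a = ram s a &
  forall p, p <= q -> ram s' (3 * S + p) = 2 ^ width e p].
have addr k s' : regs s' rS = S -> regs s' rQ = k -> k <= lev ->
    eval_expr w s' (cell 3 (Reg rQ)) = 3 * S + k.
  move=> h1 h2 kl; apply: (eval_cell w0 Sw w3) => //.
  by move: kl lS Sw; alia.
have store k s' v (g : nat -> nat) : (forall p, p < k -> ram s' (3 * S + p) = g p) -> v = g k ->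
    forall p, p <= k -> upd (ram s') (3 * S + k) v (3 * S + p) = g p.
  move=> h -> p; rewrite leq_eqVlt /upd eqn_add2l => /orP[/eqP ->|pk]; first by rewrite eqxx.
  by rewrite ltn_eqF // h.
have frame k s' v a : k <= lev -> ~~ (3 * S <= a < 4 * S) -> upd (ram s') (3 * S + k) v a = ram s' a.
  move=> kl ha; rewrite /upd; case: eqP => // E; move: ha; rewrite E.
  by move: kl lS; alia.
apply: wp_le.
  apply: wp_seq; apply: wp_assign.
  apply: wp_seq; apply: wp_assign.
  set s1 := State _ _.
  apply: wp_seq; apply: wp_store.
  have Q0 : regs s1 rQ = 0 by rewrite /s1 /upd /= /eval_expr mod0n.
  have -> : eval_expr w s1 (cell 3 (Reg rQ)) = 3 * S + 0 by apply: addr.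
  have E1 : eval_expr w s1 (Reg rNcur) = 2 ^ e by rewrite -hN.
  rewrite E1.
  apply: wp_seq; apply: (wp_weaken (leqnn _) _ (wp_while (c := e * 20 + 40) (k := lev) (I := I) _ _ _)).
  - move=> s2 [h1 h2 h3 h4 h5]; apply: wp_assign; split=> // y yn.
    by rewrite /= /upd; case: eqP => [E|_]; [move: yn; rewrite E | exact: h3].
  - move=> q s2 ql [h1 h2 h3 h4 h5].
    have wq : 1 < width e q by apply: depth_min; rewrite -Elev.
    have we : 2 ^ width e q <= 2 ^ e by rewrite leq_exp2l // width_le.
    split.
      rewrite (eval_lt (x := 2) (y := 2 ^ width e q)) //; last by apply: eval_const; move: w3; alia.
      by rewrite -[X in X < _](expn1 2) ltn_exp2l ?wq.
    pose J j s3 := [/\ regs s3 rM = 2 ^ j, ram s3 = ram s2 &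
      forall y, y <> rM -> regs s3 y = regs s2 y].
    have w2 : width e q.+1 <= e by apply: width_le.
    apply: wp_le.
      apply: wp_seq; apply: wp_assign.
      apply: wp_seq; apply: (wp_weaken (leqnn _) _ (wp_while (c := 4) (k := width e q.+1) (I := J) _ _ _)).
      + move=> s3 [r1 r2 r3].
        have hS3 : regs s3 rS = S by rewrite r3 // h3.
        apply: wp_seq; apply: wp_assign.
        apply: wp_seq; apply: wp_assign.
        set s4 := State _ _.
        have Q4 : regs s4 rQ = q.+1.
          have r4 : eval_expr w (State (upd (regs s3) rNcur (eval_expr w s3 (Reg rM))) (ram s3))
              (Reg rQ [+] Const 1) = q + 1.
            apply: eval_add; first by rewrite /eval_expr /upd /= r3.
              by apply: eval_const; move: w3; alia.
            by move: ql lS Sw w3; alia.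
          by rewrite /s4 {1}/upd /= r4 addn1.
        apply: wp_store.
        have -> : eval_expr w s4 (cell 3 (Reg rQ)) = 3 * S + q.+1 by apply: addr.
        have E4 : eval_expr w s4 (Reg rNcur) = 2 ^ width e q.+1 by rewrite -r1.
        rewrite E4; split.
        * exact: Q4.
        * exact: E4.
        * move=> y yn; rewrite /= /upd; case: eqP => [E|_]; first by move: yn; rewrite E.
          case: eqP => [E|_]; first by move: yn; rewrite E.
          rewrite r3 ?h3 // => E; by move: yn; rewrite E.
        * by move=> a ha; rewrite /= (frame q.+1 s4) // /s4 /= r2 h4.
        * by apply: (store q.+1 s4 _ (fun p => 2 ^ width e p)) => // p pq; rewrite /s4 /= r2 h5.
      + move=> j s3 jw [r1 r2 r3].
        (* j is below the rounded half of the width exactly if 2j is below the width, so the test on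
           squares stops at the right exponent. *)
        have jw2 : j + j < width e q by rewrite addnn ltnNge -leq_uphalf_double -ltnNge.
        have hNc : regs s3 rNcur = 2 ^ width e q by rewrite r3.
        have jj : 2 ^ j * 2 ^ j < 2 ^ width e q by rewrite -expnD ltn_exp2l.
        have j1 : 2 * 2 ^ j <= 2 ^ e by rewrite -expnS leq_exp2l // (leq_trans jw).
        split.
          rewrite (eval_lt (x := 2 ^ j * 2 ^ j) (y := 2 ^ width e q)) //; first by rewrite jj.
          by ev; move: jj we NS Sw; alia.
        apply: wp_le; first apply: wp_assign; last by [].
        have -> : eval_expr w s3 (Const 2 [*] Reg rM) = 2 ^ j.+1.
          by rewrite expnS; ev; move: j1 NS Sw w3; alia.
        split=> // y yn; rewrite /= /upd; case: eqP => // _; exact: r3.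
      + move=> s3 [r1 r2 r3].
        have hNc : regs s3 rNcur = 2 ^ width e q by rewrite r3.
        have mm : 2 ^ width e q.+1 * 2 ^ width e q.+1 <= 2 ^ e * 2 ^ e by rewrite leq_mul // leq_exp2l.
        rewrite (eval_lt (x := 2 ^ width e q.+1 * 2 ^ width e q.+1) (y := 2 ^ width e q)) //.
          by rewrite -expnD ltn_exp2l // addnn ltnNge -leq_uphalf_double leqnn.
        by ev; move: mm Nw Sw; rewrite ES; alia.
      + split=> //=; first by rewrite /upd /= /eval_expr modn_small //; move: w3; alia.
        by move=> y yM; rewrite /upd; case: eqP.
    by move: w2; move: (width e q.+1) => W w2; rewrite /=; clear -w2; lia.
  - move=> s2 [h1 h2 h3 h4 h5].
    rewrite (eval_lt (x := 2) (y := 2 ^ width e lev)) //; last by apply: eval_const; move: w3; alia.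
    by rewrite Elev (proj1 (depth_spec (ltnW e1))).
  - split=> //=.
    + move=> y yn; rewrite /upd; case: eqP => [E|_]; first by move: yn; rewrite E.
      by case: eqP => [E|_] //; move: yn; rewrite E.
    + by move=> a ha; rewrite frame.
    + by apply: (store 0 _ _ (fun p => 2 ^ width e p)).
rewrite /=; have : lev * (3 + (e * 20 + 40)).+1 <= lev * (e * 20 + 50).
  by rewrite leq_mul2l; apply/orP; right; alia.
by alia.
Qed.

Lemma wp_mark_prog s : regs s rT = t -> regs s rCount = n -> regs s rS = S ->
  (forall i, i < n -> ram s (2 + i) = nth 0 V i) -> (forall v, v < S -> ram s (S + v) = 0) ->
  (forall v, v \in V -> v < 2 ^ w) ->
  wp w mark_prog (n * 40 + 10)
  (fun s' => [/\ forall y, y \notin [:: rI; rV] -> regs s' y = regs s y,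
     forall a, ~~ (S <= a < 2 * S) -> ram s' a = ram s a &
     forall v, v < S -> ram s' (S + v) = usable V t v]) s.
Proof.
move=> hT hn hS hV h0 Vw; have NS := NS.
have nS : n + 2 <= S by rewrite ES -addnA leq_addl.
have tS : t < S by move: Nlo NS; alia.
pose I i s' := [/\ regs s' rI = i, forall y, y \notin [:: rI; rV] -> regs s' y = regs s y,
     forall a, ~~ (S <= a < 2 * S) -> ram s' a = ram s a &
     forall v, v < S -> ram s' (S + v) = (v \in take i V) && (v <= t)].
apply: wp_le.
  apply: wp_seq; apply: wp_assign.
  apply: (wp_weaken (leqnn _) _ (wp_while (c := 35) (k := n) (I := I) _ _ _)).
  - move=> s2 [h1 h2 h3 h4]; split=> // v vS; by rewrite h4 // take_size.
  - move=> i s1 il [h1 h2 h3 h4].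
    have [hT1 hn1 hS1] : [/\ regs s1 rT = t, regs s1 rCount = n & regs s1 rS = S].
      by rewrite !h2.
    split.
      by rewrite (eval_lt (x := i) (y := n)) // il.
    set v := nth 0 V i.
    have vV : v \in V by apply: mem_nth.
    have tk : take i.+1 V = rcons (take i V) v by rewrite (take_nth 0).
    apply: wp_le.
      apply: wp_seq; apply: wp_assign.
      have -> : eval_expr w s1 (Read (Const 2 [+] Reg rI)) = v.
        apply: (eval_read (a := 2 + i)).
          by ev; move: il nS Sw w3; alia.
        rewrite h3 ?hV //; by move: il nS; alia.
      set s2 := State _ _.
      have [hV2 hT2 hS2] : [/\ regs s2 rV = v, regs s2 rT = t & regs s2 rS = S] by [].
      have Ec : eval_expr w s2 (Reg rV [<] Reg rT [+] Const 1) = (v <= t).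
        rewrite (eval_lt (x := v) (y := t + 1)) //; first by rewrite addn1 ltnS.
        by ev; move: tS Sw w3; alia.
      have Ei m : eval_expr w (State (regs s2) m) (Reg rI [+] Const 1) = i.+1.
        rewrite -[RHS]addn1; apply: eval_add; first exact: h1.
          by apply: eval_const; move: w3; alia.
        by move: il nS Sw w3; alia.
      have regsI y : y \notin [:: rI; rV] -> upd (upd (regs s1) rV v) rI i.+1 y = regs s y.
        move=> yn; rewrite /upd; case: eqP => [E|_]; first by move: yn; rewrite E.
        by case: eqP => [E|_]; [move: yn; rewrite E | exact: h2].
      apply: wp_seq; apply: wp_if => [|]; rewrite Ec.
      + move=> vt; have {}vt : v <= t by case: (v <= t) vt.
        apply: wp_le.
          apply: wp_store; apply: wp_assign.
          have -> : eval_expr w s2 (cell 1 (Reg rV)) = 1 * S + v.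
            by apply: (eval_cell w0 Sw w3) => //; move: vt tS Sw; alia.
          have -> : eval_expr w s2 (Const 1) = 1 by apply: eval_const; move: w3; alia.
          rewrite Ei mul1n; split=> //=.
          * move=> a ha; rewrite /upd; case: eqP => [E|_]; last exact: h3.
            by move: ha; rewrite E; move: vt tS; alia.
          * move=> u uS; rewrite /upd eqn_add2l tk mem_rcons inE.
            by case: eqP => [->|_] /=; [rewrite vt | rewrite h4].
        by [].
      + move=> vt; have {}vt : (v <= t) = false by case: (v <= t) vt.
        apply: wp_le; first apply: wp_skip.
          apply: wp_assign; rewrite (Ei (ram s2)); split=> //= u uS.
          rewrite h4 // tk mem_rcons inE; case: eqP => [->|_] //=.
          by rewrite vt andbF.
        by [].
    by [].
  - move=> s1 [h1 h2 h3 h4].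
    have hn1 : regs s1 rCount = n by rewrite h2.
    by rewrite (eval_lt (x := n) (y := n)) // ltnn.
  - split=> //=.
    + by rewrite /upd /= /eval_expr mod0n.
    + by move=> y yn; rewrite /upd; case: eqP => [E|_] //; move: yn; rewrite E.
    + by move=> v vS; rewrite take0 h0.
by rewrite /=; lia.
Qed.
End Phases.

(** The transform of the marks is the same in every round, so it is computed once and kept. *)
Definition coin_prog : prog :=
  rTot ::= Reg rN ;; overwrite (Read (cell 1 (Reg rI))) ;; down_prog ;;
  tabulate rI (Reg rTot) (Const 6 [*] Reg rS) (xcell (Reg rI)).

Definition init_prog : prog :=
  overwrite_at 2 (Reg rT [+] Const 1) (Reg rInf) ;; Store (cell 2 (Const 0)) (Const 0).

Definition source_expr : expr :=
  (Reg rI [<] Reg rT [+] Const 1) [*] (Read (cell 2 (Reg rI)) [<] Reg rInf).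

(** An update without branching: an infinite entry with positive convolution is lowered by inf - k,
    thus to the number k of the round, and all other entries stay. *)
Definition update_expr : expr :=
  Read (cell 2 (Reg rI)) [-]
  (Const 1 [-] (Read (cell 2 (Reg rI)) [<] Reg rInf)) [*] (Const 0 [<] xcell (Reg rI))
    [*] (Reg rInf [-] Reg rK).

Definition round_prog : prog :=
  rTot ::= Reg rN ;; overwrite source_expr ;; down_prog ;; overwrite base_expr ;; up_prog ;;
  overwrite_at 2 (Reg rT [+] Const 1) update_expr ;; rK ::= Reg rK [+] Const 1.

(** A level moves half of the width into the gain and adds one. At width 1 the gain is e + lev - 1,
    which keeps 2^gain below [total]. *)
Lemma gain_width e q : gain e q + width e q = e + q.
Proof.
elim: q => [|q IH]; first by rewrite addn0.
rewrite -[gain e q.+1]/((width e q)./2.+1 + gain e q).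
by move: (width_half e q) IH; move: (width e q) (width e q.+1) (gain e q) => x y z; lia.
Qed.

(** * Convolution rounds and passes for special coins *)

Section Rounds.
Variables (w t : nat) (V : seq nat) (e L R S lev : nat).
Notation n := (size V).
Notation inf := (t + R + 1).
Hypothesis t0 : 0 < t.
Hypothesis w0 : 0 < w.
Hypothesis Sw : 8 * S <= 2 ^ w.
Hypothesis w3 : 8 < 2 ^ w.
Hypothesis Nw : 8 * (2 ^ e * 2 ^ e) <= 2 ^ w.
Hypothesis levS : 2 ^ e * 2 ^ lev < S.
Hypothesis tRw : 8 * (t * t * t + R + t) < 2 ^ w.
Hypothesis gw : total e lev * (t.+1 * t.+1) < 2 ^ w.
Hypothesis Nlo : 2 * t + 2 <= 2 ^ e.
Hypothesis e1 : 1 < e.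
Hypothesis Elev : lev = depth e.

Definition main_regs : seq nat := [:: rT; rN; rS; rL; rRounds; rInf; rLev].

Definition main_env (s : state) := [/\ level_env S e lev s, regs s rT = t, regs s rL = L,
  regs s rRounds = R & regs s rInf = inf /\ forall v, v < S -> ram s (S + v) = usable V t v].

Lemma main_env_frame s s' : main_env s ->
  (forall y, y \in main_regs -> regs s' y = regs s y) ->
  (forall a, (S <= a < 2 * S) || (3 * S <= a < 4 * S) -> ram s' a = ram s a) -> main_env s'.
Proof.
move=> [[h1 h2 h3 h4] h5 h6 h7 [h8 h9]] hr hm.
have lS := lev_lt_S levS.
split; rewrite ?hr //; last by split; rewrite ?hr // => v vS; rewrite hm ?h9 //; lia.
by split; rewrite ?hr // => q ql; rewrite hm ?h4 //; lia.
Qed.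

Definition coin_fun (i : nat) : int := Posz (usable V t i).

Definition coin_table (s : state) :=
  forall j, j < total e lev -> ram s (6 * S + j) = word w (down e lev coin_fun j).

Lemma NltS : 2 ^ e < S.
Proof. by apply: leq_ltn_trans levS; rewrite leq_pmulr // expn_gt0. Qed.

Lemma tltS : t.+1 < S.
Proof. by have := NltS; move: Nlo; alia. Qed.

Lemma tltw : 8 * t.+1 < 2 ^ w.
Proof. by have := tltS; move: Sw; alia. Qed.

(** Levels times layers times array length: a bound, up to a constant, for the time of one
    transform. *)
Definition work : nat := lev.+1 * (e.+1 * total e lev).

Lemma work_bounds : [/\ 2 ^ e <= total e lev, total e lev <= work, 0 < total e lev, t < 2 ^ e &
  lev * (e.+1 * (total e lev * 900)) <= work * 900].
Proof.
split; rewrite ?total_gt0 //.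
- by rewrite /total leq_pmulr // expn_gt0.
- by rewrite /work mulnA leq_pmull.
- by move: Nlo; alia.
- by rewrite /work !mulnA !leq_mul2r leqnSn !orbT.
Qed.

Lemma wp_coin_prog s : main_env s ->
  wp w coin_prog (work * 1200 + 100) (fun s' => main_env s' /\ coin_table s') s.
Proof.
move=> env; have NS := NltS; have tS := tltS.
have [[hS hl hN hst] hT hL hR [hI hP]] := env.
have [b1 b2 b3 b4 b5] := work_bounds.
have totS : total e lev < S by [].
apply: wp_le.
  apply: wp_seq; apply: wp_assign.
  set s1 := State _ _.
  have hT1 : regs s1 rTot = 2 ^ e by [].
  have env1 : main_env s1.
    by apply: (main_env_frame env) => // y; rewrite !inE => yr; rewrite /s1 /= /upd;
       case: eqP => // E; move: yr; rewrite E.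
  apply: wp_seq; apply: (wp_weaken (leqnn _) _ (wp_overwrite (s := s1) (tot := 2 ^ e) (f := coin_fun) w0 Sw w3 NS _ _ _)) => //.
  - move=> s2 [[r2 m2] hf2].
    have env2 : main_env s2.
      apply: (main_env_frame env1) => [y yr|a ha]; last by apply: m2; move: ha; alia.
      by apply: r2; apply: contraL yr; rewrite !inE => /eqP ->.
    have [lenv2 _ _ _ _] := env2.
    apply: wp_seq; apply: (wp_weaken (leqnn _) _ (wp_down_prog w0 Sw w3 Nw levS lenv2 hf2)).
    move=> s3 [[r3 m3] _ ht3 hf3].
    have env3 : main_env s3.
      apply: (main_env_frame env2) => [y yr|a ha]; last by apply: m3; move: ha; alia.
      by apply: r3; apply: contraL yr; rewrite !inE; do !case/orP; do ?move=> /eqP -> //.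
    have [[hS3 _ _ _] _ _ _ _] := env3.
    have len_w : 6 * S + total e lev < 2 ^ w by move: totS Sw; alia.
    apply: (wp_weaken (leqnn _) _ (wp_tabulate (s := s3) (len := total e lev) (base := 6 * S)
      (f := fun i => word w (down e lev coin_fun i)) w0 len_w _ _ _)).
    + move=> s4 [[r4 m4] h4]; split=> //.
      apply: (main_env_frame env3) => [y yr|a ha]; last by apply: m4; move: ha; alia.
      by apply: r4 => E; move: yr; rewrite E.
    + by move=> s' [r' _]; apply: eval_reg; rewrite r'.
    + move=> s' [r' _]; have hS' : regs s' rS = S by rewrite r'.
      by ev; move: Sw w3 totS; alia.
    + move=> s' i it [r' m'] iI; apply: (eval_xcell w0 Sw w3 (tot := total e lev)) => //.
      * by rewrite r'.
      * by move=> j jt; rewrite m' ?hf3 //; move: jt totS; alia.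
  - move=> s' i it [r' m'] iI.
    have hS' : regs s' rS = S by rewrite r'.
    apply: (@eval_read _ _ _ (1 * S + i)).
      by apply: (eval_cell w0 Sw w3) => //; move: it NS Sw; alia.
    rewrite /coin_fun word_nat; last by apply: leq_ltn_trans (leq_b1 _) _; move: w3; alia.
    rewrite m' mul1n ?hP //; first exact: ltn_trans NS.
    by move: it NS; alia.
move: b1 b2 b3 b5; move: (lev * _) => d; move: (2 ^ e) (total e lev) work => x y z.
by rewrite /=; clear; lia.
Qed.

Definition table_at (s : state) (F : nat -> nat) := forall j, j <= t -> ram s (2 * S + j) = F j.

Lemma wp_init_prog s : main_env s -> coin_table s ->
  wp w init_prog (work * 100 + 100) (fun s' => [/\ main_env s', coin_table s' &
    table_at s' (fun j => if j == 0 then 0 else inf)]) s.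
Proof.
move=> env hc; have NS := NltS; have tS := tltS; have tw := tltw.
have [[hS hl hN hst] hT hL hR [hI hP]] := env.
have [b1 b2 b3 b4 b5] := work_bounds.
have totS : total e lev < S by [].
apply: wp_le.
  apply: wp_seq; apply: (wp_weaken (leqnn _) _ (wp_overwrite_at (k := 2) (len := t.+1)
     (f := fun _ => inf) w0 Sw w3 _ _ hS _ _)) => //.
  - move=> s1 [r1 m1 f1].
    have hS1 : regs s1 rS = S by rewrite r1.
    have E0 : eval_expr w s1 (Const 0) = 0 by apply: eval_const; move: w3; alia.
    apply: wp_store; rewrite E0.
    have -> : eval_expr w s1 (cell 2 (Const 0)) = 2 * S + 0.
      by apply: (eval_cell w0 Sw w3) => //; move: tS Sw; alia.
    split.
    + apply: (main_env_frame env) => [y yr|a ha] /=.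
        by apply: r1 => E; move: yr; rewrite E.
      rewrite /upd; case: eqP => [E|_].
        by move: ha tS; rewrite E; alia.
      by apply: m1; move: ha; alia.
    + move=> j jt /=; rewrite /upd; case: eqP => [E|_].
        by exfalso; move: E tS; alia.
      by rewrite m1 ?hc //; move: jt totS; alia.
    + move=> j jt /=; rewrite /upd eqn_add2l; case: eqP => // _.
      by rewrite f1.
  - move=> s' r'; rewrite -[RHS]addn1.
    have hT' : regs s' rT = t by rewrite r'.
    by ev; move: w3 tw; alia.
  - by move=> s' i it [r' _] iI; apply: eval_reg; rewrite r'.
move: b1 b2 b4; move: (2 ^ e) (total e lev) work => x y z.
by rewrite /=; clear; lia.
Qed.

Definition product_count (b c : nat -> bool) (j : nat) : nat :=
  \sum_(p < t.+1) \sum_(q < t.+1) if p + q == j then b p * c q else 0.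

Lemma product_count_gt0 (b c : nat -> bool) j : j <= t ->
  reflect (exists v, [/\ c v, v <= j & b (j - v)]) (0 < product_count b c j).
Proof.
move=> jt; apply: (iffP idP).
  rewrite lt0n sum_nat_eq0 => /forallPn[p]; rewrite implyTb sum_nat_eq0 => /forallPn[q].
  rewrite implyTb; case: (p + q =P j) => // E; case bp: (b p) => //; case cq: (c q) => // _.
  by exists q; rewrite cq -E addnK bp leq_addl.
move=> [v [cv vj bv]].
have vt : v < t.+1 by rewrite ltnS (leq_trans vj).
have jv : j - v < t.+1 by rewrite ltnS (leq_trans (leq_subr _ _)).
rewrite /product_count (bigD1 (Ordinal jv)) //= (bigD1 (Ordinal vt)) //=.
by rewrite subnK // eqxx bv cv.
Qed.

Lemma product_count_le (b c : nat -> bool) j : product_count b c j <= t.+1 * t.+1.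
Proof.
have sum_le (G : nat -> nat) M : (forall p, G p <= M) -> \sum_(p < t.+1) G p <= t.+1 * M.
  move=> GM; apply: (@leq_trans (\sum_(p < t.+1) M)); first exact: leq_sum.
  by rewrite sum_nat_const card_ord.
apply: (sum_le (fun p => \sum_(q < t.+1) if p + q == j then b p * c q else 0)) => p.
rewrite -[X in _ <= X]muln1; apply: (sum_le (fun q => if p + q == j then b p * c q else 0)) => q.
by case: ifP => // _; case: (b p); case: (c q).
Qed.

(** The scaled coefficient does not wrap around, so the word computed is positive exactly if the
    coefficient is, and dividing by 2^gain would add nothing. *)
Lemma product_word (b c : nat -> bool) j : (forall i, t < i -> b i = false) ->
  (forall i, t < i -> c i = false) -> j <= t ->
  let x := 2 ^ gain e lev * product_count b c j in
  x < 2 ^ w /\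
  up e lev (base_mul (down e lev (fun i => Posz (b i))) (down e lev (fun i => Posz (c i)))) j = Posz x.
Proof.
move=> hb hc jt x.
have wl : width e lev = 1 by rewrite Elev (proj1 (depth_spec (ltnW e1))).
split.
  apply: leq_ltn_trans gw; apply: leq_mul; last exact: product_count_le.
  by rewrite /total -expnD leq_exp2l // -gain_width leq_addr.
have te : 2 * t < 2 ^ e by move: Nlo; alia.
rewrite (product_coef (t := t)) //.
- rewrite /x PoszM natz; congr (_ * _)%R.
  rewrite /product_count (big_morph Posz PoszD (erefl (Posz 0))); apply: eq_bigr => p _.
  rewrite (big_morph Posz PoszD (erefl (Posz 0))); apply: eq_bigr => q _.
  by case: ifP => // _; rewrite PoszM.
- by move=> i /andP[h _]; rewrite hb.
- by move=> i /andP[h _]; rewrite hc.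
- by move: jt te; alia.
Qed.

Lemma wp_round_prog k s F : main_env s -> coin_table s -> regs s rK = k.+1 -> k < R ->
  table_at s F -> bfs_table (usable V t) t inf k F ->
  wp w round_prog (work * 3000 + 300) (fun s' => [/\ main_env s', coin_table s', regs s' rK = k.+2 &
    exists F', table_at s' F' /\ bfs_table (usable V t) t inf k.+1 F']) s.
Proof.
move=> env hc hK kR hF bfs; have NS := NltS; have tS := tltS; have tw := tltw.
have [[hS hl hN hst] hT hL hR [hI hP]] := env.
have [b1 b2 b3 b4 b5] := work_bounds.
have totS : total e lev < S by [].
have infw : inf < 2 ^ w by move: t0 tRw; alia.
pose b i := (i <= t) && (ram s (2 * S + i) < inf).
pose aF i := Posz (b i).
pose X i := 0 < product_count b (usable V t) i.
pose F' i := if F i < inf then F i else if X i then k.+1 else inf.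
have b0 i : t < i -> b i = false by rewrite /b ltnNge => /negbTE ->.
have c0 i : t < i -> usable V t i = false by rewrite /usable ltnNge => /negbTE ->; rewrite andbF.
have keep rs s1 s2 : {subset rs <= conv_regs} -> changes S rs s1 s2 ->
    main_env s1 -> coin_table s1 -> regs s1 rK = k.+1 -> table_at s1 F ->
    [/\ main_env s2, coin_table s2, regs s2 rK = k.+1 & table_at s2 F].
  move=> sub [r m] h1 h2 h3 h4; split.
  - apply: (main_env_frame h1) => [y yr|a ha]; last by apply: m; move: ha; alia.
    apply: r; apply: contraL yr => /sub; rewrite !inE; do !case/orP; do ?move=> /eqP -> //.
  - by move=> j jt; rewrite m ?h2 //; move: jt totS; alia.
  - by rewrite r //; apply/negP => /sub.
  - by move=> j jt; rewrite m ?h4 //; move: jt tS; alia.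
have sI : {subset [:: rI] <= conv_regs} by move=> y; rewrite !inE => /eqP ->.
apply: wp_le.
  apply: wp_seq; apply: wp_assign.
  set s1 := State _ _.
  have hT1 : regs s1 rTot = 2 ^ e by [].
  have [env1 hc1 hK1 hF1] : [/\ main_env s1, coin_table s1, regs s1 rK = k.+1 & table_at s1 F].
    apply: (keep [:: rTot] s) => //; first by move=> y; rewrite !inE => /eqP ->.
    by split=> // y; rewrite inE /s1 /= /upd => /negbTE ->.
  apply: wp_seq; apply: (wp_weaken (leqnn _) _ (wp_overwrite (s := s1) (tot := 2 ^ e) (f := aF) w0 Sw w3 NS _ _ _)) => //.
  - move=> s2 [ch2 hf2].
    have [env2 hc2 hK2 hF2] := keep _ _ _ sI ch2 env1 hc1 hK1 hF1.
    have [lenv2 _ _ _ _] := env2.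
    apply: wp_seq; apply: (wp_weaken (leqnn _) _ (wp_down_prog w0 Sw w3 Nw levS lenv2 hf2)).
    move=> s3 [ch3 hq3 ht3 hf3].
    have [env3 hc3 hK3 hF3] := keep _ _ _ (fun y yr => yr) ch3 env2 hc2 hK2 hF2.
    have [[hS3 _ _ _] _ _ _ _] := env3.
    pose T := 2 ^ e.-1 * 2 ^ lev.
    have ET : total e lev = 2 * T by rewrite mulnA -expnS prednK // ltnW.
    apply: wp_seq; apply: (wp_weaken (leqnn _) _ (wp_overwrite (s := s3) (tot := total e lev)
      (f := base_mul (down e lev aF) (down e lev coin_fun)) w0 Sw w3 totS hS3 ht3 _)).
    + move=> s4 [ch4 hf4].
      have [env4 hc4 hK4 hF4] := keep _ _ _ sI ch4 env3 hc3 hK3 hF3.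
      have [lenv4 _ _ _ _] := env4.
      have hq4 : regs s4 rQ = lev by case: ch4 => -> //.
      have ht4 : regs s4 rTot = total e lev by case: ch4 => -> //.
      apply: wp_seq; apply: (wp_weaken (leqnn _) _ (wp_up_prog w0 Sw w3 Nw levS lenv4 hq4 ht4 hf4)).
      move=> s5 [ch5 hf5].
      have [env5 hc5 hK5 hF5] := keep _ _ _ (fun y yr => yr) ch5 env4 hc4 hK4 hF4.
      have [[hS5 _ _ _] hT5 _ _ [hI5 _]] := env5.
      apply: wp_seq; apply: (wp_weaken (leqnn _) _ (wp_overwrite_at (k := 2) (len := t.+1)
        (f := F') w0 Sw w3 _ _ hS5 _ _)) => //.
      * move=> s6 [r6 m6 f6]; apply: wp_assign; split.
        -- apply: (main_env_frame env5) => [y yr|a ha] /=; last by apply: m6; move: ha; alia.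
           rewrite /upd; case: eqP => [E|_]; first by move: yr; rewrite E.
           by apply: r6 => E; move: yr; rewrite E.
        -- by move=> j jt /=; rewrite m6 ?hc5 //; move: jt totS; alia.
        -- rewrite /= /upd eqxx -[RHS]addn1.
           have hK6 : regs s6 rK = k.+1 by rewrite r6.
           by ev; move: kR infw w3; alia.
        -- exists F'; split; first by move=> j jt; rewrite /= f6.
           apply: (bfs_tableS (k := k) (F := F) (X := X)) => //; first by move: kR; alia.
           move=> j jt; apply: (iffP (product_count_gt0 _ _ jt)).
             move=> [v [cv vj /andP[_]]]; rewrite hF ?(leq_trans (leq_subr _ _)) // => h.
             by exists v.
           move=> [v [cv vj h]]; exists v; split=> //.
           by rewrite /b hF ?h ?andbT ?(leq_trans (leq_subr _ _)).
      * move=> s' r'; rewrite -[RHS]addn1.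
        have hT' : regs s' rT = t by rewrite r'.
        by ev; move: w3 tw; alia.
      * move=> s' i it [r' m'] iI; rewrite ltnS in it.
        have [hS' hI' hK'] : [/\ regs s' rS = S, regs s' rInf = inf & regs s' rK = k.+1].
          by rewrite !r'.
        have Finf : F i <= inf.
          by case: bfs => h _ _; case: (h i it) => [h'|->//]; move: h' kR; alia.
        have EF : eval_expr w s' (Read (cell 2 (Reg rI))) = F i.
          apply: (@eval_read _ _ _ (2 * S + i)).
            by apply: (eval_cell w0 Sw w3) => //; move: it tS Sw; alia.
          by rewrite m' ?hF5 //; move: it tS; alia.
        have [xw xE] := product_word b0 c0 it.
        set x := _ * product_count _ _ _ in xw xE.
        have EX : eval_expr w s' (xcell (Reg rI)) = x.
          rewrite -[RHS](word_nat xw) -xE.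
          apply: (eval_xcell (tot := 2 ^ e) w0 Sw w3) => //; last by move: it b4; alia.
          by move=> j jt; rewrite m' ?hf5 //; move: jt NS; alia.
        have Elt : eval_expr w s' (Read (cell 2 (Reg rI)) [<] Reg rInf) = (F i < inf).
          by apply: eval_lt.
        have E0x : eval_expr w s' (Const 0 [<] xcell (Reg rI)) = (0 < x).
          by apply: eval_lt => //; apply: eval_const; move: w3; alia.
        have Xx : X i = (0 < x) by rewrite /x muln_gt0 expn_gt0.
        have -> : F' i = F i - (1 - (F i < inf)) * (0 < x) * (inf - k.+1).
          rewrite /F' Xx; case: ltnP => Fi; first by rewrite subnn !mul0n subn0.
          have -> : F i = inf by apply/eqP; rewrite eqn_leq Finf Fi.
          case: (0 < x); last by rewrite muln0 mul0n subn0.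
          by rewrite subn0 !mul1n subKn //; move: kR; alia.
        have le1 : (1 - (F i < inf)) * (0 < x) * (inf - k.+1) <= F i.
          case: ltnP => Fi; first by rewrite subnn !mul0n.
          by apply: leq_trans Fi; case: (0 < x); rewrite ?muln0 ?mul0n // subn0 !mul1n leq_subr.
        rewrite /update_expr; apply: eval_sub => //; last exact: leq_ltn_trans Finf _.
        apply: eval_mul; last by apply: leq_ltn_trans le1 (leq_ltn_trans Finf _).
          apply: eval_mul => //.
            apply: eval_sub => //; last by move: w3; alia.
              by apply: eval_const; move: w3; alia.
            exact: leq_b1.
          by apply: leq_ltn_trans (_ : 1 < _); [case: (_ < inf); case: (0 < x) | move: w3; alia].
        by ev; move: kR infw; alia.
    + move=> s' i it [r' m'] iI.
      apply: (eval_base w0 Sw w3 (T := T)); rewrite -?ET //.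
      * by rewrite r'.
      * by move=> j jt; rewrite m' ?hf3 //; move: jt totS; alia.
      * by move=> j jt; rewrite m' ?hc3 //; move: jt totS; alia.
  - move=> s' i it [r' m'] iI.
    have [hS' hT' hI'] : [/\ regs s' rS = S, regs s' rT = t & regs s' rInf = inf] by rewrite !r'.
    have E1 : eval_expr w s' (Reg rI [<] Reg rT [+] Const 1) = (i < t + 1).
      by apply: eval_lt => //; ev; move: w3 tw; alia.
    have E2 : eval_expr w s' (Read (cell 2 (Reg rI)) [<] Reg rInf) = (ram s (2 * S + i) < inf).
      apply: eval_lt => //; apply: (@eval_read _ _ _ (2 * S + i)).
        by apply: (eval_cell w0 Sw w3) => //; move: it NS Sw; alia.
      by rewrite m' //; move: it NS; alia.
    rewrite /aF word_nat; last by apply: leq_ltn_trans (leq_b1 _) _; move: w3; alia.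
    rewrite /b -mulnb /source_expr; apply: eval_mul => //.
      by rewrite E1 addn1 ltnS.
    by rewrite mulnb; apply: leq_ltn_trans (leq_b1 _) _; move: w3; alia.
have -> : cost update_expr = 30 by [].
move: b1 b2 b3 b4 b5; move: (lev * _) => d; move: (2 ^ e) (total e lev) work => x y z.
by rewrite /=; clear; lia.
Qed.

Definition rounds_prog : prog :=
  rK ::= Const 1 ;; While (Reg rK [<] Reg rRounds [+] Const 1) round_prog.

Lemma wp_rounds_prog s : main_env s -> coin_table s -> 0 < R ->
  table_at s (fun j => if j == 0 then 0 else inf) ->
  wp w rounds_prog (R * (work * 3000 + 310) + 10) (fun s' => main_env s' /\
    exists F, table_at s' F /\ bfs_table (usable V t) t inf R F) s.
Proof.
move=> env hc R0 hF; have tw := tltw.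
have infw : 8 * R < 2 ^ w by move: tRw; alia.
pose I k s' := [/\ main_env s', coin_table s', regs s' rK = k.+1 &
  exists F, table_at s' F /\ bfs_table (usable V t) t inf k F].
apply: wp_le.
  apply: wp_seq; apply: wp_assign.
  apply: (wp_weaken (leqnn _) _ (wp_while (c := work * 3000 + 300) (k := R) (I := I) _ _ _)).
  - by move=> s' [].
  - move=> k s1 kR [env1 hc1 hK1 [F [hF1 bF]]]; split.
      have [_ _ _ hR1 _] := env1.
      rewrite (eval_lt (x := k.+1) (y := R + 1)) //; first by rewrite addn1 ltnS kR.
      by ev; move: w3 infw R0; alia.
    by apply: wp_weaken (wp_round_prog env1 hc1 hK1 kR hF1 bF).
  - move=> s1 [env1 hc1 hK1 _]; have [_ _ _ hR1 _] := env1.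
    rewrite (eval_lt (x := R.+1) (y := R + 1)) //; first by rewrite addn1 ltnn.
    by ev; move: w3 infw R0; alia.
  - split.
    + apply: (main_env_frame env) => // y yr; rewrite /= /upd; case: eqP => // E.
      by move: yr; rewrite E.
    + exact: hc.
    + by rewrite /= /upd /= /eval_expr modn_small //; move: w3; alia.
    + exists (fun j => if j == 0 then 0 else inf); split=> //.
      by apply: bfs_table0 => // [|[|j]] //; rewrite addn1.
rewrite /=; have -> : R * (5 + (work * 3000 + 300)).+1 = R * (work * 3000 + 306) by congr (_ * _); alia.
have : R * (work * 3000 + 306) <= R * (work * 3000 + 310) by rewrite leq_mul2l leq_add2l orbT.
by alia.
Qed.

(** A zero register means that the bucket has no coin. The table is updated in place with j
    ascending, so the entry at j - x is already the new one. *)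
Definition relax_prog (x : nat) : prog :=
  If (Reg x)
    (rJ ::= Reg x ;;
     While (Reg rJ [<] Reg rT [+] Const 1)
       (rV ::= Read (cell 2 (Reg rJ [-] Reg x)) [+] Const 1 ;;
        If (Reg rV [<] Read (cell 2 (Reg rJ))) (Store (cell 2 (Reg rJ)) (Reg rV)) Skip ;;
        rJ ::= Reg rJ [+] Const 1))
    Skip.

Hypothesis V0 : all (fun v => 0 < v) V.

Lemma wp_relax_prog x v P F s : x \in [:: rLo; rHi] -> main_env s -> regs s x = v ->
  (0 < v -> usable V t v) -> table_at s F -> dp_table (usable V t) t inf P R F ->
  wp w (relax_prog x) (t.+1 * 60 + 20) (fun s' => [/\ main_env s',
    forall y, y \notin [:: rJ; rV] -> regs s' y = regs s y &
    exists F', table_at s' F' /\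
      dp_table (usable V t) t inf (fun y => P y || ((0 < v) && (y == v))) R F']) s.
Proof.
move=> xr env hx hv hF dp; have tS := tltS; have tw := tltw.
have infw : inf.+1 < 2 ^ w by move: t0 tRw; alia.
have [xI xJ xV] : [/\ x <> rI, x <> rJ & x <> rV].
  by move: xr; rewrite !inE => /orP[] /eqP ->.
apply: wp_le; last by exact: leqnn.
apply: (@wp_weaken _ _ (1 + (t.+1 * 50 + 10)).+1); [by lia | by move=> s'; exact |].
have Ev : eval_expr w s (Reg x) = v by [].
apply: wp_if; rewrite Ev => v0; last first.
  apply: wp_le; first apply: wp_skip; last by lia.
  split=> //; exists F; split=> //; apply: dp_table_sub dp => y /=.
  by rewrite v0 orbF.
have {}v0 : 0 < v by rewrite lt0n.
have uv := hv v0.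
have vt : v <= t by case/andP: uv.
pose G s' j := ram s' (2 * S + j).
pose I k s' := [/\ main_env s', regs s' rJ = v + k,
  forall y, y \notin [:: rJ; rV] -> regs s' y = regs s y,
  forall i, i <= t -> i < v + k -> G s' i = if v <= i then minn (F i) (G s' (i - v)).+1 else F i &
  forall i, i <= t -> v + k <= i -> G s' i = F i].
have Finf i : i <= t -> F i <= inf by case: dp => h _ _; exact: h.
have GF k s' i : I k s' -> i <= t -> G s' i <= F i.
  move=> [_ _ _ h1 h2] it; case: (ltnP i (v + k)) => ik; last by rewrite h2.
  by rewrite h1 //; case: ifP => // _; exact: geq_minl.
apply: wp_le.
  apply: wp_seq; apply: wp_assign.
  apply: (wp_weaken (leqnn _) _ (wp_while (c := 40) (k := t.+1 - v) (I := I) _ _ _)).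
  - move=> s' [h1 h2 h3 h4 h5]; split=> //.
    exists (G s'); split=> //.
    have dp' : dp_table (usable V t) t inf (predU P (pred1 v)) R (G s').
      apply: dp_tableU dp _ => //; first exact: usable_gt0 V0.
      by move=> j jt; apply: h4 => //; rewrite subnKC ?ltnS // ltnW.
    by apply: dp_table_sub dp' => y /=; rewrite v0.
  - move=> k s1 kt Ik; have [h1 h2 h3 h4 h5] := Ik.
    have [[hS1 _ _ _] hT1 _ _ _] := h1.
    have hx1 : regs s1 x = v by rewrite h3 // !inE; apply/norP; split; apply/eqP.
    have vkt : v + k <= t by move: kt vt; alia.
    have Ek : v + k - v = k by rewrite addKn.
    have kt' : k <= t by move: vkt; alia.
    split.
      rewrite (eval_lt (x := v + k) (y := t + 1)) //; first by rewrite addn1 ltnS vkt.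
      by ev; move: w3 tw; alia.
    have Ga j e' : j <= t -> eval_expr w s1 e' = j -> eval_expr w s1 (Read (cell 2 e')) = G s1 j.
      move=> jt he; apply: (@eval_read _ _ _ (2 * S + j)) => //.
      by apply: (eval_cell w0 Sw w3) => //; move: jt tS Sw; alia.
    have Gw j : j <= t -> (G s1 j).+1 < 2 ^ w.
      by move=> jt; have := GF k s1 j Ik jt; have := Finf j jt; move: infw; alia.
    have E1 : eval_expr w s1 (Read (cell 2 (Reg rJ [-] Reg x)) [+] Const 1) = (G s1 k).+1.
      rewrite -[RHS]addn1; apply: eval_add; last by rewrite addn1; apply: Gw.
        apply: Ga => //; rewrite -[RHS]Ek; apply: eval_sub => //; first exact: leq_addr.
        by move: vkt tw; alia.
      by apply: eval_const; move: w3; alia.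
    apply: wp_le.
      apply: wp_seq; apply: wp_assign; rewrite E1.
      set s2 := State _ _.
      have hV2 : regs s2 rV = (G s1 k).+1 by [].
      have hJ2 : regs s2 rJ = v + k by [].
      have hS2 : regs s2 rS = S by [].
      have E2 : eval_expr w s2 (Read (cell 2 (Reg rJ))) = G s1 (v + k).
        apply: (@eval_read _ _ _ (2 * S + (v + k))) => //.
        by apply: (eval_cell w0 Sw w3) => //; move: vkt tS Sw; alia.
      have E3 : eval_expr w s2 (Reg rV [<] Read (cell 2 (Reg rJ))) = ((G s1 k).+1 < G s1 (v + k)).
        exact: eval_lt.
      have E4 m : eval_expr w (State (regs s2) m) (Reg rJ [+] Const 1) = v + k.+1.
        rewrite addnS -[RHS]addn1; apply: eval_add => //; first by apply: eval_const; move: w3; alia.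
        by move: vkt tw; alia.
      have regs3 y : y \notin [:: rJ; rV] -> upd (upd (regs s1) rV (G s1 k).+1) rJ (v + k.+1) y = regs s y.
        move=> yn; rewrite /upd; case: eqP => [E|_]; first by move: yn; rewrite E.
        by case: eqP => [E|_]; [move: yn; rewrite E | exact: h3].
      have fin m : (forall a, a <> 2 * S + (v + k) -> m a = ram s1 a) ->
          m (2 * S + (v + k)) = minn (F (v + k)) (G s1 k).+1 ->
          I k.+1 (State (upd (regs s2) rJ (v + k.+1)) m).
        move=> hm hm2; split.
        + apply: (main_env_frame h1) => [y yr|a ha] /=.
            rewrite /upd; case: eqP => [E|_]; first by move: yr; rewrite E.
            by case: eqP => [E|_] //; move: yr; rewrite E.
          by apply: hm => E; move: ha; rewrite E; move: vkt tS; alia.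
        + by rewrite /= /upd eqxx.
        + exact: regs3.
        + move=> i it; rewrite /G /= addnS ltnS leq_eqVlt => /orP[/eqP ->|lt].
            rewrite hm2 leq_addr Ek hm //.
            by move=> /addnI E; move: v0 E; alia.
          rewrite !hm; [exact: h4 | |].
            by move=> /addnI E; move: lt E; alia.
          by move=> /addnI E; move: lt E; alia.
        + move=> i it ik; rewrite /G /= hm; first by apply: h5 => //; move: ik; alia.
          by move=> /addnI E; move: ik E; alia.
      have F5 : G s1 (v + k) = F (v + k) by apply: h5.
      apply: wp_seq; apply: wp_if; rewrite E3 F5 => lt.
      + apply: wp_le.
          apply: wp_store; apply: wp_assign.
          have -> : eval_expr w s2 (cell 2 (Reg rJ)) = 2 * S + (v + k).
            by apply: (eval_cell w0 Sw w3) => //; move: vkt tS Sw; alia.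
          rewrite E4; apply: fin => [a na|]; rewrite /upd /=; first by case: eqP.
          rewrite eqxx /minn [F _ < _]ltnNge.
          by case: (ltnP _ (F (v + k))) lt => // lt _; rewrite ltnW.
        by [].
      + apply: wp_le; first apply: wp_skip.
          apply: wp_assign; rewrite (E4 (ram s2)); apply: fin => //.
          rewrite -/(G s1 (v + k)) F5; apply/esym/minn_idPl.
          by case: (ltnP (G s1 k).+1 (F (v + k))) lt.
        by [].
    by [].
  - move=> s1 [h1 h2 h3 _ _]; have [_ hT1 _ _ _] := h1.
    rewrite (eval_lt (x := v + (t.+1 - v)) (y := t + 1)) //.
      by rewrite subnKC ?addn1 ?ltnn // ltnW.
    by ev; move: w3 tw; alia.
  - rewrite Ev; split.
    + apply: (main_env_frame env) => // y yr; rewrite /= /upd; case: eqP => // E.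
      by move: yr; rewrite E.
    + by rewrite /= /upd eqxx addn0.
    + by move=> y yn; rewrite /= /upd; case: eqP => [E|//]; move: yn; rewrite E.
    + move=> i it; rewrite addn0 => iv; rewrite leqNgt iv /=; exact: hF.
    + by move=> i it _; apply: hF.
have : (t.+1 - v) * 46 <= t.+1 * 46 by rewrite leq_mul2r leq_subr orbT.
by rewrite /=; move: (t.+1 - v) => d; clear; lia.
Qed.

(** The bucket is scanned upwards: the first coin met is its least and is recorded once, the last
    one met is its greatest. *)
Definition scan_prog : prog :=
  rLo ::= Const 0 ;; rHi ::= Const 0 ;; rJ ::= Const 0 ;;
  While (Reg rJ [<] Reg rL)
    (rV ::= Reg rB [*] Reg rL [+] Reg rJ ;;
     If (Read (cell 1 (Reg rV))) (rHi ::= Reg rV ;; If (Reg rLo) Skip (rLo ::= Reg rV)) Skip ;;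
     rJ ::= Reg rJ [+] Const 1).

Definition special_prog : prog :=
  rB ::= Const 0 ;;
  While (Reg rB [<] Reg rL)
    (scan_prog ;; relax_prog rLo ;; relax_prog rHi ;; rB ::= Reg rB [+] Const 1).

Definition output_prog : prog :=
  tabulate rI (Reg rT [+] Const 1) (Const 0)
    ((Read (cell 2 (Reg rI)) [<] Reg rInf) [*] (Read (cell 2 (Reg rI)) [+] Const 1)).

Hypothesis LLS : L * L <= S.
Hypothesis L0 : 0 < L.

(* Zero is no coin, so it marks an empty scan. *)
Definition scanned b J lo hi := forall v, b * L <= v < b * L + J -> usable V t v ->
  [/\ 0 < lo, 0 < hi & lo <= v <= hi].

Definition from_bucket b J v := 0 < v -> usable V t v /\ b * L <= v < b * L + J.

(** The scan gives lo <= y <= hi; that y is extreme in its bucket gives y <= lo or hi <= y. *)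
Lemma special_scanned b lo hi y : b < L -> scanned b L lo hi -> from_bucket b L lo ->
  from_bucket b L hi -> special (usable V t) L y -> y %/ L = b ->
  ((0 < lo) && (y == lo)) || ((0 < hi) && (y == hi)).
Proof.
move=> bL sc flo fhi /and3P[Cy yL sp] yb.
have bucket v : b * L <= v < b * L + L -> v %/ L = b /\ v < L * L.
  move=> /andP[h1 h2]; have E : v %/ L = b.
    apply/eqP; rewrite eqn_leq leq_divRL // h1 andbT -ltnS ltn_divLR // mulSn.
    by move: h2; rewrite addnC.
  by split=> //; rewrite -ltn_divLR // E.
have yr : b * L <= y < b * L + L.
  rewrite -yb leq_trunc_div /= [X in X < _](divn_eq y L) ltn_add2l; exact: ltn_pmod.
have [lo0 hi0 /andP[ly yh]] := sc y yr Cy.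
have [[Clo /bucket[blo lL]] [Chi /bucket[bhi hL]]] := (flo lo0, fhi hi0).
rewrite lo0 hi0 /=.
case/orP: sp => /allP sp.
- have := sp lo; rewrite mem_iota add0n lL => /(_ isT) /implyP.
  rewrite /in_bucket Clo blo yb eqxx => /(_ isT) h.
  by rewrite eqn_leq h ly.
- have := sp hi; rewrite mem_iota add0n hL => /(_ isT) /implyP.
  rewrite /in_bucket Chi bhi yb eqxx => /(_ isT) h.
  by rewrite [y == hi]eqn_leq h yh orbT.
Qed.

Lemma wp_scan_prog b s : main_env s -> regs s rB = b -> b < L ->
  wp w scan_prog (L * 40 + 20) (fun s' => [/\ main_env s', ram s' = ram s, regs s' rB = b &
    exists lo hi, [/\ regs s' rLo = lo, regs s' rHi = hi, scanned b L lo hi,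
      from_bucket b L lo & from_bucket b L hi]]) s.
Proof.
move=> env hB bL; have tS := tltS.
have [[hS _ _ _] hT hL hR [hI hP]] := env.
have bLL : b * L + L <= L * L by rewrite -mulSnr leq_mul2r bL orbT.
have Lw : 8 * (L * L) <= 2 ^ w by move: LLS Sw; alia.
have LL : L <= L * L by rewrite leq_pmulr.
pose I J s' := [/\ ram s' = ram s, regs s' rJ = J,
  forall y, y \notin [:: rLo; rHi; rJ; rV] -> regs s' y = regs s y &
  [/\ scanned b J (regs s' rLo) (regs s' rHi), from_bucket b J (regs s' rLo) &
      from_bucket b J (regs s' rHi)]].
apply: wp_le.
  apply: wp_seq; apply: wp_assign.
  apply: wp_seq; apply: wp_assign.
  apply: wp_seq; apply: wp_assign.
  apply: (wp_weaken (leqnn _) _ (wp_while (c := 30) (k := L) (I := I) _ _ _)).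
  - move=> s' [h1 h2 h3 [h4 h5 h6]]; split=> //.
    + apply: (main_env_frame env) => [y yr|a _]; last by rewrite h1.
      by apply: h3; move: yr; rewrite !inE; do !case/orP; do ?move=> /eqP -> //.
    + by rewrite h3.
    + by exists (regs s' rLo), (regs s' rHi).
  - move=> J s1 JL [h1 h2 h3 [h4 h5 h6]].
    have [hL1 hB1 hS1] : [/\ regs s1 rL = L, regs s1 rB = b & regs s1 rS = S] by rewrite !h3.
    split.
      by rewrite (eval_lt (x := J) (y := L)) // JL.
    set v := b * L + J.
    have vL : v < L * L by rewrite /v; move: JL bLL; alia.
    have v0 : usable V t v -> 0 < v by apply: usable_gt0 V0 _.
    have vr : b * L <= v < b * L + L by rewrite leq_addr ltn_add2l JL.
    have stepJ u : b * L <= u < b * L + J.+1 -> u = v \/ b * L <= u < b * L + J.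
      move=> /andP[hu]; rewrite addnS ltnS leq_eqVlt => /orP[/eqP|] h; [by left | right].
      by rewrite hu.
    apply: wp_le.
      apply: wp_seq; apply: wp_assign.
      have -> : eval_expr w s1 (Reg rB [*] Reg rL [+] Reg rJ) = v.
        by rewrite /v; ev; move: vL Lw; rewrite /v; alia.
      set s2 := State _ _.
      have [hV2 hS2] : regs s2 rV = v /\ regs s2 rS = S by [].
      have EP : eval_expr w s2 (Read (cell 1 (Reg rV))) = usable V t v.
        apply: (@eval_read _ _ _ (1 * S + v)).
          by apply: (eval_cell w0 Sw w3) => //; move: vL LLS Sw; alia.
        by rewrite /= h1 mul1n hP // (leq_trans vL).
      have fin f m : ram s2 = m -> f rJ = J -> f rB = b ->
          (forall y, y \notin [:: rLo; rHi; rJ; rV] -> f y = regs s y) ->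
          scanned b J.+1 (f rLo) (f rHi) -> from_bucket b J.+1 (f rLo) -> from_bucket b J.+1 (f rHi) ->
          wp w (rJ ::= Reg rJ [+] Const 1) 4 (I J.+1) (State f m).
        move=> <- fJ fB fr k1 k2 k3; apply: wp_assign.
        have -> : eval_expr w (State f (ram s2)) (Reg rJ [+] Const 1) = J.+1.
          rewrite -[RHS]addn1; apply: eval_add => //; first by apply: eval_const; move: w3; alia.
          by move: JL LL Lw w3; alia.
        split=> // y yn; rewrite /= /upd; case: eqP => [E|_]; last exact: fr.
        by move: yn; rewrite E.
      have fr2 y : y \notin [:: rLo; rHi; rJ; rV] -> regs s2 y = regs s y.
        move=> yn; rewrite /= /upd; case: eqP => [E|_]; last exact: h3.
        by move: yn; rewrite E.
      apply: wp_seq; apply: wp_if; rewrite EP => uv.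
      + have {}uv : usable V t v by case: (usable V t v) uv.
        apply: (@wp_le _ _ (2 + (2 + 3).+1)); last exact: leqnn.
        apply: wp_seq; apply: wp_assign.
        have -> : eval_expr w s2 (Reg rV) = v by [].
        set s3 := State _ _.
        have fr3 y : y \notin [:: rLo; rHi; rJ; rV] -> regs s3 y = regs s y.
          move=> yn; rewrite /= /upd; case: eqP => [E|_]; last exact: fr2.
          by move: yn; rewrite E.
        have lo3 : regs s3 rLo = regs s1 rLo by [].
        have hi3 : regs s3 rHi = v by [].
        have up x : from_bucket b J x -> from_bucket b J.+1 x.
          move=> h /h [Cx /andP[x1 x2]]; split=> //; rewrite x1 /=.
          by rewrite addnS ltnS ltnW.
        have hv : from_bucket b J.+1 v.
          by move=> _; split=> //; rewrite leq_addr addnS ltnSn.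
        apply: wp_if => lo0.
        * apply: wp_le; first apply: wp_skip; last by [].
          apply: (fin (regs s3)) => //; rewrite ?lo3 ?hi3 //; last exact: up.
          move=> u ur Cu.
          have {}lo0 : 0 < regs s1 rLo by rewrite lt0n.
          have [Clo /andP[lo1 lo2]] := h5 lo0.
          split=> //; first exact: v0.
          case: (stepJ u ur) => [->|ur'].
            by rewrite leqnn andbT ltnW.
          have [_ _ /andP[g1 g2]] := h4 u ur' Cu.
          by rewrite g1 /=; case/andP: ur' => _; rewrite -/v => /ltnW.
        * apply: wp_le; first apply: wp_assign; last by [].
          have -> : eval_expr w s3 (Reg rV) = v by [].
          apply: (fin (upd (regs s3) rLo v)) => //.
            move=> y yn; rewrite /upd; case: eqP => [E|_]; last exact: fr3.
            by move: yn; rewrite E.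
          rewrite /upd /= => u ur Cu; have vv := v0 uv; split=> //.
          case: (stepJ u ur) => [->|ur']; first by rewrite leqnn.
          have [g0 _ _] := h4 u ur' Cu.
          by move: g0; rewrite -lo3; move: lo0; rewrite /eval_expr => ->.
      + apply: wp_le; first apply: wp_skip; last by [].
        have {}uv : usable V t v = false by case: (usable V t v) uv.
        have up x : from_bucket b J x -> from_bucket b J.+1 x.
          move=> h /h [Cx /andP[x1 x2]]; split=> //; rewrite x1 /=.
          by rewrite addnS ltnS ltnW.
        apply: (fin (regs s2)) => //; last 2 first.
        * exact: up h5.
        * exact: up h6.
        move=> u ur Cu; case: (stepJ u ur) => [E|ur']; first by move: Cu; rewrite E uv.
        exact: h4.
    by [].
  - move=> s1 [_ hJ h3 _]; have hL1 : regs s1 rL = L by rewrite h3.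
    by rewrite (eval_lt (x := L) (y := L)) // ltnn.
  - split=> //.
    + by rewrite /= /upd /= /eval_expr mod0n.
    + move=> y; rewrite !inE !negb_or => /and4P[/negbTE h1 /negbTE h2 /negbTE h3 _].
      by rewrite /= /upd h1 h2 h3.
    + split.
      * by move=> v; rewrite addn0 => /andP[h1]; rewrite ltnNge h1.
      * by rewrite /= /upd /= /eval_expr mod0n.
      * by rewrite /= /upd /= /eval_expr mod0n.
by rewrite /=; clear; lia.
Qed.

Lemma wp_special_prog s F : main_env s -> table_at s F -> dp_table (usable V t) t inf pred0 R F ->
  wp w special_prog (L * (L * 40 + t.+1 * 120 + 100) + 20) (fun s' => main_env s' /\
    exists F', table_at s' F' /\ dp_table (usable V t) t inf (special (usable V t) L) R F') s.
Proof.
move=> env hF dp; have tS := tltS.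
have Lw : 8 * (L * L) <= 2 ^ w by move: LLS Sw; alia.
have LL : L <= L * L by rewrite leq_pmulr.
pose P b y := special (usable V t) L y && (y %/ L < b).
pose I b s' := [/\ main_env s', regs s' rB = b &
  exists F', table_at s' F' /\ dp_table (usable V t) t inf (P b) R F'].
apply: wp_le.
  apply: wp_seq; apply: wp_assign.
  apply: (wp_weaken (leqnn _) _ (wp_while (c := L * 40 + t.+1 * 120 + 90) (k := L) (I := I) _ _ _)).
  - move=> s' [h1 _ [F' [h2 h3]]]; split=> //; exists F'; split=> //.
    apply: dp_table_sub h3 => y sy; rewrite /P sy ltn_divLR //.
    by case/and3P: sy.
  - move=> b s1 bL [env1 hB1 [F1 [hF1 dp1]]].
    have [_ _ hL1 _ _] := env1.
    split.
      by rewrite (eval_lt (x := b) (y := L)) // bL.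
    apply: wp_le.
      apply: wp_seq; apply: wp_weaken (leqnn _) _ (wp_scan_prog env1 hB1 bL).
      move=> s2 [env2 m2 hB2 [lo [hi [hlo hhi sc flo fhi]]]].
      have hF2 : table_at s2 F1 by move=> j jt; rewrite m2 hF1.
      apply: wp_seq; apply: (wp_weaken (leqnn _) _ (wp_relax_prog (x := rLo) (v := lo) _ env2 hlo _ hF2 dp1)) => //.
        move=> s3 [env3 r3 [F3 [hF3 dp3]]].
        have hhi3 : regs s3 rHi = hi by rewrite r3.
        apply: wp_seq; apply: (wp_weaken (leqnn _) _ (wp_relax_prog (x := rHi) (v := hi) _ env3 hhi3 _ hF3 dp3)) => //.
          move=> s4 [env4 r4 [F4 [hF4 dp4]]].
          have hB4 : regs s4 rB = b by rewrite r4 // r3.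
          apply: wp_assign.
          have -> : eval_expr w s4 (Reg rB [+] Const 1) = b.+1.
            by rewrite -[RHS]addn1; ev; move: bL LL Lw w3; alia.
          split.
          + apply: (main_env_frame env4) => // y yr; rewrite /= /upd; case: eqP => // E.
            by move: yr; rewrite E.
          + by rewrite /= /upd eqxx.
          + exists F4; split=> //; apply: dp_table_sub dp4 => y /andP[sy].
            rewrite ltnS leq_eqVlt => /orP[/eqP yb|yb]; last by rewrite /P sy yb.
            by rewrite -orbA (special_scanned bL sc flo fhi sy yb) orbT.
        by case/fhi.
      by case/flo.
    by rewrite /=; lia.
  - move=> s1 [[_ _ hL1 _ _] hB1 _].
    by rewrite (eval_lt (x := L) (y := L)) // ltnn.
  - split.
    + apply: (main_env_frame env) => // y yr; rewrite /= /upd; case: eqP => // E.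
      by move: yr; rewrite E.
    + by rewrite /= /upd /= /eval_expr mod0n.
    + exists F; split=> //; apply: dp_table_sub dp => y; by rewrite /P ltn0 andbF.
rewrite /=; have -> : L * (3 + (L * 40 + t.+1 * 120 + 90)).+1 = L * (L * 40 + t.+1 * 120 + 94).
  by congr (_ * _); alia.
have : L * (L * 40 + t.+1 * 120 + 94) <= L * (L * 40 + t.+1 * 120 + 100).
  by rewrite leq_mul2l leq_add2l orbT.
by alia.
Qed.

Lemma wp_output_prog s F : main_env s -> table_at s F -> (forall j, j <= t -> F j <= inf) ->
  wp w output_prog (t.+1 * 50 + 20)
    (fun s' => forall j, j <= t -> ram s' j = (F j < inf) * (F j + 1)) s.
Proof.
move=> env hF Finf; have tS := tltS; have tw := tltw.
have infw : inf.+1 < 2 ^ w by move: t0 tRw; alia.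
have [[hS _ _ _] hT _ _ [hI _]] := env.
apply: wp_weaken (wp_tabulate (len := t.+1) (base := 0)
  (f := fun j => (F j < inf) * (F j + 1)) w0 _ _ _ _).
- by rewrite /=; clear; lia.
- by move=> s' [_ h] j jt; apply: h.
- by rewrite add0n; move: tw; alia.
- move=> s' [r' _]; rewrite -[RHS]addn1; have hT' : regs s' rT = t by rewrite r'.
  by ev; move: w3 tw; alia.
- by move=> s' _; apply: eval_const; move: w3; alia.
- move=> s' i it [r' m'] iI; rewrite ltnS in it.
  have [hS' hI'] : regs s' rS = S /\ regs s' rInf = inf by rewrite !r'.
  have EF : eval_expr w s' (Read (cell 2 (Reg rI))) = F i.
    apply: (@eval_read _ _ _ (2 * S + i)).
      by apply: (eval_cell w0 Sw w3) => //; move: it tS Sw; alia.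
    by rewrite m' ?hF //; move: it tS; alia.
  have Fw : F i + 1 < 2 ^ w by move: (Finf i it) infw; alia.
  apply: eval_mul.
  + exact: eval_lt.
  + by ev; move: w3 Fw; alia.
  + by apply: leq_ltn_trans Fw; case: (F i < inf); rewrite ?mul1n ?mul0n.
Qed.
End Rounds.

(** * Assembly and total running time *)

Definition main_prog : prog :=
  size_prog ;; level_prog ;; mark_prog ;; coin_prog ;; init_prog ;; rounds_prog ;;
  special_prog ;; output_prog.

(** Marking takes 40 steps per coin of the input. At most t coins are usable, which gives [t * 40];
    the others are charged to the separate term for coins exceeding t. *)
Definition run_time (t : nat) : nat :=
  let e := exponent t in let L := cube_root t in let lev := depth e in
  let W := work e lev in let R := (6 * e + 1) * L in
  (e * 20 + L * 20 + 100) + ((lev * (e * 20 + 50) + 30) + ((t * 40 + 10) +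
  ((W * 1200 + 100) + ((W * 100 + 100) + ((R * (W * 3000 + 310) + 10) +
  ((L * (L * 40 + t.+1 * 120 + 100) + 20) + (t.+1 * 50 + 20))))))).

Lemma count_usable (V : seq nat) t : coin_set V -> count (fun v => v <= t) V <= t.
Proof.
move=> [uV V0]; rewrite -size_filter -[X in _ <= X](size_iota 1 t).
apply: uniq_leq_size; first exact: filter_uniq.
move=> v; rewrite mem_filter mem_iota add1n ltnS => /andP[-> /(allP V0) ->]; by [].
Qed.

(** The reason for Q = 6 e: with N = 2^e >= 4 the two factors are at most 4 N and N^3, while the
    right side is N^6. *)
Lemma exchange_bound e L : 1 < e -> 2 * L <= 2 ^ e ->
  (6 * e).+1 * (6 * e * (L * L)).+1 < 2 ^ (6 * e).
Proof.
move=> e1 LN; rewrite mulnC (mulnC 6) expnM.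
have N4 : 4 <= 2 ^ e by rewrite -[4]/(2 ^ 2) leq_exp2l.
have eN : 2 * e <= 2 ^ e.
  rewrite -[in X in _ <= X](prednK (ltnW e1)) expnS leq_mul2l /=.
  by apply: leq_trans (ltn_expl e.-1 (isT : 1 < 2)); rewrite prednK // ltnW.
move: (2 ^ e) N4 eN LN => N N4 eN LN.
have h1 : (e * 6).+1 <= 4 * N by move: N4 eN; clear; lia.
have h2 : (e * 6 * (L * L)).+1 <= N * (N * N).
  have h : 4 * (e * 6 * (L * L)) <= 3 * (N * (N * N)).
    have -> : 4 * (e * 6 * (L * L)) = (2 * e * 3) * ((2 * L) * (2 * L)) by ring.
    have -> : 3 * (N * (N * N)) = N * 3 * (N * N) by ring.
    by apply: leq_mul; [rewrite leq_mul2r eN orbT | apply: leq_mul].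
  have h' : 4 <= N * (N * N).
    have N0 : 0 < N by apply: leq_trans N4.
    by apply: leq_trans N4 _; rewrite leq_pmulr // muln_gt0 N0.
  by move: h h'; move: (N * _) (e * 6 * _) => x y; clear; lia.
apply: leq_ltn_trans (leq_mul h2 h1) _.
have -> : N * (N * N) * (4 * N) = 4 * N ^ 4 by rewrite !expnS expn0; ring.
have N0 : 0 < N by apply: leq_trans N4.
rewrite (expnD N 2 4) ltn_pmul2r ?expn_gt0 ?N0 //.
by apply: (@leq_trans (4 ^ 2)) => //; rewrite leq_exp2r.
Qed.

Lemma main_prog_solves : solves_all_targets main_prog 16 40 run_time.
Proof.
move=> w t V t0 cV [ww Vw].
have [uV V0] := cV.
have big : (t + size V + 1) ^ 16 <= 2 ^ w.
  apply: (@leq_trans (2 ^ (16 * up_log 2 (t + size V).+1))); last by rewrite leq_exp2l.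
  rewrite (mulnC 16) expnM addn1 leq_exp2r //; exact: up_logP.
have w0 : 0 < w.
  have h : 1 < (t + size V).+1 by rewrite ltnS addn_gt0 t0.
  by apply: leq_trans ww; rewrite muln_gt0 /= up_log_gt0 h.
set e := exponent t; set L := cube_root t; set lev := depth e; set R := (6 * e + 1) * L.
set S := 2 ^ e * 2 ^ e + size V + 2.
have [Nlo Nhi e1 Nmin] := exponent_spec t0; rewrite -/e in Nlo Nhi e1 Nmin.
have [Sw w3 Nw levS [tRw gw]] :=
  word_bounds (S := S) t0 Nhi e1 (erefl L) (erefl R) (erefl S) (erefl lev) big.
have [Lcube Lt] := cube_root_spec t; rewrite -/L in Lcube Lt.
have L0 := L_gt0 t0 (erefl L).
have LN : L <= 2 ^ e by apply: leq_trans Lt _; move: Nlo; alia.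
have LLS : L * L <= S by rewrite /S -addnA; apply: leq_trans (leq_addr _ _); exact: leq_mul.
have R0 : 0 < R by rewrite /R muln_gt0 addn1.
have tltN : t < 2 ^ e by move: Nlo; alia.
have NS : 2 ^ e < S by apply: leq_ltn_trans levS; rewrite leq_pmulr // expn_gt0.
have nS : size V + 2 <= S by rewrite /S -addnA leq_addl.
have beyond a : size V + 2 <= a -> ram (input t V) a = 0.
  by move=> h; rewrite /= nth_default //= -addn2.
have lS := lev_lt_S levS.
have inflt : t < t + R + 1 by move: R0; alia.
suff [n0 [s [ex le out]]] : wp w main_prog (run_time t + 40 * count (fun v => t < v) V)
    (output t V) (input t V) by exists n0, s.
have cnt : size V <= t + count (fun v => t < v) V.
  rewrite -(count_predC (fun v => v <= t) V); apply: leq_add; first exact: count_usable.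
  by apply: sub_count => v /=; rewrite ltnNge.
apply: wp_le.
  apply: wp_seq; apply: (wp_weaken (leqnn _) _ (wp_size_prog (S := S) (lev := lev) t0 w0 Sw w3 Nw levS tRw Nlo Nmin e1
    (erefl L) (erefl R) (erefl S) (erefl lev))).
  move=> s1 [hT1 hn1 hN1 hL1 [hR1 hI1 hS1 m1]].
  apply: wp_seq; apply: (wp_weaken (leqnn _) _ (wp_level_prog (lev := lev) w0 Sw w3 Nw levS e1 (erefl S) (erefl lev) hN1 hS1)).
  move=> s2 [hl2 r2 m2 st2].
  apply: wp_seq; apply: (wp_weaken (leqnn _) _ (wp_mark_prog (s := s2) t0 w0 Sw w3 Nw levS tRw Nlo e1
    (erefl L) (erefl R) (erefl S) (erefl lev) _ _ _ _ _ _)).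
  - move=> s3 [r3 m3 P3].
    have env3 : main_env t V e L R S lev s3.
      split; rewrite ?r3 // ?r2 //.
      by split; rewrite ?r3 // ?r2 // => q ql; rewrite m3 ?st2 //; move: ql lS; alia.
    apply: wp_seq; apply: (wp_weaken (leqnn _) _ (wp_coin_prog t0 w0 Sw w3 Nw levS tRw gw Nlo e1 (erefl lev) env3)).
    move=> s4 [env4 hc4].
    apply: wp_seq; apply: (wp_weaken (leqnn _) _ (wp_init_prog t0 w0 Sw w3 Nw levS tRw gw Nlo e1 (erefl lev) env4 hc4)).
    move=> s5 [env5 hc5 hF5].
    apply: wp_seq; apply: (wp_weaken (leqnn _) _ (wp_rounds_prog t0 w0 Sw w3 Nw levS tRw gw Nlo e1 (erefl lev) env5 hc5 R0 hF5)).
    move=> s6 [env6 [F6 [hF6 bfs6]]].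
    have dp6 : dp_table (usable V t) t (t + R + 1) pred0 R F6.
      by apply: dp_table0 bfs6; move: R0 inflt; alia.
    apply: wp_seq; apply: (wp_weaken (leqnn _) _ (wp_special_prog t0 w0 Sw w3 Nw levS tRw gw Nlo e1 (erefl lev) V0 LLS L0 env6 hF6 dp6)).
    move=> s7 [env7 [F7 [hF7 dp7]]].
    have [Finf at7 _] := dp7.
    apply: (wp_weaken (leqnn _) _ (wp_output_prog t0 w0 Sw w3 levS tRw Nlo env7 hF7 Finf)).
    move=> s8 out8 j jt; rewrite out8 //.
    apply: (min_coins_of_table uV V0 inflt Finf at7 _ jt).
    have ER : R = (6 * e).+1 * L by rewrite /R addn1.
    apply: (dp_table_final (inf := t + R + 1) (L := L) (Q := 6 * e)) => //.
    + by apply: exchange_bound => //; apply: leq_trans Nlo; move: Lt; alia.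
    + by rewrite mulnA.
    + by rewrite -ER.
  - by rewrite r2.
  - by rewrite r2.
  - by rewrite r2.
  - move=> i iV; rewrite m2 ?m1 //=; by move: iV nS; alia.
  - move=> v vS; rewrite m2 ?m1 ?beyond //; by move: vS nS; alia.
  - by move=> v /(allP Vw).
rewrite /run_time; cbv zeta; rewrite -/e -/L -/lev -/R.
move: cnt; move: (size V) (count _ _) => nV c cnt.
move: (e * 20 + L * 20 + 100) (lev * (e * 20 + 50) + 30) (work e lev * 1200 + 100 + _) => a b d.
by move: cnt; clear; lia.
Qed.

(** * Asymptotics *)

Import Order.TTheory Num.Theory.

Section Asymptotics.
Local Open Scope nat_scope.

(** The rounds dominate. Of the four factors e, one comes from the number of rounds, one from the
    levels, one from the layers of a transform and one from the padding. *)
Lemma run_time_le : exists C, forall t, 0 < t ->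
  run_time t <= C * (exponent t ^ 4 * (t * cube_root t)).
Proof.
(* 96 bounds W / (e^3 t), and 1300 = 1200 + 100 belongs to the transform of the marks and the
   initial table. With 7 e L bounding the number of rounds, 672 = 7 * 96 and 310 * 7 cover the
   rounds; the rest is room for lower terms. *)
exists (500 + 96 * 1300 + 672 * 3000 + 310 * 7 + 2000) => t t0.
have [Nlo Nhi e1 _] := exponent_spec t0.
have [Lcube Lt] := cube_root_spec t.
have L0 := L_gt0 t0 (erefl (cube_root t)).
rewrite /run_time; cbv zeta; rewrite /work /total.
move: (depth_spec (ltnW e1)) => [_].
move: (ltn_expl (depth (exponent t)) (isT : 1 < 2)).
move: (exponent t) (cube_root t) (depth (exponent t)) Nlo Nhi e1 Lt L0 {Lcube} => e L lev Nlo Nhi e1 Lt L0.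
move: (2 ^ lev) (2 ^ e) Nlo Nhi => l N Nlo Nhi levl le.
set W := lev.+1 * _; set U := e ^ 4 * (t * L).
have e0 : 0 < e by apply: ltnW.
have tL0 : 0 < t * L by rewrite muln_gt0 t0.
have pw a b : a <= e ^ 4 -> b <= t * L -> a * b <= U by exact: leq_mul.
have ee k : k <= 4 -> e ^ k <= e ^ 4 by move=> k4; rewrite leq_pexp2l.
have u1 : 1 <= U by have := pw 1 1; rewrite muln1; apply; rewrite ?expn_gt0 ?e0.
have ue : e <= U by have := pw e 1; rewrite muln1; apply => //; rewrite -{1}(expn1 e) ee.
have uee : e * e <= U by have := pw (e * e) 1; rewrite muln1; apply => //; exact: (ee 2).
have utL : t * L <= U by have := pw 1 (t * L); rewrite mul1n; apply => //; rewrite expn_gt0 e0.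
have ut : t <= U by apply: leq_trans utL; rewrite leq_pmulr.
have uL : L <= U by apply: leq_trans utL; rewrite leq_pmull.
have uLL : L * L <= U by apply: leq_trans utL; rewrite leq_mul2r Lt orbT.
have le2 : lev <= 2 * e by apply: leq_trans le; apply: ltnW.
have uW : W <= 96 * (e ^ 3 * t).
  have -> : 96 * (e ^ 3 * t) = (3 * e) * ((2 * e) * ((8 * t) * (2 * e))).
    by rewrite !expnS expn0; ring.
  apply: leq_mul; first by move: le2 e0; clear; lia.
  apply: leq_mul; first by move: e0; clear; lia.
  by apply: leq_mul => //; move: Nhi t0; clear; lia.
have e3t : e ^ 3 * t <= U by apply: leq_mul; [exact: ee | rewrite leq_pmulr].
have uW' : W <= 96 * U by apply: leq_trans uW _; rewrite leq_mul2l e3t orbT.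
have R7 : (6 * e + 1) * L <= 7 * (e * L).
  by rewrite mulnA leq_mul2r; apply/orP; right; move: e0; clear; lia.
have eL : e * L <= U.
  apply: leq_mul; first by rewrite -{1}(expn1 e) ee.
  by rewrite leq_pmull.
have uR : (6 * e + 1) * L <= 7 * U by apply: leq_trans R7 _; rewrite leq_mul2l eL orbT.
have uRW : (6 * e + 1) * L * W <= 672 * U.
  apply: leq_trans (leq_mul R7 uW) _.
  have -> : 7 * (e * L) * (96 * (e ^ 3 * t)) = 7 * 96 * (e ^ 4 * (t * L)).
    by rewrite !expnS expn0; ring.
  by rewrite leq_mul2r; apply/orP; right.
have ulev : lev * (e * 20 + 50) <= 140 * U.
  apply: (@leq_trans ((2 * e) * (70 * e))); first by apply: leq_mul => //; move: e0; clear; lia.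
  by rewrite mulnACA leq_mul2l uee orbT.
have uLt : L * t.+1 <= 2 * U.
  apply: (@leq_trans (2 * (t * L))); last by rewrite leq_mul2l utL orbT.
  have -> : 2 * (t * L) = L * (2 * t) by ring.
  by rewrite leq_mul2l; apply/orP; right; move: t0; clear; lia.
have -> : L * (L * 40 + t.+1 * 120 + 100) = L * L * 40 + L * t.+1 * 120 + L * 100 by ring.
have -> : (6 * e + 1) * L * (W * 3000 + 310) = (6 * e + 1) * L * W * 3000 + (6 * e + 1) * L * 310.
  by rewrite mulnDr mulnA.
move: u1 ue ut uL uLL uW' uR uRW ulev uLt.
generalize ((6 * e + 1) * L * W); generalize ((6 * e + 1) * L); generalize (lev * (e * 20 + 50)).
generalize (L * t.+1); generalize (L * L); generalize W; generalize U.
by clear; lia.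
Qed.
End Asymptotics.

Section BigO.
Variable R : realType.
Local Open Scope classical_set_scope.
Local Open Scope ring_scope.

(** Rounding up adds at most 1, which is at most the real cube root because t >= 1. *)
Lemma cube_root_le (t : nat) : (0 < t)%N -> (cube_root t)%:R <= 2 * t%:R `^ (1 / 3) :> R.
Proof.
move=> t0; set y := _ `^ _.
have tR : 1 <= t%:R :> R by rewrite ler1n.
have t3 : y ^+ 3 = t%:R.
  by rewrite -powR_mulrn ?powR_ge0 // /y -powRrM div1r mulVf ?powRr1 // pnatr_eq0.
have y0 : 0 <= y by exact: powR_ge0.
have y1 : 1 <= y.
  rewrite -(@ler_pXn2r _ 3) ?nnegrE // expr1n t3 //.
case E : (cube_root t) => [|l]; first by rewrite mulr_ge0.
have lt : (l * l * l < t)%N by apply: cube_root_min; rewrite E.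
have ly : l%:R <= y.
  rewrite -(@ler_pXn2r _ 3) ?nnegrE // t3 -natrX ler_nat !expnS expn0 muln1 mulnA.
  exact: ltnW.
by rewrite -natr1; lra.
Qed.

(** For t >= 2, 2^(e - 1) < 2t + 2 <= t^3, so e is at most 3 log t + 1 in base two, and log t >= 1
    absorbs the 1. *)
Lemma exponent_le (t : nat) : (1 < t)%N -> (exponent t)%:R <= 4 / ln 2 * ln t%:R :> R.
Proof.
move=> t1; have [_ _ e1 min] := exponent_spec (ltnW t1).
have : (2 ^ (exponent t).-1 < 2 * t + 2)%N by apply: min; rewrite prednK // ltnW.
have t3 : (2 * t + 2 <= t ^ 3)%N.
  have t2 : (4 <= t * t)%N by rewrite -[4%N]/(2 * 2)%N leq_mul.
  by rewrite !expnS expn0 muln1; have := leq_mul (leqnn t) t2; lia.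
case: (exponent t) e1 => // e e1 /= lt.
have {lt} : (2 ^ e <= t ^ 3)%N by apply: leq_trans t3; exact: ltnW.
rewrite -(ler_nat R) !natrX => h.
have t0R : 0 < t%:R :> R by rewrite ltr0n ltnW.
have ln2 : 0 < ln 2 :> R by rewrite ln_gt0 // ltr1n.
have : ln (2 ^+ e) <= ln (t%:R ^+ 3) :> R by rewrite ler_ln ?posrE ?exprn_gt0.
rewrite !lnXn //.
have : ln 2 <= ln t%:R :> R by rewrite ler_ln ?posrE // ler_nat.
rewrite mulrAC ler_pdivlMr // -[e.+1]addn1 natrD (mulrDl e%:R) mul1r -[ln 2 *+ e]mulr_natl -[ln t%:R *+ 3]mulr_natl.
by move: (ln 2) (ln t%:R) => x y; move: (e%:R * x) => z; lra.
Qed.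

Lemma run_time_bigO : (fun t : nat => (run_time t)%:R : R^o) =O_\oo
  (fun t : nat => (t%:R `^ (4 / 3) * ln t%:R ^+ 4 : R^o)).
Proof.
have [C hC] := run_time_le.
have ln2 : 0 < ln 2 :> R by rewrite ln_gt0 // ltr1n.
apply/eqO_exP; exists (C.+1%:R * (4 / ln 2) ^+ 4 * 2).
  by apply: mulr_gt0 => //; apply: mulr_gt0; rewrite ?ltr0n // exprn_gt0 // divr_gt0.
(* At t = 1 the logarithm vanishes, so the bound can only start at 2. *)
exists 2%N => // t /= t2.
have t1 : (0 < t)%N by apply: leq_trans t2.
have tR : 0 < t%:R :> R by rewrite ltr0n.
have lnt : 0 <= ln t%:R :> R by rewrite ln_ge0 // ler1n.
rewrite ger0_norm // ger0_norm; last by rewrite mulr_ge0 ?powR_ge0 ?exprn_ge0.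
apply: (@le_trans _ _ (C%:R * ((exponent t)%:R ^+ 4 * (t%:R * (cube_root t)%:R)))).
  by rewrite -natrX -!natrM ler_nat hC.
have p43 : t%:R `^ (4 / 3) = t%:R * t%:R `^ (1 / 3) :> R.
  rewrite (_ : 4 / 3 = 1 + 1 / 3); last by lra.
  by rewrite powRD ?powRr1 ?ler0n // gt_eqF ?implybT.
have he := exponent_le t2.
have hL := cube_root_le t1.
rewrite p43.
have -> : C.+1%:R * (4 / ln 2) ^+ 4 * 2 * (t%:R * t%:R `^ (1 / 3) * ln t%:R ^+ 4) =
  C.+1%:R * ((4 / ln 2 * ln t%:R) ^+ 4 * (t%:R * (2 * t%:R `^ (1 / 3)))) :> R.
  by rewrite exprMn; ring.
apply: ler_pM => //; rewrite ?mulr_ge0 ?exprn_ge0 // ?ler_nat //.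
apply: ler_pM => //; rewrite ?mulr_ge0 ?exprn_ge0 //.
  by rewrite lerXn2r // ?nnegrE // mulr_ge0 // divr_ge0 // ltW.
by rewrite ler_wpM2l.
Qed.
End BigO.

Local Open Scope classical_set_scope.
Local Open Scope ring_scope.

Theorem theorem1 (R : realType) :
  exists (p : prog) (c a : nat) (T : nat -> nat),
    solves_all_targets p c a T /\
    exists k : nat,
      (fun t : nat => (T t)%:R : R^o) =O_\oo
      (fun t : nat => (t%:R `^ (4 / 3) * ln t%:R ^+ k : R^o)).
Proof.
exists main_prog, 16%N, 40%N, run_time; split; first exact: main_prog_solves.
by exists 4%N; exact: run_time_bigO.
Qed.
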